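(* Let $a$ be the jump-diffusion coefficient $$a(\omega,x,y)=\overline a(x,y)+\Phi_1(W_1(\omega,x,y))+\Phi_2\big(W_2(\omega,l_1(\omega,x),l_2(\omega,y))\big),\qquad(\omega,x,y)\in\Omega\times\mathcal D,$$ described in the context, and let $f\in L^q(\Omega;H)$ and $g\in L^q(\Omega;L^2(\Gamma_2))$ for some $q\in[1,+\infty)$. Then for $\mathbb P$-almost every $\omega\in\Omega$ there exists a unique pathwise weak solution $u(\omega,\cdot)\in V$ to the problem $$-\nabla\cdot(a(\omega,\cdot)\nabla u(\omega,\cdot))=f(\omega,\cdot)\ \text{in }\mathcal D,\quad u(\omega,\cdot)=0\ \text{on }\Gamma_1,\quad a(\omega,\cdot)\,\overrightarrow n\cdot\nabla u(\omega,\cdot)=g(\omega,\cdot)\ \text{on }\Gamma_2 .$$ Furthermore, $u\in L^r(\Omega;V)$ for all $r\in[1,q)$ and $$\|u\|_{L^r(\Omega;V)}\le C(\overline a_-,\mathcal D)\big(\|f\|_{L^q(\Omega;H)}+\|g\|_{L^q(\Omega;L^2(\Gamma_2))}\big),$$ where $C(\overline a_-,\mathcal D)>0$ is a constant depending only on $\overline a_-$ and the volume of $\mathcal D$ (the decomposition $\partial\mathcal D=\Gamma_1\cup\Gamma_2$ being fixed throughout).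
   Context: $(\Omega,\mathcal F,\mathbb P)$ is a complete probability space, $0<D<+\infty$, $\mathcal D=(0,D)^2$, $H=L^2(\mathcal D)$. The boundary is decomposed as a disjoint union $\partial\mathcal D=\Gamma_1\cup\Gamma_2$ of two fixed $1$-dimensional manifolds (in particular $\Gamma_1$ has positive length) such that the exterior normal derivative $\overrightarrow n\cdot\nabla u$ on $\Gamma_2$ is well defined for every $u\in C^1(\overline{\mathcal D})$; $\overrightarrow n$ is the outward unit normal. $T:H^1(\mathcal D)\to H^{1/2}(\partial\mathcal D)$ is the trace operator, $V=\{v\in H^1(\mathcal D): Tv|_{\Gamma_1}=0\}$ with $\|v\|_V=\|v\|_{H^1(\mathcal D)}=\big(\int_{\mathcal D}|v|^2+\|\nabla v\|_2^2\,d\underline x\big)^{1/2}$. For a Banach space $B$ and $p\in[1,\infty)$, $L^p(\Omega;B)$ is the Bochner space of strongly measurable $Z:\Omega\to B$ with $\|Z\|_{L^p(\Omega;B)}=\mathbb E(\|Z\|_B^p)^{1/p}<\infty$. A pathwise weak solution for given $\omega$ is $u(\omega,\cdot)\in V$ with $$\int_{\mathcal D}a(\omega,\underline x)\nabla u(\omega,\underline x)\cdot\nabla v(\underline x)\,d\underline x=\int_{\mathcal D}f(\omega,\underline x)v(\underline x)\,d\underline x+\int_{\Gamma_2}g(\omega,\underline x)[Tv](\underline x)\,d\underline x\quad\text{for all }v\in V.$$ Ingredients of $a$: - $\overline a:\mathcal D\to(0,+\infty)$ is deterministic and continuous with $0<\overline a_-\le\overline a\le\overline a_+<\infty$ on $\mathcal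 D$ for constants $\overline a_\pm$. - $\Phi_1,\Phi_2:\mathbb R\to[0,+\infty)$ are continuous. - $W_1$ and $W_2$ are zero-mean real-valued Gaussian random fields on the closed square $[0,D]^2$ and on $[0,+\infty)^2$, respectively, with $\mathbb P$-a.s. continuous paths. - $l_1,l_2$ are Lévy subordinators on $[0,D]$ ($\mathbb P$-a.s. non-decreasing real-valued Lévy processes starting at $0$, with càdlàg paths), independent of the Gaussian random fields $W_1$ and $W_2$. *)

(* Defs.v *)
From HB Require Import structures.
From mathcomp Require Import all_boot all_order all_algebra.
From mathcomp Require Import all_classical all_reals all_analysis.

Set Implicit Arguments.
Unset Strict Implicit.
Unset Printing Implicit Defensive.

Import Order.TTheory GRing.Theory Num.Theory.
Import numFieldNormedType.Exports.

Local Open Scope classical_set_scope.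
Local Open Scope ring_scope.

Notation plane R := (R * R)%type.

Section PlaneLebesgue.
Variable R : realType.

Let leb2_prod :
    {measure set (measurableTypeR R * measurableTypeR R) -> \bar R} :=
  (@lebesgue_measure R \x @lebesgue_measure R)%E.

(* The library's product of Lebesgue measures, retyped on R * R: measurableTypeR
   R and R carry the same sigma-algebra under different displays. *)
Definition leb2 : set (plane R) -> \bar R :=
  (@lebesgue_measure R \x @lebesgue_measure R)%E.

Let leb20 : leb2 set0 = 0%E.
Proof. exact: (measure0 leb2_prod). Qed.

Let leb2_ge0 A : (0 <= leb2 A)%E.
Proof. exact: (measure_ge0 leb2_prod). Qed.

Let leb2_sigma_additive : semi_sigma_additive leb2.
Proof. exact: (@measure_semi_sigma_additive _ _ _ leb2_prod). Qed.

HB.instance Definition _ :=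
  isMeasure.Build _ _ _ leb2 leb20 leb2_ge0 leb2_sigma_additive.

End PlaneLebesgue.
Arguments leb2 : clear implicits.

Section Geometry.
Context {R : realType}.
Implicit Types (D : R) (z n : plane R) (M : set (plane R)).

Definition square D : set (plane R) :=
  [set z | 0 < z.1 < D /\ 0 < z.2 < D].

Definition csquare D : set (plane R) :=
  [set z | 0 <= z.1 <= D /\ 0 <= z.2 <= D].

Definition bsquare D : set (plane R) := csquare D `\` square D.

Definition quadrant : set (plane R) := [set z | 0 <= z.1 /\ 0 <= z.2].

(* Sides 0 to 3 of the square, each parametrised by arc length over [0, D]. *)
Definition side D (k : nat) (t : R) : plane R :=
  match k with
  | 0%N => (t, 0)
  | 1%N => (D, t)
  | 2%N => (t, D)
  | _ => (0, t)
  end.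

Lemma measurable_side D k : measurable_fun setT (side D k).
Proof.
by case: k => [|[|[|k]]]; apply: measurable_fun_pair;
  [exact: measurable_id | exact: measurable_cst
  | exact: measurable_cst | exact: measurable_id
  | exact: measurable_id | exact: measurable_cst
  | exact: measurable_cst | exact: measurable_id].
Qed.

Definition side_measure D (k : nat) : set (plane R) -> \bar R :=
  pushforward (mrestr (@lebesgue_measure R) (measurable_itv `[0, D]))
    (side D k).

Let side_push D k : {measure set (plane R) -> \bar R} :=
  measure_function_pushforward__canonical__measure_function_Measure
    (mrestr (@lebesgue_measure R) (measurable_itv `[0, D]))
    (measurable_side D k).

Let side_measure0 D k : side_measure D k set0 = 0%E.
Proof. exact: (measure0 (side_push D k)). Qed.

Let side_measure_ge0 D k A : (0 <= side_measure D k A)%E.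
Proof. exact: (measure_ge0 (side_push D k)). Qed.

Let side_measure_sigma_additive D k : semi_sigma_additive (side_measure D k).
Proof. exact: (@measure_semi_sigma_additive _ _ _ (side_push D k)). Qed.

HB.instance Definition _ D k := isMeasure.Build _ _ _ (side_measure D k)
  (side_measure0 D k) (side_measure_ge0 D k) (@side_measure_sigma_additive D k).

(* Arc length (one-dimensional surface measure) on the boundary of the square;
   the sides overlap at the four corners only, which are negligible. *)
Definition arclength D : set (plane R) -> \bar R := msum (side_measure D) 4.

HB.instance Definition _ D := Measure.on (arclength D).

(* One-dimensional topological manifold embedded in the plane, possibly with
   boundary points: locally homeomorphic to the line or to a half-line. Proper
   nonempty parts of the boundary of the square cannot both be manifolds
   without boundary. *)
Definition one_manifold M := forall z, M z ->
  exists (U : set (plane R)) (I : set R) (g : R -> plane R) (h : plane R -> R),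
    [/\ open U, U z & I = setT \/ I = [set t | 0 <= t]] /\
    [/\ {within I, continuous g}, {within M `&` U, continuous h},
        g @` I = M `&` U & {in I, cancel g h}].

(* Outward unit normal to the square at a boundary point: n is orthogonal to
   the tangent line of the boundary at z and points outwards. There is none
   at a corner. *)
Definition outward_normal D z n :=
  [/\ n.1 ^+ 2 + n.2 ^+ 2 = 1,
      forall e : R, 0 < e -> \forall w \near z, bsquare D w ->
        `|n.1 * (w.1 - z.1) + n.2 * (w.2 - z.2)| <= e * `|w - z|,
      \forall t \near 0^'+, ~ csquare D (z + t *: n)
    & \forall t \near 0^'+, square D (z - t *: n)].

Definition boundary_decomposition D (G1 G2 : set (plane R)) :=
  [/\ G1 `|` G2 = bsquare D, G1 `&` G2 = set0,
      one_manifold G1 & one_manifold G2] /\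
  [/\ (0 < arclength D G1)%E
    & forall z, G2 z -> exists! n, outward_normal D z n].

End Geometry.

(* Elements of the spaces L^2, H^1 and V are represented by functions; two
   representatives are the same element when they agree almost everywhere. *)

Section FunctionSpaces.
Context {R : realType}.
Implicit Types (D : R) (v w t phi : plane R -> R) (mu : {measure set (plane R) -> \bar R}).

Definition L2 mu (A : set (plane R)) : set (plane R -> R) :=
  [set v | v \_ A \in Lfun mu 2%:E].

Definition L2norm mu (A : set (plane R)) v : \bar R :=
  ('N[mu]_2%:E[EFin \o (v \_ A)])%E.

Definition basis (i : bool) : plane R := if i then (0, 1) else (1, 0).

Definition pderiv (i : bool) v : plane R -> R := fun z => 'D_(basis i) v z.

Fixpoint Ck (k : nat) v : Prop :=
  if k is k'.+1 then
    continuous v /\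
    forall i, (forall z, derivable v z (basis i)) /\ Ck k' (pderiv i v)
  else continuous v.

Definition test_function (A : set (plane R)) phi :=
  (forall k, Ck k phi) /\
  exists K, [/\ compact K, K `<=` A & forall z, ~ K z -> phi z = 0].

Definition is_weak_pderiv D (i : bool) v w :=
  L2 (leb2 R) (square D) w /\
  forall phi, test_function (square D) phi ->
    \int[leb2 R]_(z in square D) (v z * pderiv i phi z) =
    - \int[leb2 R]_(z in square D) (w z * phi z).

Definition weak_pderiv D (i : bool) v : plane R -> R :=
  xget (fun=> 0) [set w | is_weak_pderiv D i v w].

Definition H1 D : set (plane R -> R) :=
  [set v | L2 (leb2 R) (square D) v /\ forall i, exists w, is_weak_pderiv D i v w].

Definition H1norm D v : \bar R :=
  ((\int[leb2 R]_(z in square D)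
      (v z ^+ 2 + (weak_pderiv D false v z ^+ 2 + weak_pderiv D true v z ^+ 2))%:E)
   `^ 2^-1)%E.

(* t = Tv. The trace operator is the continuous extension to H^1 of the
   restriction map v |-> v|_{boundary} on C^1 functions, which are dense in
   H^1; its graph is thus the closure of the graph of the restriction map. *)
Definition is_trace D v t :=
  [/\ H1 D v, L2 (arclength D) (bsquare D) t
    & exists phi_ : nat -> plane R -> R,
      [/\ forall n, Ck 1 (phi_ n),
          H1norm D (phi_ n - v) @[n --> \oo] --> 0%E
        & L2norm (arclength D) (bsquare D) (phi_ n - t) @[n --> \oo] --> 0%E]].

Definition V D (G1 : set (plane R)) : set (plane R -> R) :=
  [set v | H1 D v /\
    exists2 t, is_trace D v t & {ae arclength D, forall z, G1 z -> t z = 0}].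

Definition weak_solution D (G1 G2 : set (plane R)) (a f g u : plane R -> R) :=
  V D G1 u /\
  forall v t, V D G1 v -> is_trace D v t ->
    \int[leb2 R]_(z in square D)
      (a z * (weak_pderiv D false u z * weak_pderiv D false v z
              + weak_pderiv D true u z * weak_pderiv D true v z)) =
    \int[leb2 R]_(z in square D) (f z * v z)
    + \int[arclength D]_(z in G2) (g z * t z).

End FunctionSpaces.

(* Bochner space of maps into the subspace B of E with (semi)norm N; strong
   measurability is being an almost sure limit of simple maps. *)
Section Bochner.
Context d (Omega : measurableType d) (R : realType) (P : probability Omega R).
Variables (E : zmodType) (B : set E) (N : E -> \bar R).

Definition simple_map (s : Omega -> E) :=
  [/\ finite_set (range s), forall y, measurable (s @^-1` [set y])
    & forall w, B (s w)].

Definition strongly_measurable (Z : Omega -> E) :=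
  exists s_ : nat -> Omega -> E, (forall n, simple_map (s_ n)) /\
    {ae P, forall w, N (s_ n w - Z w) @[n --> \oo] --> 0%E}.

Definition Bochner_norm (p : R) (Z : Omega -> E) : \bar R :=
  ('N[P]_p%:E[N \o Z])%E.

Definition Bochner (p : R) : set (Omega -> E) :=
  [set Z | [/\ forall w, B (Z w), strongly_measurable Z
             & (Bochner_norm p Z < +oo)%E]].

End Bochner.

Section Stochastic.
Context d (Omega : measurableType d) (R : realType) (P : probability Omega R).

(* Centred normal law, the degenerate case of variance 0 included. *)
Definition centered_gaussian (X : Omega -> R) :=
  measurable_fun setT X /\
  ((exists2 s : R, 0 < s &
      forall A, measurable A -> P (X @^-1` A) = normal_prob 0 s A) \/
   (forall A, measurable A -> P (X @^-1` A) = \d_(0 : R) A)).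

(* A vector is centred Gaussian when all linear combinations of its
   coordinates are centred normal. *)
Definition centered_gaussian_field (S : set (plane R))
    (W : Omega -> plane R -> R) :=
  forall (n : nat) (z : 'I_n -> plane R) (c : 'I_n -> R),
    (forall i, S (z i)) ->
    centered_gaussian (fun w => \sum_(i < n) c i * W w (z i)).

Definition continuous_paths (S : set (plane R)) (W : Omega -> plane R -> R) :=
  {ae P, forall w, {within S, continuous (W w)}}.

Definition cadlag (D : R) (l : R -> R) :=
  (forall t, 0 <= t < D -> l x @[x --> t^'+] --> l t) /\
  (forall t, 0 < t <= D -> cvg (l x @[x --> t^'-])).

Definition independent_increments (D : R) (l : Omega -> R -> R) :=
  forall (n : nat) (t : nat -> R) (A : nat -> set R),
    0 <= t 0%N -> (forall i, (i < n)%N -> t i <= t i.+1) -> t n <= D ->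
    (forall i, measurable (A i)) ->
    P [set w | forall i, (i < n)%N -> A i (l w (t i.+1) - l w (t i))] =
    (\prod_(i < n) P [set w | A i (l w (t i.+1) - l w (t i))%R])%E.

Definition stationary_increments (D : R) (l : Omega -> R -> R) :=
  forall (s t : R) (A : set R), 0 <= s -> s <= t -> t <= D -> measurable A ->
    P [set w | A (l w t - l w s)] = P [set w | A (l w (t - s) - l w 0)].

Definition stochastically_continuous (D : R) (l : Omega -> R -> R) :=
  forall t e : R, 0 <= t <= D -> 0 < e ->
    P [set w | e <= `|l w s - l w t|] @[s --> within `[0, D] (nbhs t)] --> 0%E.

Definition levy_process (D : R) (l : Omega -> R -> R) :=
  [/\ forall t, 0 <= t <= D -> measurable_fun setT (l ^~ t),
      {ae P, forall w, l w 0 = 0},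
      independent_increments D l,
      stationary_increments D l
    & stochastically_continuous D l].

Definition levy_subordinator (D : R) (l : Omega -> R -> R) :=
  [/\ levy_process D l,
      {ae P, forall w, cadlag D (l w)}
    & {ae P, forall w s t, 0 <= s -> s <= t -> t <= D -> l w s <= l w t}].

Definition events (T : Type) (S : set T) (X : Omega -> T -> R) :
    set (set Omega) :=
  [set A | exists2 t, S t & exists2 C, measurable C & A = (X ^~ t) @^-1` C].

Definition independent_classes (F G : set (set Omega)) :=
  forall A C, F A -> G C -> P (A `&` C) = (P A * P C)%E.

(* The pair (l1, l2) is independent of the pair (W1, W2). *)
Definition independent_of_fields (D : R) (l1 l2 : Omega -> R -> R)
    (W1 W2 : Omega -> plane R -> R) :=
  independent_classes
    <<s events `[0, D] l1 `|` events `[0, D] l2 >>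
    <<s events (csquare D) W1 `|` events quadrant W2 >>.

End Stochastic.

Definition jump_diffusion (R : realType) (Omega : Type) (abar : plane R -> R)
    (Phi1 Phi2 : R -> R) (W1 W2 : Omega -> plane R -> R)
    (l1 l2 : Omega -> R -> R) (w : Omega) (z : plane R) : R :=
  abar z + Phi1 (W1 w z) + Phi2 (W2 w (l1 w z.1, l2 w z.2)).

(* Main.v *)
Require Import Defs.
From HB Require Import structures.
From mathcomp Require Import all_boot all_order all_algebra.
From mathcomp Require Import all_classical all_reals all_analysis.
From mathcomp Require Import measurable_realfun ring lra.

(* For almost every outcome the coefficient is bounded on the square, and it is
   at least [am]. Hence the energy form [energy_form a u v], the integral of
   [a grad u . grad v], is an inner product on [V], equivalent to that of [H1]
   by the Poincare inequality; the Riesz representation of the load functional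
   is the unique weak solution, and its norm is bounded by a constant times the
   norm of the data. The trace and Poincare inequalities are first shown for C1
   functions by joining points of the square to points of a side by segments
   parallel to the axes.

   Measurability of the solution does not use stability under perturbation of
   the coefficient. Let [(e j)] be dense in [V] and [F] the load functional.
   Then the energy of [u - e k] is the supremum over [j] of
   [2 (F (e j) - energy_form a (e k) (e j)) - energy_form a (e j) (e j)], so it
   is a measurable function of the outcome as soon as the coefficient is jointly
   measurable; the best approximation of [u] among [e 0, ..., e n] is then a
   simple map, and these maps converge to [u]. Joint measurability comes from
   right-continuity of subordinators and continuity of the Gaussian fields.

   The bound on moments integrates the pathwise bound, with Minkowski's
   inequality and monotonicity of [L^p] norms on a probability space. *)

Set Implicit Arguments.
Unset Strict Implicit.
Unset Printing Implicit Defensive.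

Import Order.TTheory GRing.Theory Num.Theory.
Import numFieldNormedType.Exports.

Local Open Scope classical_set_scope.
Local Open Scope ring_scope.

(** * Semi-inner product spaces *)

(** The upper bound of the coefficient depends on the outcome and no moment of it is available, so
    it may serve only in qualitative steps such as equivalence of norms; every quantitative constant
    comes from [am] and the fixed geometry, and the final constant is chosen before the probability
    space. The jumps are the reason to avoid perturbing the coefficient: two coefficients that jump
    along different lines stay apart in the supremum norm, so approximation by countably many
    coefficients is not at hand, whereas the energy distance to a dense sequence of [V] needs no
    topology on coefficients.

    Since no quotient is formed, weak derivatives and traces are picked by choice and are linear
    only almost everywhere. Uniqueness of weak derivatives needs a supply of smooth compactly
    supported functions, built from exp(-1/x). Uniqueness of traces is the trace inequality: it
    makes the closure of the graph of the restriction map a graph. No measurability of [G1] is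
    assumed, so the Poincare inequality is run on the measurable zero set of a trace, which contains
    [G1] up to a null set. *)

Section SemiHilbert.
Context {R : realType} {E : lmodType R}.
Implicit Types (B M : set E) (b : E -> E -> R).

(* Vectors are only constrained on the subset [B], and [b] may vanish on
   nonzero vectors: function spaces are used without passing to classes modulo
   almost everywhere equality. *)
Record semi_inner B b : Prop := SemiInner {
  si_0 : B 0;
  si_lin : forall c x y, B x -> B y -> B (c *: x + y);
  si_sym : forall x y, B x -> B y -> b x y = b y x;
  si_linl : forall c x y z, B x -> B y -> B z ->
    b (c *: x + y) z = c * b x z + b y z;
  si_ge0 : forall x, B x -> 0 <= b x x }.

(** Cauchy sequences with this explicit rate are the only ones that occur: minimising sequences
    satisfy it by the parallelogram identity, and in [L2] it gives a geometrically convergent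
    subsequence with explicit indices. *)
Definition semi_complete B b := forall (u : nat -> E) (K : R),
  (forall n, B (u n)) ->
  (forall m n, (m <= n)%N -> b (u m - u n) (u m - u n) <= K / m.+1%:R) ->
  exists2 x, B x & b (u n - x) (u n - x) @[n --> \oo] --> 0.

Section Basics.
Variables (B : set E) (b : E -> E -> R) (H : semi_inner B b).

Lemma siD x y : B x -> B y -> B (x + y).
Proof. by move=> Bx By; rewrite -[x]scale1r; apply: (si_lin H). Qed.

Lemma siZ c x : B x -> B (c *: x).
Proof. by move=> Bx; rewrite -[_ *: _]addr0; apply: (si_lin H) => //; exact: si_0 H. Qed.

Lemma siB x y : B x -> B y -> B (x - y).
Proof. by move=> Bx By; rewrite addrC -scaleN1r; apply: (si_lin H). Qed.

Lemma sibDl x y z : B x -> B y -> B z -> b (x + y) z = b x z + b y z.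
Proof. by move=> Bx By Bz; rewrite -[x]scale1r (si_linl H) // scale1r mul1r. Qed.

Lemma sib0l z : B z -> b 0 z = 0.
Proof.
move=> Bz; have := sibDl (si_0 H) (si_0 H) Bz.
by rewrite addr0 => /eqP; rewrite -subr_eq0 opprD addNKr oppr_eq0 => /eqP.
Qed.

Lemma sibZl c x z : B x -> B z -> b (c *: x) z = c * b x z.
Proof.
move=> Bx Bz; rewrite -[_ *: _]addr0 (si_linl H) // ?sib0l ?addr0 //.
exact: si_0 H.
Qed.

Lemma sibBl x y z : B x -> B y -> B z -> b (x - y) z = b x z - b y z.
Proof.
by move=> Bx By Bz; rewrite addrC -scaleN1r (si_linl H) // mulN1r addrC.
Qed.

Lemma sib_sqrD c x y : B x -> B y ->
  b (x + c *: y) (x + c *: y) = b x x + 2 * c * b x y + c ^+ 2 * b y y.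
Proof.
move=> Bx By; have Bcy := siZ c By; have Bs := siD Bx Bcy.
rewrite sibDl // sibZl // (si_sym H _ Bs) // (si_sym H _ Bs) //.
rewrite !sibDl // !sibZl // (si_sym H By Bx); ring.
Qed.

Lemma si_CS x y : B x -> B y -> b x y ^+ 2 <= b x x * b y y.
Proof.
move=> Bx By.
have K t : 0 <= b x x + 2 * t * b x y + t ^+ 2 * b y y.
  by rewrite -sib_sqrD //; apply: (si_ge0 H); apply/siD/siZ.
have [y0|y0] := eqVneq (b y y) 0.
  have [->|n0] := eqVneq (b x y) 0; first by rewrite expr0n y0 mulr0.
  (* The parameter is chosen to make the nonnegative polynomial equal to -1. *)
  have := K (- (b x x + 1) / (2 * b x y)); rewrite y0 mulr0 addr0.
  rewrite (_ : 2 * _ * _ = - (b x x + 1)); last by field.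
  by rewrite opprD addrA subrr add0r oppr_ge0 ler10.
have yp : 0 < b y y by rewrite lt_def y0 (si_ge0 H).
have := K (- b x y / b y y).
rewrite (_ : _ + _ = (b x x * b y y - b x y ^+ 2) / b y y); last by field.
by rewrite pmulr_lge0 ?invr_gt0 // subr_ge0.
Qed.

Lemma sib_sqrD_le x y : B x -> B y ->
  b (x + y) (x + y) <= 2 * b x x + 2 * b y y.
Proof.
move=> Bx By.
have := sib_sqrD 1 Bx By; have := sib_sqrD (-1) Bx By; rewrite !scale1r => h1 h2.
have := si_ge0 H (siD Bx (siZ (-1) By)); lra.
Qed.

Lemma sib_sqrN x : B x -> b (- x) (- x) = b x x.
Proof.
move=> Bx; have Bn : B (-1 *: x) by exact: siZ.
rewrite -scaleN1r sibZl // (si_sym H) // sibZl //; ring.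
Qed.

Lemma sib_sqrB_le x y z : B x -> B y -> B z ->
  b (x - z) (x - z) <= 2 * b (x - y) (x - y) + 2 * b (y - z) (y - z).
Proof.
by move=> Bx By Bz; rewrite -[x - z](subrKA y); apply: sib_sqrD_le; exact: siB.
Qed.

End Basics.

(* Only rational combinations are required of [M], so that the closest-point
   argument also applies to the countable rational span of a sequence. *)
Lemma semi_projection B b M x : semi_inner B b -> semi_complete B b ->
    M `<=` B -> M !=set0 ->
    (forall (c : rat) y z, M y -> M z -> M (ratr c *: y + z)) -> B x ->
  exists (s : nat -> E) (p : E), [/\ forall n, M (s n), B p,
    b (s n - p) (s n - p) @[n --> \oo] --> 0 & forall y, M y -> b (x - p) y = 0].
Proof.
move=> H cplt MB [m0 Mm0] Mlin Bx.
pose A := [set b (x - m) (x - m) | m in M].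
have A0 : A !=set0 by exists (b (x - m0) (x - m0)); exists m0.
have BxM m : M m -> B (x - m) by move=> /MB Bm; exact: (siB H).
have lA : has_lbound A.
  by exists 0 => _ [m Mm <-]; apply: (si_ge0 H); exact: BxM.
set dd := inf A.
have dle m : M m -> dd <= b (x - m) (x - m).
  by move=> Mm; apply: ge_inf => //; exists m.
have /choice[s sP] : forall n : nat, exists m,
    M m /\ b (x - m) (x - m) < dd + n.+1%:R^-1.
  move=> n; have [|_ [m Mm <-] lt] := @inf_adherent _ A n.+1%:R^-1 _ (conj A0 lA).
    by rewrite invr_gt0 ltr0n.
  by exists m.
have Bs n : B (s n) by apply: MB; case: (sP n).
(* With u = x - s m and v = x - s n, the parallelogram identity gives |u - v|^2 = 2 |u|^2 + 2 |v|^2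
   - |u + v|^2, and |u + v|^2 >= 4 dd because the midpoint of [s m] and [s n] lies in [M]. What
   remains is at most 2/(m+1) + 2/(n+1) <= 4/(m+1). *)
have [||p Bp ps] := cplt s 4.
- by [].
- move=> m n mn.
  pose mid := ratr 2^-1 *: s m + (ratr 2^-1 *: s n + 0).
  have M0 : M 0.
    have := Mlin (-1) _ _ Mm0 Mm0.
    by rewrite rmorphN1 scaleN1r addNr.
  have Mmid : M mid by apply: (Mlin); [case: (sP m)|apply: (Mlin) => //; case: (sP n)].
  have h0 := dle _ Mmid.
  have Bu := BxM _ (proj1 (sP m)); have Bv := BxM _ (proj1 (sP n)).
  set u := x - s m in Bu; set v := x - s n in Bv.
  have emid : x - mid = 2^-1 *: (u + 1 *: v).
    rewrite /mid /u /v addr0 -scalerDr scale1r addrACA -opprD scalerBr.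
    rewrite (_ : ratr 2^-1 = 2^-1 :> R); last by rewrite fmorphV /= (ratr_nat R 2).
    rewrite (_ : x + x = 2 *: x); last by rewrite scaler_nat mulr2n.
    by rewrite scalerA mulVf ?pnatr_eq0 // scale1r.
  have esub : s m - s n = v + (-1) *: u.
    by rewrite /u /v scaleN1r opprB [RHS]addrC subrKA.
  have Buv : B (u + 1 *: v) by apply: (siD H) => //; exact: (siZ H).
  have Buv' := siZ H 2^-1 Buv.
  rewrite emid (sibZl H) // (si_sym H) // (sibZl H) // (sib_sqrD H) // in h0.
  rewrite esub (sib_sqrD H) // (si_sym H Bv Bu).
  have /= h1 := proj2 (sP m); have /= h2 := proj2 (sP n).
  have h3 : n.+1%:R^-1 <= m.+1%:R^-1 :> R by rewrite lef_pV2 ?posrE ?ltr0n // ler_nat.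
  rewrite -/u -/v in h1 h2; rewrite expr1n in h0; rewrite sqrrN expr1n.
  move: h0 h1 h2 h3; set im := m.+1%:R^-1; set jn := n.+1%:R^-1; lra.
exists s, p; split => //; first by move=> n; case: (sP n).
move=> y My; have By := MB _ My.
set be := b (x - p) y; set Y := b y y; have Y0 : 0 <= Y by exact: (si_ge0 H).
(* The limit [p] need not lie in [M], so minimality is used at [s n] against [s n + t y]; the
   discrepancy [b (s n - p) y] is controlled by the nonnegative square of [s n - p - t y], and n
   tends to infinity. *)
have key (t : rat) : ratr t * be <= ratr t ^+ 2 * Y.
  set tt : R := ratr t.
  have : 2 * tt * be - 2 * tt ^+ 2 * Y <= 0; last by lra.
  have cvg0 : (n.+1%:R^-1 + b (s n - p) (s n - p)) @[n --> \oo] --> (0 : R).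
    by rewrite -[X in _ --> X]addr0; apply: cvgD => //; exact: cvg_harmonic.
  have /cvg_lim <- // := cvg0.
  apply: limr_ge; first by apply/cvg_ex; eexists; exact: cvg0.
  near=> n.
  have Msty : M (ratr t *: y + s n) by apply: Mlin => //; case: (sP n).
  have Bsp : B (s n - p) by exact: (siB H).
  have Bxs : B (x - s n) by exact: (siB H).
  have := dle _ Msty.
  rewrite opprD addrCA addrC -scaleNr (sib_sqrD H) // => h1.
  have := si_ge0 H (siD H Bsp (siZ H (- tt) By)).
  rewrite (sib_sqrD H) // => h2.
  have h3 : be = b (x - s n) y + b (s n - p) y.
    by rewrite -(sibDl H) // /be addrA subrK.
  have /= h4 := proj2 (sP n).
  rewrite -/tt in h1; rewrite h3 -/Y sqrrN in h1 h2 *.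
  by move: h1 h2 h4; set jn := n.+1%:R^-1; lra.
(* Take t = 1/(n+1) and t = -1/(n+1), which are rational, divide by |t| and let n grow. *)
suff [h1 h2] : be <= 0 /\ - be <= 0 by apply/eqP; rewrite eq_le h1 -oppr_le0.
have cv0 : (n.+1%:R^-1 * Y) @[n --> \oo] --> (0 : R).
  by rewrite -[X in _ --> X](mul0r Y); apply: cvgMl; exact: cvg_harmonic.
have ne0 n : (0 : R) < n.+1%:R by rewrite ltr0n.
split; rewrite -(cvg_lim _ cv0) //; apply: limr_ge;
  try (by apply/cvg_ex; eexists; exact: cv0); near=> n;
  rewrite -(ler_pM2l (x := n.+1%:R^-1)) ?invr_gt0 // mulrA -expr2.
- by have := key n.+1%:R^-1; rewrite fmorphV /= ratr_nat.
- by have := key (- n.+1%:R^-1); rewrite rmorphN fmorphV /= ratr_nat mulrN mulNr sqrrN.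
Unshelve. all: by end_near.
Qed.

(** The classical argument through the kernel of [F]: if [F x0] is nonzero, the residual [z] of the
    projection of [x0] onto the closed kernel is orthogonal to the kernel, and a multiple of [z]
    represents [F]. The quadratic bound does two jobs: [F] vanishes at the projection, which is only
    known as a limit of points of the kernel, and [b z z] is nonzero although [b] may be
    degenerate. *)
Lemma semi_riesz B b (F : E -> R) (C : R) :
    semi_inner B b -> semi_complete B b ->
    (forall c x y, B x -> B y -> F (c *: x + y) = c * F x + F y) ->
    (forall x, B x -> F x ^+ 2 <= C * b x x) ->
  exists2 r, B r & forall y, B y -> b r y = F y.
Proof.
move=> H cplt Flin Fbd.
have F0 : F 0 = 0.
  have := Flin 1 _ _ (si_0 H) (si_0 H); rewrite scaler0 addr0 mul1r.
  by move/eqP; rewrite eq_sym -subr_eq0 addrK => /eqP.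
have FZ c x : B x -> F (c *: x) = c * F x.
  by move=> Bx; rewrite -[_ *: _]addr0 Flin ?F0 ?addr0 //; exact: si_0 H.
have FB x y : B x -> B y -> F (x - y) = F x - F y.
  by move=> Bx By; rewrite addrC -scaleN1r Flin // mulN1r addrC.
have [[x0 [Bx0 Fx0]]|nF] := pselect (exists x, B x /\ F x != 0); last first.
  exists 0; first exact: si_0 H.
  move=> y By; rewrite (sib0l H) //; apply/esym/eqP; case: eqVneq => // Fy.
  by case: nF; exists y.
pose M := [set x | B x /\ F x = 0].
have [||||s [p [Ms Bp sp orth]]] := @semi_projection B b M x0 H cplt.
- by move=> x [].
- by exists 0; split => //; exact: si_0 H.
- move=> c y z [By Fy] [Bz Fz]; split; first exact: (si_lin H).
  by rewrite Flin // Fy Fz mulr0 addr0.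
- by [].
have Fp : F p = 0.
  apply/eqP; rewrite -sqrf_eq0 eq_le sqr_ge0 andbT.
  have cv : (C * b (s n - p) (s n - p)) @[n --> \oo] --> (0 : R).
    by rewrite -[X in _ --> X](mulr0 C); exact: cvgMr.
  rewrite -(cvg_lim _ cv) //; apply: limr_ge; first by apply/cvg_ex; eexists; exact: cv.
  near=> n; have [Bsn Fsn] := Ms n.
  by rewrite -sqrrN -[- F p]add0r -Fsn -FB // Fbd //; exact: (siB H).
set z := x0 - p in orth; have Bz : B z by exact: (siB H).
have Fz : F z = F x0 by rewrite FB // Fp subr0.
have bz : b z z != 0.
  apply/eqP => bz0; have := Fbd _ Bz; rewrite bz0 mulr0 => h.
  have : F z ^+ 2 == 0 by rewrite eq_le h sqr_ge0.
  by rewrite sqrf_eq0 Fz (negbTE Fx0).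
exists (F z / b z z *: z); first exact: (siZ H).
move=> y By; rewrite (sibZl H) //.
set t := - (F y / F z).
have Mt : M (t *: z + y).
  split; first exact: (si_lin H).
  by rewrite Flin // mulNr divfK ?Fz // addNr.
have := orth _ Mt; rewrite (si_sym H) //; last exact: (si_lin H).
rewrite (si_linl H) // (si_sym H By Bz) => /eqP; rewrite addrC addr_eq0 => /eqP ->.
rewrite /t; field.
by rewrite bz Fz Fx0.
Unshelve. all: by end_near.
Qed.

(* Rational combinations are indexed by [{poly rat}], a countable type. *)
Definition rat_span (S : nat -> E) (p : {poly rat}) : E :=
  \sum_(i < size p) ratr p`_i *: S i.

Lemma rat_span_widen S (p : {poly rat}) n : (size p <= n)%N ->
  rat_span S p = \sum_(i < n) ratr p`_i *: S i.
Proof.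
move=> le_pn; rewrite /rat_span (big_ord_widen _ (fun i => ratr p`_i *: S i) le_pn).
rewrite [LHS]big_mkcond; apply: eq_bigr => i _; case: ifP => // /negbT.
by rewrite -leqNgt => /(nth_default _) ->; rewrite rmorph0 scale0r.
Qed.

Lemma rat_span_lin S (c : rat) (p q : {poly rat}) :
  rat_span S (c *: p + q) = ratr c *: rat_span S p + rat_span S q.
Proof.
pose n := maxn (size (c *: p + q)%R) (maxn (size p) (size q)).
rewrite !(@rat_span_widen _ _ n) ?leq_max ?leqnn ?orbT // scaler_sumr -big_split.
apply: eq_bigr => i _ /=.
by rewrite coefD coefZ rmorphD rmorphM /= scalerDl scalerA.
Qed.

(** The difference between [x] and its projection onto the closure of the rational span is
    orthogonal to every [S k], hence null by totality, so points of the span come arbitrarily close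
    to [x]. Rational coefficients make the span countable. *)
Lemma semi_dense B b (S : nat -> E) : semi_inner B b -> semi_complete B b ->
    (forall k, B (S k)) ->
    (forall x, B x -> (forall k, b x (S k) = 0) -> b x x = 0) ->
  exists e : nat -> E, (forall k, B (e k)) /\
    forall x (eps : R), B x -> 0 < eps -> exists k, b (x - e k) (x - e k) < eps.
Proof.
move=> H cplt BS tot.
have Bspan p : B (rat_span S p).
  rewrite /rat_span; elim/big_ind: _ => [||i _]; first exact: si_0 H.
    by move=> ? ?; exact: (siD H).
  by apply: (siZ H).
pose e k := if unpickle k is Some p then rat_span S p else 0.
exists e; split=> [k|x eps Bx eps0].
  by rewrite /e; case: unpickle => //; exact: si_0 H.
pose M := range (rat_span S).
have [||||s [p [Ms Bp sp orth]]] := @semi_projection B b M x H cplt.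
- by move=> _ [p _ <-].
- by exists (rat_span S 0), 0.
- by move=> c _ _ [p _ <-] [q _ <-]; exists (c *: p + q) => //; exact: rat_span_lin.
- by [].
have b0 : b (x - p) (x - p) = 0.
  apply: tot => [|k]; first exact: (siB H).
  apply: orth; exists 'X^k => //.
  rewrite (@rat_span_widen _ _ k.+1) ?size_polyXn // big_ord_recr /= big1 ?add0r.
    by rewrite coefXn eqxx rmorph1 scale1r.
  by move=> i _; rewrite coefXn ltn_eqF // rmorph0 scale0r.
have e4 : 0 < eps / 4 by rewrite divr_gt0.
have /cvgrPdist_lt/(_ _ e4) [N _ /(_ N (leqnn N))] := sp.
rewrite sub0r normrN => hN; have [q _ sq] := Ms N.
have BsN : B (s N) by rewrite -sq.
exists (pickle q); rewrite /e pickleK sq.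
apply: (le_lt_trans (sib_sqrB_le H Bx Bp BsN)).
rewrite b0 mulr0 add0r -(sib_sqrN H) ?opprB; last exact: (siB H).
have := ler_norm (b (s N - p) (s N - p)); lra.
Qed.

End SemiHilbert.

(** * Square integrable functions *)

(** Translates between the norms of the statement, which are extended-real square roots, and the
    real quadratic forms of the Hilbert space arguments. *)
Lemma sqrt_cvg0P (R : realType) (a : nat -> R) : (forall n, 0 <= a n) ->
  (a n @[n --> \oo] --> 0) <-> ((Num.sqrt (a n))%:E @[n --> \oo] --> 0%E).
Proof.
move=> a0; split=> [cv|].
  apply: cvg_EFin; first exact: nearW.
  rewrite /= -[X in _ --> X](sqrtr0 R).
  by apply: (@cvg_comp _ _ _ _ (fun y => Num.sqrt y) _ _ _ cv); exact: sqrt_continuous.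
move=> /fine_cvgP [_ /=] cv.
have -> : a = (fun n => Num.sqrt (a n) ^+ 2).
  by apply/funext => n; rewrite sqr_sqrtr.
have -> : 0 = 0 ^+ 2 :> R by rewrite expr0n.
by apply: (@cvg_comp _ _ _ _ (fun y => y ^+ 2) _ _ _ cv); exact: exprn_continuous.
Qed.

Section SquareIntegrable.
Context d (T : measurableType d) (R : realType) (mu : {measure set T -> \bar R}).
Implicit Types (f g h : T -> R).

Definition ip f g : R := (\int[mu]_x (f x * g x))%R.

Definition sqint : set (T -> R) := [set f | f \in Lfun mu 2%:E].

Lemma sqint_measurable f : sqint f -> measurable_fun setT f.
Proof. by rewrite /sqint /= inE => /andP[/[!inE]]. Qed.

Lemma sqint_sqr_lty f : sqint f -> (\int[mu]_x ((f x ^+ 2)%:E) < +oo)%E.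
Proof.
by move=> /Lfun2_integrable_sqr /integrable_lty; apply; exact: measurableT.
Qed.

Lemma abse_powR2 (x : R) : (`|x%:E| `^ 2 = (x ^+ 2)%:E)%E.
Proof. by rewrite /= powR_mulrn // real_normK // num_real. Qed.

Lemma Lnorm2E f : ('N[mu]_2%:E[EFin \o f] = (\int[mu]_x ((f x ^+ 2)%:E)) `^ 2^-1)%E.
Proof.
by rewrite unlock /Lnorm; congr (_ `^ _)%E; apply: eq_integral => x _; rewrite abse_powR2.
Qed.

Lemma sqintP f : measurable_fun setT f ->
  (\int[mu]_x ((f x ^+ 2)%:E) < +oo)%E -> sqint f.
Proof.
move=> mf foo; rewrite /sqint /= inE; apply/andP; split; rewrite inE //=.
by rewrite /finite_norm Lnorm2E; apply: poweR_lty.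
Qed.

Lemma sqint_le (c : R) f g : measurable_fun setT f -> sqint g ->
  (forall x, f x ^+ 2 <= c * g x ^+ 2) -> sqint f.
Proof.
move=> mf g2 fg; apply: sqintP => //.
have ig := Lfun2_integrable_sqr g2.
apply: (@integrable_lty _ _ _ mu) => //.
apply: (@le_integrable _ _ _ mu _ measurableT _ (fun x => c%:E * (g x ^+ 2)%:E)%E).
- by apply/measurable_EFinP; exact: measurable_funX.
- move=> x _ /=; rewrite lee_fin ger0_norm ?sqr_ge0 //.
  by apply: (le_trans (fg x)); exact: ler_norm.
- exact: integrableZl.
Qed.

Lemma sqint_integrable f g : sqint f -> sqint g ->
  mu.-integrable setT (EFin \o (fun x => f x * g x)).
Proof. by move=> f2 g2; apply/Lfun1_integrable; apply: Lfun2_mul_Lfun1. Qed.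

Lemma sqint_lin c f g : sqint f -> sqint g -> sqint (c *: f + g).
Proof.
have [_ H] := @Lfun_submod_closed _ T R mu 2%:E (lee1n 2).
by rewrite /sqint /= => f2 g2; apply: H.
Qed.

Lemma sqint0 : sqint 0.
Proof.
by have [H _] := @Lfun_submod_closed _ T R mu 2%:E (lee1n 2); exact: H.
Qed.

Lemma sqint_semi_inner : semi_inner sqint ip.
Proof.
split.
- exact: sqint0.
- by move=> c f g; exact: sqint_lin.
- by move=> f g _ _; apply: eq_Rintegral => x _; rewrite mulrC.
- move=> c f g h f2 g2 h2; rewrite /ip -RintegralZl //; last exact: sqint_integrable.
  rewrite -RintegralD //; [|exact: integrableZl (sqint_integrable f2 h2)
                           |exact: sqint_integrable].
  by apply: eq_Rintegral => x _; rewrite !fctE mulrDl -mulrA.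
- by move=> f _; apply: Rintegral_ge0 => x _; rewrite -expr2 sqr_ge0.
Qed.

Lemma ip_sqrE f : sqint f -> ((ip f f)%:E = \int[mu]_x ((f x ^+ 2)%:E))%E.
Proof.
move=> f2; rewrite /ip /Rintegral fineK //.
  by apply: integrable_fin_num => //; exact: sqint_integrable.
Qed.

Lemma poweR_sqrt (x : R) : 0 <= x -> (x%:E `^ 2^-1 = (Num.sqrt x)%:E)%E.
Proof. by move=> x0; rewrite poweR_EFin powR12_sqrt. Qed.

Lemma Lnorm2_sqrt f : sqint f ->
  'N[mu]_2%:E[EFin \o f]%E = (Num.sqrt (ip f f))%:E.
Proof.
move=> f2; rewrite Lnorm2E -ip_sqrE // poweR_sqrt //.
exact: (si_ge0 sqint_semi_inner).
Qed.

Lemma eq_ae_ip f f' g g' : sqint f -> sqint f' -> sqint g -> sqint g' ->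
  {ae mu, forall x, f x = f' x} -> {ae mu, forall x, g x = g' x} ->
  ip f g = ip f' g'.
Proof.
move=> f2 f2' g2 g2' ff' gg'; rewrite /ip /Rintegral; congr fine.
apply: ae_eq_integral => //.
- by apply/measurable_EFinP; apply: measurable_funM; exact: sqint_measurable.
- by apply/measurable_EFinP; apply: measurable_funM; exact: sqint_measurable.
- by move: ff' gg'; apply: filterS2 => x -> ->.
Qed.

Lemma ip_eq0 f : sqint f -> ip f f = 0 -> {ae mu, forall x, f x = 0}.
Proof.
move=> f2 f0; have mf := sqint_measurable f2.
have := @ae_eq_integral_abs _ _ _ mu setT measurableT (fun x => (f x ^+ 2)%:E).
case => [|+ _].
  by apply/measurable_EFinP; exact: measurable_funX.
have -> : (\int[mu]_x `|(f x ^+ 2)%:E| = 0)%E.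
  rewrite -[RHS]/(0%:E) -f0 ip_sqrE //; apply: eq_integral => x _.
  by rewrite gee0_abs // lee_fin sqr_ge0.
move=> /(_ erefl); apply: filterS => x /(_ I) [] /eqP.
by rewrite sqrf_eq0 => /eqP.
Qed.

Lemma sqint_ae f g : measurable_fun setT g -> sqint f ->
  {ae mu, forall x, f x = g x} -> sqint g.
Proof.
move=> mg f2 fg; have mf := sqint_measurable f2.
apply: sqintP => //; apply: le_lt_trans (sqint_sqr_lty f2).
rewrite le_eqVlt; apply/orP; left; apply/eqP.
apply: ae_eq_integral => //; try by apply/measurable_EFinP; exact: measurable_funX.
by move: fg; apply: filterS => x ->.
Qed.

Lemma sqint_bounded (c : R) f g : measurable_fun setT f -> sqint g ->
  (forall x, `|f x| <= c) -> sqint (fun x => f x * g x).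
Proof.
move=> mf g2 fc; apply: (@sqint_le (c ^+ 2) _ g) => //.
  by apply: measurable_funM => //; exact: sqint_measurable.
move=> x; rewrite exprMn ler_wpM2r ?sqr_ge0 // -real_normK ?num_real //.
by rewrite lerXn2r ?nnegrE // (le_trans _ (fc x)).
Qed.

(** Write d for the n-th increment. The integrals of 2^n d^2 are at most K 2^-n, so the sum of these
    functions is finite almost everywhere; where it is finite, |d| <= (2^-n + 2^n d^2) / 2 makes the
    increments absolutely summable. *)
Lemma fast_cvg_ae (v : nat -> T -> R) (K : R) : (forall n, sqint (v n)) ->
  (forall n, ip (v n.+1 - v n) (v n.+1 - v n) <= K * 4^-1 ^+ n) ->
  {ae mu, forall x, cvgn (v ^~ x)}.
Proof.
move=> v2 vK; have K0 : 0 <= K.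
  have := vK 0%N; rewrite expr0 mulr1; apply: le_trans.
  by apply: (si_ge0 sqint_semi_inner); exact: (siB sqint_semi_inner).
pose D n x := v n.+1 x - v n x.
have D2 n : sqint (v n.+1 - v n) by exact: (siB sqint_semi_inner).
have mD n : measurable_fun setT (D n) by exact: sqint_measurable (D2 n).
pose t n x := ((2 ^+ n * D n x ^+ 2)%:E : \bar R).
have t0 n x : (0 <= t n x)%E by rewrite lee_fin mulr_ge0 ?sqr_ge0 // exprn_ge0.
have mt n : measurable_fun setT (t n).
  by apply/measurable_EFinP; apply: measurable_funM => //; exact: measurable_funX.
have hfin : (\int[mu]_x (\sum_(0 <= n <oo) t n x) < +oo)%E.
  rewrite integral_nneseries //.
  apply: (@le_lt_trans _ _ (K / (1 - 2^-1))%:E); last exact: ltry.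
  apply: lime_le.
    by apply: is_cvg_nneseries => n _ _; exact: integral_ge0.
  apply: nearW => n.
  apply: le_trans (_ : (\sum_(0 <= i < n) (K * 2^-1 ^+ i)%:E <= _)%E).
    apply: lee_sum => i _.
    rewrite /t; under eq_integral do rewrite EFinM.
    rewrite ge0_integralZl //; last 2 first.
    - by apply/measurable_EFinP; exact: measurable_funX.
    - by move=> x _; rewrite lee_fin sqr_ge0.
    rewrite -(ip_sqrE (D2 i)) -EFinM lee_fin.
    apply: (@le_trans _ _ (2 ^+ i * (K * 4^-1 ^+ i))).
      by rewrite ler_wpM2l ?exprn_ge0.
    by rewrite mulrCA ler_wpM2l // -exprMn (_ : 2 * 4^-1 = 2^-1) //; lra.
  rewrite sumEFin lee_fin; apply: (@geometric_le_lim _ n K 2^-1) => //.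
  by rewrite ger0_norm; lra.
have mh : measurable_fun setT (fun x => \sum_(0 <= n <oo) t n x)%E.
  by apply: ge0_emeasurable_sum => // n x _ _; exact: t0.
have h0 x : (0 <= \sum_(0 <= n <oo) t n x)%E by exact: nneseries_ge0.
have : mu.-integrable setT (fun x => \sum_(0 <= n <oo) t n x)%E.
  apply/integrableP; split => //.
  by under eq_integral do rewrite gee0_abs //.
move=> /integrable_ae -/(_ measurableT); apply: filterS => x /(_ I) hx.
set h := (fine (\sum_(0 <= n <oo) t n x)%E).
have part n : \sum_(0 <= i < n) (2 ^+ i * D i x ^+ 2) <= h.
  rewrite -lee_fin /h fineK // -sumEFin.
  exact: (@nneseries_lim_ge _ (t ^~ x) xpredT).
have bound n : [normed series (D ^~ x)] n <= 2^-1 * (2 + h).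
  apply: (@le_trans _ _ (2^-1 * (\sum_(0 <= i < n) 2^-1 ^+ i +
      \sum_(0 <= i < n) (2 ^+ i * D i x ^+ 2)))).
    rewrite -big_split mulr_sumr; apply: ler_sum => i _ /=.
    have p0 : (0 : R) < 2 ^+ i by rewrite exprn_gt0.
    rewrite exprVn -(ler_pM2l p0) -subr_ge0.
    have -> : 2 ^+ i * (2^-1 * ((2 ^+ i)^-1 + 2 ^+ i * D i x ^+ 2)) -
        2 ^+ i * `|D i x| = 2^-1 * (1 - 2 ^+ i * `|D i x|) ^+ 2.
      rewrite -[D i x ^+ 2]real_normK ?num_real //; field.
      by rewrite gt_eqF.
    by rewrite mulr_ge0 // sqr_ge0.
  rewrite ler_wpM2l // lerD //.
  have := @geometric_le_lim R n 1 2^-1 ler01; rewrite /series /geometric /=.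
  under eq_bigr do rewrite mul1r.
  move=> H; apply: (le_trans (H _ _)); [lra|by rewrite ger0_norm; lra|].
  by rewrite (_ : 1 - 2^-1 = 2^-1) ?div1r ?invrK //; lra.
have : cvgn [normed series (D ^~ x)].
  apply: nondecreasing_is_cvgn.
    by apply: nondecreasing_series => n _ _; exact: normr_ge0.
  by exists (2^-1 * (2 + h)) => _ [n _ <-]; exact: bound.
move=> /normed_cvg cD.
have -> : v ^~ x = (fun n => v 0%N x + series (D ^~ x) n).
  by apply/funext => n; rewrite /series /= telescope_sumr // addrC subrK.
apply: is_cvgD => //; exact: is_cvg_cst.
Qed.

(** The indices [4 ^ k] turn the rate [K / m.+1] into a geometric one, so that subsequence converges
    almost everywhere. Fatou's lemma then bounds the distance from each [u n] to the pointwise limit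
    by the same rate. *)
Lemma sqint_complete : semi_complete sqint ip.
Proof.
move=> u K u2 uK.
have H := sqint_semi_inner.
pose v k := u (4 ^ k)%N.
have v2 k : sqint (v k) by exact: u2.
have K0 : 0 <= K.
  have := uK 0%N 0%N (leqnn _); rewrite divr1; apply: le_trans.
  by apply: (si_ge0 H); exact: (siB H).
have vK k : ip (v k.+1 - v k) (v k.+1 - v k) <= K * 4^-1 ^+ k.
  rewrite -opprB (sib_sqrN H); last exact: (siB H).
  apply: (le_trans (uK _ _ _)); first by rewrite leq_exp2l.
  rewrite ler_wpM2l // exprVn lef_pV2 ?posrE ?exprn_gt0 ?ltr0n //.
  by rewrite -natrX ler_nat.
have [N [mN N0 Nv]] := fast_cvg_ae v2 vK.
(* Set to 0 on the exceptional null set, so that the limit exists at every point and is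
   measurable. *)
pose w k x := v k x * \1_(~` N) x.
have mw k : measurable_fun setT (w k).
  apply: measurable_funM; first exact: sqint_measurable.
  by apply: measurable_indic; exact: measurableC.
have wv k : {ae mu, forall x, v k x = w k x}.
  exists N; split => // x /= nx; apply: contrapT => Nx; apply: nx.
  by rewrite /w indicE mem_set // mulr1.
have w2 k : sqint (w k) by apply: sqint_ae (wv k) => //; exact: mw.
have cw x : cvgn (w ^~ x).
  have [Nx|Nx] := pselect (N x).
    have -> : w ^~ x = fun=> 0.
      by apply/funext => k; rewrite /w indicE memNset ?mulr0.
    exact: is_cvg_cst.
  have -> : w ^~ x = v ^~ x.
    by apply/funext => k; rewrite /w indicE mem_set ?mulr1.
  by apply: contrapT => nc; apply: Nx; apply: Nv.
pose f x := limn (w ^~ x).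
have mf : measurable_fun setT f.
  by apply: (measurable_fun_cvg mw) => x _; exact: cw.
have fatou_bound n : (\int[mu]_x (((u n - f) x ^+ 2)%:E) <= (K / n.+1%:R)%:E)%E.
  have mg k : measurable_fun setT (fun x => ((u n x - w k x) ^+ 2)%:E).
    apply/measurable_EFinP; apply: measurable_funX; apply: measurable_funB => //.
    exact: sqint_measurable.
  have := @fatou _ _ _ mu _ measurableT _ mg.
  have -> : (\int[mu]_x limn_einf (fun k => ((u n x - w k x) ^+ 2)%:E) =
      \int[mu]_x ((u n - f) x ^+ 2)%:E)%E.
    apply: eq_integral => x _.
    suff cv : ((u n x - w k x) ^+ 2)%:E @[k --> \oo] --> ((u n - f) x ^+ 2)%:E.
      by have [-> _] := cvg_limn_einf_sup cv.
    apply: cvg_EFin; first exact: nearW.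
    apply: (@cvg_comp _ _ _ (fun k => u n x - w k x) (fun y => y ^+ 2)).
      by apply: cvgB; [exact: cvg_cst|exact: cw].
    exact: exprn_continuous.
  move=> fat; apply: (le_trans (fat _)); first by move=> k x _; rewrite lee_fin sqr_ge0.
  rewrite limn_einf_lim; apply: lime_le; first exact: is_cvg_einfs.
  (* From j = n on, the index [4 ^ j] of the subsequence is beyond n, where the Cauchy bound
     applies. *)
  exists n => // j /= nj.
  apply: le_trans (_ : (\int[mu]_x ((u n x - w j x) ^+ 2)%:E <= _)%E).
    by apply: ereal_inf_lbound; exists j => //=.
  have s2 : sqint (u n - w j) by exact: (siB H).
  rewrite -(ip_sqrE s2) lee_fin.
  have s2' : sqint (u n - v j) by exact: (siB H).
  have e : {ae mu, forall x, (u n - w j) x = (u n - v j) x}.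
    by move: (wv j); apply: filterS => x /= wx; rewrite !fctE wx.
  rewrite (eq_ae_ip s2 s2' s2 s2' e e) /v; apply: uK.
  by apply: (leq_trans nj); apply: ltnW; exact: ltn_expl.
have uf2 n : sqint (u n - f).
  apply: sqintP; last exact: le_lt_trans (fatou_bound n) (ltry _).
  by apply: measurable_funB => //; exact: sqint_measurable.
exists f.
  by rewrite -[f](subKr (u 0%N)); exact: (siB H).
apply: (@squeeze_cvgr _ _ _ _ (fun=> 0) (fun n => K / n.+1%:R)).
- near=> n; rewrite (si_ge0 H) //= -lee_fin ip_sqrE //.
- exact: cvg_cst.
- by rewrite -[X in _ --> X](mulr0 K); apply: cvgMr; exact: cvg_harmonic.
Unshelve. all: by end_near.
Qed.

Lemma sqint_cvgP (u : nat -> T -> R) f : (forall n, sqint (u n - f)) ->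
  (ip (u n - f) (u n - f) @[n --> \oo] --> 0) <->
  ('N[mu]_2%:E[EFin \o (u n - f)%R]%E @[n --> \oo] --> 0%E).
Proof.
move=> u2; have -> : (fun n => 'N[mu]_2%:E[EFin \o (u n - f)%R]%E) =
    (fun n => (Num.sqrt (ip (u n - f) (u n - f)))%:E).
  by apply/funext => n; exact: Lnorm2_sqrt.
apply: sqrt_cvg0P => n; exact: (si_ge0 sqint_semi_inner).
Qed.

End SquareIntegrable.

(** * Lebesgue measure on the plane *)

Section PlaneMeasure.
Context {R : realType}.

(* [y] is approached from the right by [(floor (n y) + 1) / n]. *)
Lemma measurable_fun_right_continuous d (T : measurableType d) (B : set R)
    (h : T * R -> R) : measurable B ->
    (forall y, measurable_fun setT (fun t => h (t, y))) ->
    (forall t y, B y -> h (t, s) @[s --> y^'+] --> h (t, y)) ->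
  measurable_fun (setT `*` B) h.
Proof.
move=> mB mh ch.
pose g (n : nat) (y : R) : R := ((Num.floor (n.+1%:R * y) + 1)%:~R) / n.+1%:R.
have n0 (n : nat) : 0 < n.+1%:R :> R by rewrite ltr0n.
have gy n y : y < g n y <= y + n.+1%:R^-1.
  rewrite /g ltr_pdivlMr // mulrC floorD1_gt //=.
  rewrite ler_pdivrMr // mulrDl mulVf ?gt_eqF // intrD lerD2r mulrC.
  exact: floor_le_tmp.
pose H n (z : T * R) := h (z.1, g n z.2).
have mH n : measurable_fun (setT `*` B) (H n).
  apply: measurable_funTS => _ Y mY; rewrite setTI.
  have -> : H n @^-1` Y = \bigcup_(i : int)
      ([set t | Y (h (t, (i + 1)%:~R / n.+1%:R))] `*`
       `[i%:~R / n.+1%:R, (i + 1)%:~R / n.+1%:R[).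
    apply/seteqP; split => [[t y] /= Yh|[t y] [i _ /= [Yh]]].
      exists (Num.floor (n.+1%:R * y)) => //=; split => //.
      by rewrite in_itv /= ler_pdivrMr // ltr_pdivlMr // mulrC floor_le_tmp floorD1_gt.
    rewrite in_itv /= ler_pdivrMr // ltr_pdivlMr // mulrC => iy.
    by rewrite /H /= /g (floor_def iy).
  apply: countable_bigcupT_measurable => //.
  move=> i; apply: measurableX => //.
  by have := mh ((i + 1)%:~R / n.+1%:R) measurableT Y mY; rewrite setTI.
apply: (measurable_fun_cvg mH) => -[t y] [_ /= By].
have /cvg_at_rightP := ch t y By; apply; split.
  by move=> n; have /andP[] := gy n y.
apply: (@squeeze_cvgr _ _ _ _ (fun=> y) (fun n => y + n.+1%:R^-1)).
- by apply: nearW => n; have /andP[/ltW -> ->] := gy n y.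
- exact: cvg_cst.
- by rewrite -[X in _ --> X]addr0; apply: cvgD; [exact: cvg_cst|exact: cvg_harmonic].
Qed.

Lemma continuous_plane_measurable (f : plane R -> R) :
  continuous f -> measurable_fun setT f.
Proof.
move=> cf; rewrite -setXTT.
apply: measurable_fun_right_continuous => // [y|t y _].
  apply: continuous_measurable_fun => x.
  apply: (@cvg_comp _ _ _ (fun x => (x, y)) f _ (nbhs (x, y))); last exact: cf.
  exact: (@cvg_pair _ _ _ (nbhs x) (nbhs x) (nbhs y) _ _ _ id (cst y) cvg_id (@cvg_cst _ _ _ _ _)).
suff H : f (t, s) @[s --> y] --> f (t, y) by exact: cvg_at_right_filter H.
apply: (@cvg_comp _ _ _ (fun s => (t, s)) f _ (nbhs (t, y))); last exact: cf.
exact: (@cvg_pair _ _ _ (nbhs y) (nbhs t) (nbhs y) _ _ _ (cst t) id (@cvg_cst _ _ _ _ _) cvg_id).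
Qed.

Local Notation mu := (@lebesgue_measure R).
Let leb2_prod : {measure set (measurableTypeR R * measurableTypeR R) -> \bar R} :=
  (mu \x mu)%E.
(** [leb2] and the product measure agree on all sets but live on types with different displays;
    integrals are carried from one to the other by pushing forward along the identity. *)
Let idp : measurableTypeR R * measurableTypeR R -> plane R := id.
Let midp : measurable_fun setT idp. Proof. by move=> _ A mA; rewrite setTI. Qed.
Let push : {measure set (plane R) -> \bar R} :=
  measure_function_pushforward__canonical__measure_function_Measure leb2_prod midp.

Lemma ge0_integral_leb2 (f : plane R -> \bar R) : measurable_fun setT f ->
    (forall z, (0 <= f z)%E) ->
  (\int[leb2 R]_z f z = \int[mu]_x \int[mu]_y f (x, y))%E /\
  (\int[leb2 R]_z f z = \int[mu]_y \int[mu]_x f (x, y))%E.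
Proof.
move=> mf f0.
have E : (\int[leb2 R]_z f z = \int[leb2_prod]_z f z)%E.
  rewrite (@eq_measure_integral _ _ _ _ push) => [|A mA _ //].
  by rewrite (ge0_integral_pushforward midp leb2_prod measurableT).
by split; rewrite E; [rewrite fubini_tonelli1|rewrite fubini_tonelli2].
Qed.

Lemma integral_leb2 (f : plane R -> \bar R) : (leb2 R).-integrable setT f ->
  (\int[leb2 R]_z f z = \int[mu]_x \int[mu]_y f (x, y))%E /\
  (\int[leb2 R]_z f z = \int[mu]_y \int[mu]_x f (x, y))%E.
Proof.
move=> /[dup] fint /integrableP [mf finf].
have fint' : leb2_prod.-integrable setT f.
  apply/integrableP; split => //.
  move: finf; rewrite (@eq_measure_integral _ _ _ _ push) => [|A mA _ //].
  by rewrite (ge0_integral_pushforward midp leb2_prod measurableT) //; exact: measurableT_comp.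
have E : (\int[leb2 R]_z f z = \int[leb2_prod]_z f z)%E.
  rewrite (@eq_measure_integral _ _ _ _ push) => [|A mA _ //].
  by rewrite (@integral_pushforward _ _ _ _ _ idp midp leb2_prod setT f).
by rewrite E; split; [rewrite -integral12_prod_meas1|rewrite -integral21_prod_meas1].
Qed.

Lemma leb2X (A B : set R) : measurable A -> measurable B ->
  leb2 R (A `*` B) = (mu A * mu B)%E.
Proof. by move=> mA mB; rewrite /leb2 product_measure1E. Qed.

Lemma squareE (D : R) : square D = `]0, D[ `*` `]0, D[.
Proof. by apply/seteqP; split => z /=; rewrite !in_itv. Qed.

Lemma csquareE (D : R) : csquare D = `[0, D] `*` `[0, D].
Proof. by apply/seteqP; split => z /=; rewrite !in_itv. Qed.

Lemma measurable_square (D : R) : measurable (square D).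
Proof. by rewrite squareE; exact: measurableX. Qed.

Lemma measurable_csquare (D : R) : measurable (csquare D).
Proof. by rewrite csquareE; exact: measurableX. Qed.

Lemma measurable_bsquare (D : R) : measurable (bsquare D).
Proof. by apply: measurableD; [exact: measurable_csquare|exact: measurable_square]. Qed.

Lemma leb2_square (D : R) : 0 < D -> leb2 R (square D) = (D ^+ 2)%:E.
Proof.
move=> D0; rewrite squareE leb2X // lebesgue_measure_itv /= lte_fin D0.
by rewrite -EFinD subr0 -EFinM.
Qed.

End PlaneMeasure.

(** * Test functions on the square *)

Section Bump.
Context {R : realType}.
Implicit Types (P : {poly R}) (x t : R).

(* The functions [P(1/x) exp(-1/x)] on [x > 0], extended by [0], are stable
   under derivation; this is how the smoothness of [exp(-1/x)] is proved. *)
Definition flat P x : R := if 0 < x then P.[x^-1] * expR (- x^-1) else 0.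

(** With y = 1/x, so that dy/dx = - y^2, the derivative of P(y) exp(-y) in x is y^2 (P(y) - P'(y))
    exp(-y). *)
Definition dflat P : {poly R} := 'X^2 * (P - P^`()).

(** Each monomial is handled by y^i exp(-y) <= i!, read off the exponential series. *)
Lemma flat_bounded P : exists2 C, 0 <= C & forall x, `|flat P x| <= C.
Proof.
exists (\sum_(i < size P) `|P`_i| * i`!%:R).
  by apply: sumr_ge0 => i _; rewrite mulr_ge0.
move=> x; rewrite /flat; case: ifPn => [x0|_]; last first.
  by rewrite normr0 sumr_ge0 // => i _; rewrite mulr_ge0.
rewrite horner_coef mulr_suml; apply: le_trans (ler_norm_sum _ _ _) _.
apply: ler_sum => i _; rewrite -mulrA normrM ler_wpM2l //.
have y0 : 0 <= x^-1 by rewrite invr_ge0 ltW.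
rewrite ger0_norm ?mulr_ge0 ?exprn_ge0 ?expR_ge0 // expRN ler_pdivrMr ?expR_gt0 //.
case: (nat_of_ord i) => [|n].
  by rewrite expr0 fact0 mul1r (le_trans _ (expR_ge1Dx _)) // lerDl.
rewrite mulrC -ler_pdivrMr ?ltr0n ?fact_gt0 //.
by apply: le_trans (expR_ge1Dxn n y0); rewrite lerDr.
Qed.

Lemma flatX P x : x != 0 -> flat ('X * P) x = x^-1 * flat P x.
Proof.
by rewrite /flat; case: ifP => [_ _|]; rewrite ?mulr0 // hornerM hornerX mulrA.
Qed.

Lemma is_derive_flat P x : is_derive x 1 (flat P) (flat (dflat P) x).
Proof.
have [x0|x0|->] := ltgtP x 0.
- rewrite {2}/flat ltNge ltW //=.
  apply: (@near_eq_is_derive _ _ _ (cst 0)) => //.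
  near=> y; rewrite /flat ltNge ltW //=.
  by near: y; exact: lt_nbhsl.
- have xn0 : x != 0 by rewrite gt_eqF.
  pose F (y : R) : R := P.[y^-1] * expR (- y^-1).
  suff dF : is_derive x 1 F (flat (dflat P) x).
    apply: near_eq_is_derive dF; near=> y; rewrite /flat ifT //.
    by near: y; exact: lt_nbhsr.
  rewrite /flat x0 /dflat !hornerE.
  have dP : is_derive (x^-1) 1 (horner P) P^`().[x^-1] by exact: is_derive_poly.
  have dV : is_derive x 1 (fun y : R => y^-1) (- x ^- 2).
    by have := is_deriveV xn0 (is_derive_id x 1); rewrite /GRing.scale /= mulr1.
  have dVN : is_derive x 1 (fun y : R => - y^-1) (- - x ^- 2) by exact: is_deriveN.
  have dE := @is_derive1_comp _ expR (fun y => - y^-1) x _ _ (is_derive_expR _) dVN.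
  have dPV := @is_derive1_comp _ (horner P) (fun y => y^-1) x _ _ dP dV.
  apply: is_derive_eq (is_deriveM dPV dE) _; rewrite /= /GRing.scale /=; field.
  exact: xn0.
have -> : flat (dflat P) 0 = 0 by rewrite /flat ltxx.
(* One factor 'X absorbs the division by h in the difference quotient at 0; the other leaves a
   factor h in front of a bounded function. *)
have [C C0 hC] := flat_bounded ('X * ('X * P)).
suff H : h^-1 *: (flat P (h *: 1 + 0) - flat P 0) @[h --> 0^'] --> (0 : R).
  by apply: DeriveDef; [apply/cvg_ex; exists 0|exact: cvg_lim H].
have C1 : 0 < C + 1 by rewrite ltr_wpDl.
apply/cvgrPdist_le => e e0; near=> h.
have h0 : h != 0 by near: h; exact: nbhs_dnbhs_neq.
rewrite sub0r normrN addr0 {2}/flat ltxx subr0 /GRing.scale /= mulr1.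
rewrite -flatX // -[flat _ _](mulVKf h0) -flatX // normrM.
apply: (@le_trans _ _ (`|h| * C)); first by rewrite ler_wpM2l.
apply: (@le_trans _ _ (`|h| * (C + 1))); first by rewrite ler_wpM2l // lerDl.
rewrite -ler_pdivlMr //; near: h.
by apply: dnbhs0_le; rewrite divr_gt0.
Unshelve. all: by end_near.
Qed.

Lemma flat1_ge0 x : 0 <= flat 1 x.
Proof. by rewrite /flat; case: ifP => // _; rewrite hornerC mul1r expR_ge0. Qed.

Lemma flat1_le1 x : flat 1 x <= 1.
Proof.
rewrite /flat; case: ifP => // x0; rewrite hornerC mul1r expR_le1 oppr_le0.
by rewrite invr_ge0 ltW.
Qed.

(** The shift by 1 makes the n-th function vanish for x <= 1/(n+1), so that products of such
    functions have compact support inside the open square, without changing the limit. *)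
Lemma flat1_cvg x : 
  flat 1 (n.+1%:R * x - 1) @[n --> \oo] --> (if 0 < x then 1 else 0 : R).
Proof.
case: ifPn => x0; last first.
  apply: cvg_near_cst; near=> n; rewrite /flat ifF //.
  apply/negbTE; rewrite -leNgt subr_le0; apply: (@le_trans _ _ 0) => //.
  by rewrite mulr_ge0_le0 // leNgt.
apply/cvgrPdist_le => e e0; near=> n.
rewrite ger0_norm ?subr_ge0 ?flat1_le1 //.
have y0 : e^-1 <= n.+1%:R * x - 1.
  rewrite lerBrDr -ler_pdivrMr // -natr1 -lerBlDr.
  by near: n; exact: nbhs_infty_ger.
have yp : 0 < n.+1%:R * x - 1 by rewrite (lt_le_trans _ y0) ?invr_gt0.
rewrite /flat yp hornerC mul1r lerBlDr -lerBlDl.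
apply: le_trans (expR_ge1Dx _); rewrite lerD2l lerN2.
by rewrite invf_ple.
Unshelve. all: by end_near.
Qed.

End Bump.

Section Regularity.
Context {R : realType}.
Implicit Types (f g : plane R -> R) (z v : plane R).

Lemma CkS k f : Ck k.+1 f -> Ck k f.
Proof.
elim: k f => [|k IH] f [cf H]; first exact: cf.
by split=> // i; have [df Cf] := H i; split => //; exact: IH.
Qed.

Lemma CkD k f g : Ck k f -> Ck k g -> Ck k (f + g).
Proof.
elim: k f g => [|k IH] f g /=.
  by move=> cf cg z; apply: cvgD; [exact: cf|exact: cg].
move=> [cf Hf] [cg Hg]; split; first by move=> z; apply: cvgD; [exact: cf|exact: cg].
move=> i; have [df Cf] := Hf i; have [dg Cg] := Hg i; split.
  by move=> z; exact: derivableD.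
have -> : pderiv i (f + g) = pderiv i f + pderiv i g.
  by apply/funext => z; rewrite /pderiv deriveD.
exact: IH.
Qed.

Lemma CkM k f g : Ck k f -> Ck k g -> Ck k (f * g).
Proof.
elim: k f g => [|k IH] f g.
  by move=> cf cg z; apply: cvgM; [exact: cf|exact: cg].
move=> /[dup] /CkS Cf [cf Hf] /[dup] /CkS Cg [cg Hg]; split.
  by move=> z; apply: cvgM; [exact: cf|exact: cg].
move=> i; have [df Cdf] := Hf i; have [dg Cdg] := Hg i; split.
  by move=> z; exact: derivableM.
have -> : pderiv i (f * g) = f * pderiv i g + g * pderiv i f.
  by apply/funext => z; rewrite /pderiv deriveM.
by apply: CkD; exact: IH.
Qed.

Lemma Ck_cst k (c : R) : Ck k (cst c : plane R -> R).
Proof.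
elim: k c => [|k IH] c; first by move=> z; exact: cvg_cst.
split=> [|i]; first by move=> z; exact: cvg_cst.
split=> [z|]; first exact: derivable_cst.
have -> : pderiv i (cst c) = cst 0.
  by apply/funext => z; rewrite /pderiv derive_cst.
exact: IH.
Qed.

Definition coord (i : bool) z : R := if i then z.2 else z.1.

Definition line (i : bool) z (s : R) : plane R := if i then (z.1, s) else (s, z.2).

Lemma coord_line i z s : coord i (line i z s) = s.
Proof. by case: i. Qed.

Lemma line_coord i z : line i z (coord i z) = z.
Proof. by case: i z => -[]. Qed.

Lemma line_step i z (s h : R) : h *: Defs.basis i + line i z s = line i z (h + s).
Proof.
by case: i; rewrite /line /Defs.basis; apply/pair_equal_spec => /=;
  rewrite /GRing.scale /= ?mulr0 ?mulr1 ?add0r.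
Qed.

Lemma is_derive_line i f z (s df : R) :
  is_derive (line i z s) (Defs.basis i) f df <->
  is_derive s (1 : R) (fun s => f (line i z s)) df.
Proof.
have E : (fun h : R => h^-1 *: ((f \o shift (line i z s)) (h *: Defs.basis i) - f (line i z s))) =
    (fun h : R => h^-1 *: (((fun s => f (line i z s)) \o shift s) (h *: (1 : R)) -
       f (line i z s))).
  by apply/funext => h; rewrite /= line_step /GRing.scale /= mulr1.
by split=> -[d1 d2]; constructor; move: d1 d2; rewrite /derivable /derive E.
Qed.

Lemma derivable_line i f z s : derivable f (line i z s) (Defs.basis i) ->
  is_derive s (1 : R) (fun s => f (line i z s)) (pderiv i f (line i z s)).
Proof. by move=> df; apply/is_derive_line; constructor. Qed.

Lemma Ck_flat k (i : bool) (P : {poly R}) (al be : R) :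
  Ck k (fun z => flat P (al * coord i z + be)).
Proof.
have cont P' : continuous (fun z => flat P' (al * coord i z + be)).
  move=> z; apply: (@cvg_comp _ _ _ (fun z => al * coord i z + be) (flat P')); last first.
    apply: differentiable_continuous; apply/derivable1_diffP.
    by have [] := is_derive_flat P' (al * coord i z + be).
  apply: cvgD; last exact: cvg_cst.
  by apply: cvgMr; case: (i); [exact: cvg_snd|exact: cvg_fst].
elim: k P => [|k IH] P; first exact: cont.
split; first exact: cont.
move=> j.
have D z : is_derive z (Defs.basis j) (fun z => flat P (al * coord i z + be))
    (if j == i then al * flat (dflat P) (al * coord i z + be) else 0).
  rewrite -(line_coord j z); apply/is_derive_line.
  case: eqVneq => [->|ji]; last first.
    rewrite (_ : (fun s => _) = cst (flat P (al * coord i z + be))).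
      exact: is_derive_cst.
    by apply/funext => s; congr (flat P (al * _ + be)); move: ji; case: (j); case: (i).
  rewrite (_ : (fun s => _) = flat P \o (fun s => al * s + be)); last first.
    by apply/funext => s /=; rewrite coord_line.
  rewrite coord_line mulrC; apply: is_derive1_comp; first exact: is_derive_flat.
  apply: is_derive_eq; rewrite ?addr0; exact: mulr1.
split; first by move=> z; have [] := D z.
have -> : pderiv j (fun z => flat P (al * coord i z + be)) =
    fun z => (if j == i then al else 0) * flat (dflat P) (al * coord i z + be).
  by apply/funext => z; rewrite /pderiv; have [_ ->] := D z; case: ifP; rewrite ?mul0r.
apply: (@CkM k (cst _)); last exact: IH.
exact: Ck_cst.
Qed.

End Regularity.

(** * Integrable functions orthogonal to all test functions *)

Section PiSystemIntegral.
Context d (T : measurableType d) d' (T' : measurableType d') (R : realType).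
Variables (mu : {measure set T -> \bar R}) (f : T -> \bar R) (p : T -> T').
Hypotheses (intf : mu.-integrable setT f) (mp : measurable_fun setT p).

(** The integrand is signed, so the induction runs over the Dynkin system of sets with vanishing
    integral. Taking a coordinate for [p] and a strip for [I] frees one coordinate of a product set
    while the other stays fixed. *)
Lemma integral0_pi_system (I : set T) (G : set (set T')) : measurable I ->
    (@measurable _ T' = <<s G >>) -> setI_closed G ->
    (\int[mu]_(x in I) f x = 0)%E ->
    (forall B, G B -> \int[mu]_(x in I `&` p @^-1` B) f x = 0)%E ->
  forall B, measurable B -> (\int[mu]_(x in I `&` p @^-1` B) f x = 0)%E.
Proof.
move=> mI mG GI I0 G0 B mB.
have mpB A : measurable A -> measurable (I `&` p @^-1` A).
  by move=> mA; apply: measurableI => //; rewrite -[_ @^-1` _]setTI; exact: mp.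
apply: (@dynkin_induction _ T' G
  (fun B => (\int[mu]_(x in I `&` p @^-1` B) f x = 0)%E)) => //.
- by rewrite preimage_setT setIT.
- move=> S mS S0.
  have IE : I = (I `&` p @^-1` S) `|` (I `&` p @^-1` (~` S)).
    by rewrite -setIUr preimage_setC setUv setIT.
  move: I0; rewrite {1}IE integral_setU //.
  + by rewrite S0 add0e.
  + exact: mpB.
  + by apply: mpB; exact: measurableC.
  + by apply: measurable_funTS; exact: measurable_int intf.
  + apply/eqP; rewrite preimage_setC setIACA setICr.
    by rewrite setIid setI0.
- move=> F mF tF F0; rewrite preimage_bigcup setI_bigcupr integral_bigcup //.
  + by apply: eseries0 => n _ _; exact: F0.
  + apply/trivIsetP => i j _ _ ij.
    have /trivIsetP tF' := tF.
    rewrite setIACA -[X in _ `&` X]preimage_setI tF' //.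
    by rewrite preimage_set0 setI0.
  + by move=> k; exact: mpB.
  + apply: integrableS intf => //.
    by apply: bigcup_measurable => k _; exact: mpB.
- by rewrite -mG.
Qed.

End PiSystemIntegral.

Section TestFunctions.
Context {R : realType}.
Implicit Types (D a c : R) (z : plane R).

(** Rational endpoints keep the family of corners countable; the same corners later provide the
    countable total family behind the separability of [V]. *)
Definition rat_rays : set (set R) := [set `]ratr q, +oo[%classic | q in [set: rat]].

Lemma measurable_rat_rays : @measurable _ R = <<s rat_rays >>.
Proof.
transitivity (<<s @RGenOInfty.G R >>); first exact: RGenOInfty.measurableE.
rewrite eqEsubset; split; apply: smallest_sub; try exact: smallest_sigma_algebra.
  move=> _ [x ->].
  have -> : `]x, +oo[%classic = \bigcup_(q : rat)
      (if x < ratr q then `]ratr q, +oo[%classic else set0).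
    apply/seteqP; split=> [y /=|y [q _]].
      rewrite in_itv /= andbT => /rat_in_itvoo[q]; rewrite in_itv /= => /andP[xq qy].
      by exists q => //; rewrite xq /= in_itv /= qy.
    by case: ifP => // xq /=; rewrite !in_itv /= !andbT; exact: lt_trans.
  apply: (@countable_bigcupT_measurable _ (g_sigma_algebraType rat_rays)) => //.
  by move=> q; case: ifP => _; [apply: sub_sigma_algebra; exists q|exact: measurable0].
by move=> _ [q _ <-]; apply: sub_sigma_algebra; exists (ratr q).
Qed.

(** The second coordinate is freed, then the first, and products of measurable sets finally generate
    the plane. Each use of the Dynkin argument starts from the integral over the whole range of the
    coordinate being freed, which is why half-planes and the plane appear beside the quadrants. *)
Lemma plane_integral0_ae (f : plane R -> \bar R) :
    (leb2 R).-integrable setT f -> (\int[leb2 R]_z f z = 0)%E ->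
    (forall a c : rat, \int[leb2 R]_(z in `]ratr a, +oo[ `*` `]ratr c, +oo[) f z = 0)%E ->
    (forall a : rat, \int[leb2 R]_(z in `]ratr a, +oo[ `*` setT) f z = 0)%E ->
    (forall c : rat, \int[leb2 R]_(z in setT `*` `]ratr c, +oo[) f z = 0)%E ->
  ae_eq (leb2 R) setT f (cst 0%E).
Proof.
move=> intf fT fac fa fc.
have GI : setI_closed rat_rays.
  move=> _ _ [x _ <-] [y _ <-]; exists (Order.max x y) => //; apply/seteqP; split => t /=;
    rewrite !in_itv /= !andbT.
    by case: (leP x y) => xy h; split => //; apply: le_lt_trans h; rewrite ler_rat // ltW.
  by case=> h1 h2; case: (leP x y).
have GE := measurable_rat_rays.
have m1 : measurable_fun setT (fun z : plane R => z.1) by exact: measurable_fst.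
have m2 : measurable_fun setT (fun z : plane R => z.2) by exact: measurable_snd.
have XE (A B : set R) : A `*` B = (A `*` setT) `&` snd @^-1` B.
  by apply/seteqP; split => z /=; [move=> []|move=> [[]]].
have XE' (A B : set R) : A `*` B = (setT `*` B) `&` fst @^-1` A.
  by apply/seteqP; split => z /=; [move=> []|move=> [[]]].
have s1 (a : rat) B : measurable B -> (\int[leb2 R]_(z in `]ratr a, +oo[ `*` B) f z = 0)%E.
  move=> mB; rewrite XE.
  apply: (integral0_pi_system intf m2 _ GE GI) => //.
    by apply: measurableX.
  by move=> _ [c _ <-]; rewrite -XE.
have s1' B : measurable B -> (\int[leb2 R]_(z in setT `*` B) f z = 0)%E.
  move=> mB; rewrite XE.
  apply: (integral0_pi_system intf m2 _ GE GI) => //; rewrite setXTT //.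
  rewrite -setXTT.
  by move=> _ [c _ <-]; rewrite -XE.
have s2 A B : measurable A -> measurable B -> (\int[leb2 R]_(z in A `*` B) f z = 0)%E.
  move=> mA mB; rewrite XE'.
  apply: (integral0_pi_system intf m1 _ GE GI) => //; first exact: measurableX.
    exact: s1'.
  by move=> _ [a _ <-]; rewrite -XE'; exact: s1.
apply: integral_ae_eq => // E _ mE; rewrite integral_cst // mul0e.
have midp : measurable_fun [set: plane R] (@id (plane R)) by exact: measurable_id.
rewrite -[E]setTI -[E]preimage_id.
have GP := @measurable_prod_measurableType _ _ R R.
apply: (integral0_pi_system intf midp _ GP) => //.
  move=> _ _ [A mA [B mB <-]] [A' mA' [B' mB' <-]]; rewrite -setXI.
  by exists (A `&` A'); [exact: measurableI|exists (B `&` B') => //; exact: measurableI].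
by move=> _ [A mA [B mB <-]]; rewrite setTI preimage_id; exact: s2.
Qed.

(* A test function on the square which increases to the indicator of
   the part of the square above and to the right of [(a, c)]. *)
Definition bump D a c (n : nat) z : R :=
  flat 1 (n.+1%:R * (z.1 - a) - 1) * flat 1 (n.+1%:R * (D - z.1) - 1) *
  (flat 1 (n.+1%:R * (z.2 - c) - 1) * flat 1 (n.+1%:R * (D - z.2) - 1)).

Lemma bump_test D a c n : 0 <= a -> 0 <= c ->
  test_function (square D) (bump D a c n).
Proof.
move=> a0 c0; split.
  move=> k.
  have F i (s b : R) : Ck k (fun z => flat 1 (n.+1%:R * (s * (coord i z - b)) - 1)).
    rewrite (_ : (fun z => _) =
        fun z => flat 1 ((n.+1%:R * s) * coord i z + (- n.+1%:R * s * b - 1))).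
      exact: Ck_flat.
    by apply/funext => z; congr flat; ring.
  have E : bump D a c n =
    (fun z => flat 1 (n.+1%:R * (1 * (coord false z - a)) - 1)) *
    (fun z => flat 1 (n.+1%:R * (-1 * (coord false z - D)) - 1)) *
    ((fun z => flat 1 (n.+1%:R * (1 * (coord true z - c)) - 1)) *
    (fun z => flat 1 (n.+1%:R * (-1 * (coord true z - D)) - 1))).
    by apply/funext => z; rewrite /bump !fctE /coord !mul1r !mulN1r !opprB.
  by rewrite E; do 2! [apply: CkM]; try apply: F; apply: CkM; exact: F.
(* Each factor of [bump] vanishes unless its coordinate is at distance at least 1/(n+1) from the
   corresponding edge. *)
have [e n0 eE] : exists2 e : R, 0 < e & e = n.+1%:R^-1.
  by exists n.+1%:R^-1 => //; rewrite invr_gt0 ltr0n.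
exists (`[a + e, D - e] `*` `[c + e, D - e]).
split.
- by apply: compact_setX; exact: segment_compact.
- move=> z [/=]; rewrite !in_itv /= => /andP[h1 h2] /andP[h3 h4].
  by split; apply/andP; split; lra.
- move=> z nz; have N0 : (0 : R) < n.+1%:R by rewrite ltr0n.
  have le1 (t : R) : flat 1 (n.+1%:R * t - 1) != 0 -> e <= t.
    rewrite eE /flat; case: ifP; rewrite ?eqxx // subr_gt0 => h _.
    by rewrite -[leLHS]mulr1 ler_pdivrMl // ltW.
  apply: contrapT => /eqP; rewrite /bump !mulf_eq0 !negb_or.
  move=> /andP[/andP[/le1 h1 /le1 h2] /andP[/le1 h3 /le1 h4]]; apply: nz.
  by split => /=; rewrite in_itv /=; apply/andP; split; lra.
Qed.

Lemma bump_ge0_le1 D a c n z : 0 <= bump D a c n z <= 1.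
Proof.
have h (t : R) : 0 <= flat 1 t <= 1 by rewrite flat1_ge0 flat1_le1.
rewrite /bump; move: (h (n.+1%:R * (z.1 - a) - 1)) (h (n.+1%:R * (D - z.1) - 1))
  (h (n.+1%:R * (z.2 - c) - 1)) (h (n.+1%:R * (D - z.2) - 1)).
move=> /andP[? ?] /andP[? ?] /andP[? ?] /andP[? ?].
by rewrite !mulr_ge0 //= !mulr_ile1 // mulr_ge0.
Qed.

Lemma bump_cvg D a c z : 0 <= a -> 0 <= c -> square D z ->
  bump D a c n z @[n --> \oo] --> (\1_(`]a, +oo[ `*` `]c, +oo[) z : R).
Proof.
move=> a0 c0 [/andP[x0 xD] /andP[y0 yD]].
have -> : \1_(`]a, +oo[ `*` `]c, +oo[) z =
    (if 0 < z.1 - a then 1 else 0) * (if 0 < D - z.1 then 1 else 0) *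
    ((if 0 < z.2 - c then 1 else 0) * (if 0 < D - z.2 then 1 else 0)) :> R.
  rewrite !subr_gt0 xD yD !mulr1 indicE.
  have -> : (z \in `]a, +oo[ `*` `]c, +oo[) = (a < z.1) && (c < z.2).
    apply/idP/andP; first by move=> /set_mem [] /=; rewrite !in_itv /= !andbT.
    by move=> [h1 h2]; apply/mem_set; split; rewrite /= in_itv /= andbT.
  by do 2! case: ifP => _; rewrite ?mulr0 ?mul0r ?mulr1.
by do 2! [apply: cvgM]; try apply: flat1_cvg; apply: cvgM; exact: flat1_cvg.
Qed.

Lemma sqint_indic_square D : 0 < D -> sqint (leb2 R) (\1_(square D)).
Proof.
move=> D0; apply: sqintP; first by apply: measurable_indic; exact: measurable_square.
have -> : (\int[leb2 R]_z ((\1_(square D) z : R) ^+ 2)%:E =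
    \int[leb2 R]_z (\1_(square D) z)%:E)%E.
  by apply: eq_integral => z _; rewrite indicE; case: (_ \in _); rewrite ?expr1n ?expr0n.
rewrite integral_indic ?setIT //; last exact: measurable_square.
by have := leb2_square D0 => /= ->; rewrite ltry.
Qed.

Lemma square_center D : 0 < D -> square D (D / 2, D / 2).
Proof. by move=> D0; split; apply/andP; split => /=; lra. Qed.

Lemma sqint_test D (phi : plane R -> R) : 0 < D ->
  continuous phi -> (exists M, forall z, square D z -> `|phi z| <= M) ->
  sqint (leb2 R) (phi \_ (square D)).
Proof.
move=> D0 cphi [M hM].
have mphi := continuous_plane_measurable cphi.
have -> : phi \_ (square D) = (fun z => (phi \_ (square D)) z * \1_(square D) z).
  by apply/funext => z; rewrite !patchE indicE; case: (_ \in _) => /=; rewrite ?mulr1 ?mulr0.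
have M0 : 0 <= M.
  by have /hM := square_center D0; apply: le_trans.
apply: (@sqint_bounded _ _ _ _ M) => [||z].
- apply/(measurable_restrictT _ (measurable_square D)).
  exact: measurable_funTS.
- exact: sqint_indic_square.
- rewrite patchE; case: ifPn => [/set_mem/hM //|_]; by rewrite normr0.
Qed.

(** Fundamental lemma of the calculus of variations: by dominated convergence along [bump], the
    integral of [w] over every corner of the square vanishes, and corners determine an integrable
    function almost everywhere. *)
Lemma ortho_test_ae0 D (w : plane R -> R) : 0 < D ->
    L2 (leb2 R) (square D) w ->
    (forall phi, test_function (square D) phi ->
      \int[leb2 R]_(z in square D) (w z * phi z) = 0) ->
  {ae leb2 R, forall z, square D z -> w z = 0}.
Proof.
move=> D0 w2 H; set S := square D; set W := w \_ S.
have W2 : sqint (leb2 R) W by [].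
have mW := sqint_measurable W2.
have WS z : ~ S z -> W z = 0 by move=> nz; rewrite /W patchE memNset.
have WI : W = (fun z => W z * \1_S z).
  apply/funext => z; rewrite indicE; case: (pselect (S z)) => Sz.
    by rewrite mem_set // mulr1.
  by rewrite WS // mul0r.
have intW : (leb2 R).-integrable setT (EFin \o W).
  rewrite WI; exact: sqint_integrable W2 (sqint_indic_square D0).
have key E a c : measurable E -> 0 <= a -> 0 <= c ->
    S `&` E = S `&` (`]a, +oo[ `*` `]c, +oo[) ->
    (\int[leb2 R]_(z in E) (W z)%:E = 0)%E.
  move=> mE a0 c0 SE.
  have tb n := bump_test D n a0 c0.
  have mb n : measurable_fun setT (bump D a c n).
    by apply: continuous_plane_measurable; have [/(_ 0%N)] := tb n.
  have := @dominated_convergence _ _ _ (leb2 R) setT measurableT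
    (fun n z => (W z * bump D a c n z)%:E) (fun z => (W z * \1_E z)%:E)
    (fun z => `|(W z)%:E|%E).
  case.
  - by move=> n; apply/measurable_EFinP; exact: measurable_funM.
  - by apply/measurable_EFinP/measurable_funM => //; exact: measurable_indic.
  - apply: aeW => z _; apply: cvg_EFin; first exact: nearW.
    have [Sz|/WS ->] := pselect (S z); last first.
      by rewrite mul0r; under eq_fun do rewrite mul0r; exact: cvg_cst.
    apply: cvgMr; have -> : \1_E z = \1_(`]a, +oo[ `*` `]c, +oo[) z :> R.
      rewrite !indicE; congr (_%:R); congr nat_of_bool.
      have -> : (z \in E) = (z \in S `&` E) by rewrite in_setI mem_set.
      by rewrite SE in_setI mem_set.
    exact: bump_cvg.
  - exact: integrable_abse.
  - apply: aeW => z n _ /=; rewrite lee_fin normrM ler_piMr //.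
    by have /andP[h1 h2] := bump_ge0_le1 D a c n z; rewrite ger0_norm.
  move=> _ _.
  have -> : [sequence (\int[leb2 R]_z (W z * bump D a c n z)%:E)%E]_n = cst 0%E.
    apply/funext => n /=.
    have -> : (fun z => (W z * bump D a c n z)%:E) =
        EFin \o (fun z => W z * (bump D a c n \_ S) z).
      apply/funext => z /=; rewrite [in RHS]patchE; case: ifPn => // /negP nz.
      by rewrite WS ?mul0r // => Sz; apply: nz; exact: mem_set.
    rewrite -(@fineK _ (\int[leb2 R]_z _)%E); last first.
      apply: integrable_fin_num => //; apply: sqint_integrable => //.
      apply: sqint_test => //; first by have [/(_ 0%N)] := tb n.
      exists 1 => z _; have /andP[h1 h2] := bump_ge0_le1 D a c n z.
      by rewrite ger0_norm.
    congr (_%:E); rewrite -[RHS](H _ (tb n)) Rintegral_mkcond /Rintegral; congr fine.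
    by apply: eq_integral => z _; rewrite /W !patchE; case: ifP; rewrite ?mul0r.
  move=> /(cvg_lim (@ereal_hausdorff R)); rewrite lim_cst // => /esym.
  rewrite (integral_mkcond E) => <-.
  apply: eq_integral => z _; rewrite patchE indicE.
  by case: ifP; rewrite ?mulr1 ?mulr0.
have mitv (a : R) : measurable (`]a, +oo[ : set R) by exact: measurable_itv.
(* [bump] wants its corner at nonnegative coordinates. The integrand lives on the open square, so
   the corner may be moved to [Order.max a 0] without changing the integral. *)
have Sax a z : S z -> (Order.max a 0 < z.1) = (a < z.1).
  by move=> [/andP[z0 _] _]; rewrite gt_max z0 andbT.
have Say a z : S z -> (Order.max a 0 < z.2) = (a < z.2).
  by move=> [_ /andP[z0 _]]; rewrite gt_max z0 andbT.
have S0 z : S z -> (0 < z.1) * (0 < z.2) by move=> [/andP[-> _] /andP[-> _]].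
have m0 a : 0 <= Order.max a 0 :> R by rewrite le_max lexx orbT.
have := plane_integral0_ae intW; case.
- apply: (key setT 0 0) => //; apply/seteqP; split => z /= [Sz _]; split => //.
  by rewrite !in_itv /= !S0.
- move=> a' c'; set a : R := ratr a'; set c : R := ratr c'.
  apply: (key _ (Order.max a 0) (Order.max c 0)) => //.
    exact: measurableX.
  by apply/seteqP; split => z /= [Sz]; rewrite !in_itv /= !andbT Sax // Say.
- move=> a'; set a : R := ratr a'; apply: (key _ (Order.max a 0) 0) => //; first exact: measurableX.
  by apply/seteqP; split => z /= [Sz]; rewrite !in_itv /= !andbT Sax // S0 // => -[].
- move=> c'; set c : R := ratr c'; apply: (key _ 0 (Order.max c 0)) => //; first exact: measurableX.
  by apply/seteqP; split => z /= [Sz]; rewrite !in_itv /= !andbT Say // S0 // => -[].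
move=> N [mN N0 NW]; exists N; split => // z /= nz; apply: NW => /= h; apply: nz => Sz.
by have := h I; rewrite /W patchE mem_set // => -[].
Qed.

End TestFunctions.

(** * Trace and Poincare inequalities for C1 functions *)

Section SmoothOnSquare.
Context {R : realType}.
Implicit Types (D : R) (z : plane R) (phi psi f : plane R -> R) (i : bool).
Local Notation mu := (@lebesgue_measure R).

(* Allows to treat both coordinates at once: [i = false] is the first one. *)
Definition pt i (s t : R) : plane R := if i then (t, s) else (s, t).

Lemma pt_line i s t : pt i s t = line i (t, t) s.
Proof. by case: i. Qed.

Lemma pt_negb i s t : pt (~~ i) s t = pt i t s.
Proof. by case: i. Qed.

Lemma pt_square D i s t : square D (pt i s t) <-> 0 < s < D /\ 0 < t < D.
Proof. by rewrite /square /pt; case: i => /=; split => -[]. Qed.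

Lemma tonelli_pt i (f : plane R -> \bar R) : measurable_fun setT f ->
  (forall z, (0 <= f z)%E) ->
  (\int[leb2 R]_z f z = \int[mu]_t \int[mu]_s f (pt i s t))%E.
Proof. by move=> mf f0; have [H1 H2] := ge0_integral_leb2 mf f0; case: i. Qed.

Lemma fubini_pt i (f : plane R -> \bar R) : (leb2 R).-integrable setT f ->
  (\int[leb2 R]_z f z = \int[mu]_t \int[mu]_s f (pt i s t))%E.
Proof. by move=> intf; have [H1 H2] := integral_leb2 intf; case: i. Qed.

Lemma measurable_integral_pt i (f : plane R -> \bar R) : measurable_fun setT f ->
  (forall z, (0 <= f z)%E) ->
  measurable_fun setT (fun t => \int[mu]_s f (pt i s t))%E.
Proof.
move=> mf f0; case: i.
  exact: (@measurable_fun_fubini_tonelli_F _ _ _ _ _ mu f).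
exact: (@measurable_fun_fubini_tonelli_G _ _ _ _ _ mu f).
Qed.

Lemma continuous_pt i t : continuous (fun s => pt i s t).
Proof.
move=> s; case: i.
  exact: (@cvg_pair _ _ _ (nbhs s) (nbhs t) (nbhs s) _ _ _ (cst t) id (@cvg_cst _ _ _ _ _) cvg_id).
exact: (@cvg_pair _ _ _ (nbhs s) (nbhs s) (nbhs t) _ _ _ id (cst t) cvg_id (@cvg_cst _ _ _ _ _)).
Qed.

Lemma continuous_bounded_square D phi : continuous phi ->
  exists M, forall z, csquare D z -> `|phi z| <= M.
Proof.
move=> cphi; have cS : compact (csquare D).
  by rewrite csquareE; apply: compact_setX; exact: segment_compact.
have : compact (phi @` csquare D).
  by apply: continuous_compact => //; exact: continuous_subspaceT.
move=> /compact_bounded [M [_ /(_ (`|M| + 1))]].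
have -> : M < `|M| + 1 by rewrite (le_lt_trans (ler_norm _)) // ltrDl.
by move=> /(_ isT) H; exists (`|M| + 1) => z Sz; apply: H; exists z.
Qed.

Lemma square_csquare D : square D `<=` csquare D.
Proof. by move=> z [/andP[/ltW ? /ltW ?] /andP[/ltW ? /ltW ?]]; split; apply/andP. Qed.

Lemma sqint_continuous D phi : 0 < D -> continuous phi ->
  sqint (leb2 R) (phi \_ (square D)).
Proof.
move=> D0 cphi; apply: sqint_test => //.
have [M hM] := continuous_bounded_square D cphi.
by exists M => z /square_csquare; exact: hM.
Qed.

Lemma FTC_pt i phi (a b t : R) : Ck 1 phi -> a < b ->
  (\int[mu]_(s in `]a, b[) (pderiv i phi (pt i s t))%:E =
    (phi (pt i b t) - phi (pt i a t))%:E)%E.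
Proof.
move=> [cphi H] ab; have [dphi cdphi] := H i.
have cline f : continuous f -> continuous (fun s => f (pt i s t)).
  move=> cf s; apply: (@cvg_comp _ _ _ (fun s => pt i s t) f _ (nbhs (pt i s t))).
    exact: continuous_pt.
  exact: cf.
have dline s : is_derive s (1 : R) (fun s => phi (pt i s t)) (pderiv i phi (pt i s t)).
  rewrite pt_line (_ : (fun s => _) = fun s => phi (line i (t, t) s)).
    exact: derivable_line.
  by apply/funext => s'; rewrite pt_line.
rewrite -(@integral_itv_bndoo R a b _ true false); last first.
  apply/measurable_EFinP; apply: measurable_funTS.
  by apply: continuous_measurable_fun; exact: cline.
rewrite (@continuous_FTC2 _ _ (fun s => phi (pt i s t))) //.
- by apply: continuous_subspaceT; exact: cline.
- split.
  + by move=> s _; have [] := dline s.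
  + by apply: cvg_at_right_filter; exact: cline.
  + by apply: cvg_at_left_filter; exact: cline.
- by move=> s _; rewrite derive1E; have [_ ->] := dline s.
Qed.

(** Fubini with the inner integral along direction [i]; the fundamental theorem of calculus on each
    line leaves two values at points of the boundary, where [phi] is 0. *)
Lemma integral_pderiv0 D i phi : 0 < D -> Ck 1 phi ->
  (forall z, ~ square D z -> phi z = 0) ->
  \int[leb2 R]_(z in square D) pderiv i phi z = 0.
Proof.
move=> D0 Cphi phi0; have [_ /(_ i) [_ cd]] := Cphi.
have s2 := sqint_continuous D0 cd.
have int : (leb2 R).-integrable setT (EFin \o (pderiv i phi \_ (square D))).
  have -> : pderiv i phi \_ (square D) =
      fun z => (pderiv i phi \_ (square D)) z * \1_(square D) z.
    by apply/funext => z; rewrite !patchE indicE; case: (_ \in _) => /=; rewrite ?mulr1 ?mulr0.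
  exact: sqint_integrable s2 (sqint_indic_square D0).
rewrite Rintegral_mkcond /Rintegral (fubini_pt i int).
rewrite integral0_eq // => t _ /=.
have [tD|tD] := boolP (0 < t < D); last first.
  apply: integral0_eq => s _; rewrite patchE memNset // => /pt_square [_].
  by apply/negP.
rewrite (_ : (\int[mu]_s _)%E = (\int[mu]_(s in `]0%R, D[) (pderiv i phi (pt i s t))%:E)%E).
  rewrite FTC_pt // !phi0 ?subrr //; move=> /pt_square; rewrite ltxx ?andbF /=; by case.
rewrite [RHS]integral_mkcond; apply: eq_integral => s _.
rewrite !patchE; have [sD|sD] := boolP (s \in `]0, D[).
  by rewrite !mem_set //=; apply/pt_square; move: sD; rewrite in_itv.
rewrite !memNset //=; first exact/negP.
by move=> /pt_square [h _]; move: sD; rewrite in_itv /= h.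
Qed.

(** Integration by parts: the product of [phi] with a test function vanishes off the square, so the
    integral of its derivative is 0. *)
Lemma C1_weak_pderiv D i phi : 0 < D -> Ck 1 phi ->
  is_weak_pderiv D i phi (pderiv i phi).
Proof.
move=> D0 Cphi; have [cphi /(_ i) [dphi cd]] := Cphi.
split; first exact: sqint_continuous.
move=> psi [Cpsi [K [cK KS K0]]].
have [cpsi /(_ i) [dpsi cdpsi]] := Cpsi 1%N.
have := @integral_pderiv0 D i (phi * psi) D0 (CkM Cphi (Cpsi 1%N)).
have -> : pderiv i (phi * psi) = phi * pderiv i psi + psi * pderiv i phi.
  by apply/funext => z; rewrite /pderiv deriveM.
move=> /(_ _)/wrap[].
  by move=> z nS; rewrite fctE K0 ?mulr0 // => /KS.
have M f : \int[leb2 R]_(z in square D) f z = \int[leb2 R]_z (f \_ (square D)) z.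
  exact: Rintegral_mkcond.
rewrite !M.
have E f g : (f * g) \_ (square D) = fun z => (f \_ (square D)) z * (g \_ (square D)) z.
  by apply/funext => z; rewrite !patchE; case: ifP => //; rewrite mulr0.
have -> : (phi * pderiv i psi + psi * pderiv i phi) \_ (square D) =
    fun z => (phi \_ (square D)) z * (pderiv i psi \_ (square D)) z +
      (pderiv i phi \_ (square D)) z * (psi \_ (square D)) z.
  apply/funext => z; rewrite !patchE !fctE; case: ifP => //; last by rewrite !mulr0 addr0.
  by rewrite [psi z * _]mulrC.
rewrite RintegralD //; last 2 first.
- by apply: sqint_integrable; exact: sqint_continuous.
- by apply: sqint_integrable; exact: sqint_continuous.
rewrite -!E; move=> /eqP; rewrite addr_eq0 => /eqP.
by [].
Qed.

End SmoothOnSquare.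

Section BoundaryInequalities.
Context {R : realType}.
Implicit Types (D : R) (z : plane R) (phi : plane R -> R) (i : bool).
Local Notation mu := (@lebesgue_measure R).

Lemma integral_indic_oo (a b : R) : a <= b ->
  (\int[mu]_s (\1_(`]a, b[%classic : set R) s)%:E = (b - a)%:E)%E.
Proof.
move=> ab; rewrite integral_indic // setIT.
apply: (etrans (lebesgue_measure_itv `]a, b[)); rewrite /= lte_fin.
have [_|ba] := ltP a b; first by rewrite EFinB.
by rewrite (@le_anti _ _ a b) ?subrr // ab.
Qed.

Lemma sqint_indic_itv (a b : R) : sqint mu (\1_(`]a, b[%classic : set R)).
Proof.
apply: sqintP; first by apply: measurable_indic.
have -> : (\int[mu]_s ((\1_(`]a, b[%classic : set R) s : R) ^+ 2)%:E =
    \int[mu]_s (\1_(`]a, b[%classic : set R) s)%:E)%E.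
  by apply: eq_integral => z _; rewrite indicE; case: (_ \in _); rewrite ?expr1n ?expr0n.
have [ab|ba] := leP a b; first by rewrite integral_indic_oo // ltry.
rewrite set_itv_ge ?bnd_simp -?leNgt ?(ltW ba) //.
by rewrite integral0_eq // => x _; rewrite indic0.
Qed.

Lemma sqint_itv (g : R -> R) (a b : R) : continuous g ->
  sqint mu (g \_ `]a, b[).
Proof.
move=> cg; have : compact (g @` `[a, b]).
  by apply: continuous_compact; [exact: continuous_subspaceT|exact: segment_compact].
move=> /compact_bounded [M [_ /(_ (`|M| + 1))]].
have -> : M < `|M| + 1 by rewrite (le_lt_trans (ler_norm _)) // ltrDl.
move=> /(_ isT) H.
have -> : g \_ `]a, b[ = fun s => (g \_ `]a, b[) s * \1_(`]a, b[%classic : set R) s.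
  by apply/funext => z; rewrite !patchE indicE; case: (_ \in _) => /=; rewrite ?mulr1 ?mulr0.
apply: (@sqint_bounded _ _ _ _ (`|M| + 1)) => [||s].
- apply/(measurable_restrictT _ (measurable_itv _)); apply: measurable_funTS.
  exact: continuous_measurable_fun.
- exact: sqint_indic_itv.
- rewrite patchE; case: ifPn => [/set_mem /= sab|_]; last by rewrite normr0 addr_ge0.
  by apply: H; exists s => //; exact: subset_itv_oo_cc.
Qed.

Lemma itv_CS (g : R -> R) (a b : R) : continuous g -> a < b ->
  (\int[mu]_(s in `]a, b[) g s) ^+ 2 <= (b - a) * \int[mu]_(s in `]a, b[) g s ^+ 2.
Proof.
move=> cg ab; pose f := g \_ `]a, b[.
have f2 : sqint mu f by exact: sqint_itv.
have i2 := sqint_indic_itv a b.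
have := si_CS (sqint_semi_inner mu) i2 f2.
have -> : ip mu (\1_(`]a, b[%classic : set R)) f = \int[mu]_(s in `]a, b[) g s.
  rewrite Rintegral_mkcond; apply: eq_Rintegral => s _; rewrite /f !patchE indicE.
  by case: (_ \in _); rewrite ?mul1r ?mul0r.
have -> : ip mu (\1_(`]a, b[%classic : set R)) (\1_(`]a, b[%classic : set R)) = b - a.
  have : ((ip mu (\1_(`]a, b[%classic : set R)) (\1_(`]a, b[%classic : set R)))%:E = (b - a)%:E)%E.
    rewrite (ip_sqrE i2).
    have -> : (\int[mu]_s ((\1_(`]a, b[%classic : set R) s : R) ^+ 2)%:E =
      \int[mu]_s (\1_(`]a, b[%classic : set R) s)%:E)%E.
      by apply: eq_integral => z _; rewrite indicE; case: (_ \in _); rewrite ?expr1n ?expr0n.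
    by rewrite integral_indic_oo // ltW.
  by case.
suff -> : ip mu f f = \int[mu]_(s in `]a, b[) g s ^+ 2 by [].
rewrite Rintegral_mkcond; apply: eq_Rintegral => s _; rewrite /f !patchE.
by case: (_ \in _); rewrite -?expr2 ?expr0n.
Qed.

Definition line_energy D i phi (t : R) : R :=
  \int[mu]_(s in `]0, D[) (pderiv i phi (pt i s t)) ^+ 2.

Lemma ge0_integral_lincomb d (T : measurableType d) (nu : {measure set T -> \bar R})
    (A : set T) (al be : R) (p q : T -> R) : measurable A -> 0 <= al -> 0 <= be ->
    measurable_fun A p -> measurable_fun A q ->
    (forall x, A x -> 0 <= p x) -> (forall x, A x -> 0 <= q x) ->
  (\int[nu]_(x in A) (al * p x + be * q x)%:E =
    al%:E * \int[nu]_(x in A) (p x)%:E + be%:E * \int[nu]_(x in A) (q x)%:E)%E.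
Proof.
move=> mA al0 be0 mp mq p0 q0.
under eq_integral do rewrite EFinD !EFinM.
rewrite ge0_integralD //.
- by rewrite !ge0_integralZl //; do ?[exact/measurable_EFinP|move=> x Ax; rewrite lee_fin ?p0 ?q0].
- by move=> x Ax; rewrite -EFinM lee_fin mulr_ge0 // p0.
- by apply/measurable_EFinP; exact: measurable_funM.
- by move=> x Ax; rewrite -EFinM lee_fin mulr_ge0 // q0.
- by apply/measurable_EFinP; exact: measurable_funM.
Qed.

Section C1.
Variables (D : R) (phi : plane R -> R).
Hypotheses (D0 : 0 < D) (Cphi : Ck 1 phi).

Let cd i : continuous (pderiv i phi).
Proof. by have [_ /(_ i) []] := Cphi. Qed.

Let cl i t : continuous (fun s => pderiv i phi (pt i s t)).
Proof.
move=> s; apply: (@cvg_comp _ _ _ (fun s => pt i s t) (pderiv i phi) _ (nbhs (pt i s t))).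
  exact: continuous_pt.
exact: cd.
Qed.

Lemma line_energyE i t : ((line_energy D i phi t)%:E =
  \int[mu]_(s in `]0%R, D[) ((pderiv i phi (pt i s t)) ^+ 2)%:E)%E.
Proof.
have f2 := @sqint_itv _ 0 D (@cl i t).
have := ip_sqrE f2.
have -> : (\int[mu]_s (((fun s => pderiv i phi (pt i s t)) \_ `]0, D[) s ^+ 2)%:E =
    \int[mu]_(s in `]0%R, D[) ((pderiv i phi (pt i s t)) ^+ 2)%:E)%E.
  rewrite [RHS]integral_mkcond; apply: eq_integral => s _; rewrite !patchE.
  by case: (_ \in _); rewrite ?expr0n.
move=> <-; congr EFin; rewrite /line_energy Rintegral_mkcond.
apply: eq_Rintegral => s _; rewrite !patchE.
by case: (_ \in _); rewrite -?expr2 ?expr0n.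
Qed.

Lemma line_energy_ge0 i t : 0 <= line_energy D i phi t.
Proof. by rewrite -lee_fin line_energyE; apply: integral_ge0 => s _; rewrite lee_fin sqr_ge0. Qed.

(** The increment is the integral of the derivative over the segment; Cauchy-Schwarz on an interval
    of length at most [D] gives the factor. *)
Lemma line_energy_bound i t (s s' : R) : 0 <= s <= D -> 0 <= s' <= D ->
  (phi (pt i s t) - phi (pt i s' t)) ^+ 2 <= D * line_energy D i phi t.
Proof.
wlog ss' : s s' / s' < s => [hw|] sD s'D.
  have [ss'|ss'|->] := ltgtP s' s.
  - exact: hw.
  - by rewrite -sqrrN opprB; exact: hw.
  - by rewrite subrr expr0n mulr_ge0 ?line_energy_ge0 // ltW.
have <- : \int[mu]_(s in `]s', s[) pderiv i phi (pt i s t) =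
    phi (pt i s t) - phi (pt i s' t).
  by rewrite /Rintegral FTC_pt.
apply: le_trans (itv_CS (@cl i t) ss') _.
have [/andP[s0 sD'] /andP[s'0 s'D']] := (sD, s'D).
have le1 : s - s' <= D by lra.
apply: (@le_trans _ _ (D * \int[mu]_(s in `]s', s[) pderiv i phi (pt i s t) ^+ 2)).
  by rewrite ler_wpM2r // Rintegral_ge0 // => x _; exact: sqr_ge0.
rewrite ler_pM2l // -lee_fin line_energyE.
rewrite /Rintegral fineK; last first.
  have f2 := @sqint_itv _ s' s (@cl i t).
  have := ip_sqrE f2.
  have -> : (\int[mu]_x (((fun s => pderiv i phi (pt i s t)) \_ `]s', s[) x ^+ 2)%:E =
    \int[mu]_(x in `]s', s[) ((pderiv i phi (pt i x t)) ^+ 2)%:E)%E.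
    rewrite [RHS]integral_mkcond; apply: eq_integral => x _; rewrite !patchE.
    by case: (_ \in _); rewrite ?expr0n.
  by move=> <-.
apply: ge0_subset_integral => //.
- apply/measurable_EFinP; apply: measurable_funX; apply: measurable_funTS.
  exact: continuous_measurable_fun (@cl i t).
- by move=> x _; rewrite lee_fin sqr_ge0.
- by apply: subset_itvW.
Qed.

Let dsq i z : \bar R := (((pderiv i phi \_ (square D)) z) ^+ 2)%:E.

Let mdsq i : measurable_fun setT (dsq i).
Proof.
apply/measurable_EFinP/measurable_funX.
by apply: sqint_measurable; apply: sqint_continuous.
Qed.

Let dsq_ge0 i z : (0 <= dsq i z)%E.
Proof. by rewrite lee_fin sqr_ge0. Qed.

Let dsq_pt i t : (\int[mu]_s dsq i (pt i s t) =
  ((line_energy D i phi \_ `]0%R, D[) t)%:E)%E.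
Proof.
rewrite patchE; case: ifPn => tD; last first.
  apply: integral0_eq => s _; rewrite /dsq patchE memNset ?expr0n // => /pt_square [_ h].
  by move/negP: tD; apply; apply/mem_set; rewrite /= in_itv.
rewrite line_energyE [RHS]integral_mkcond; apply: eq_integral => s _.
rewrite /dsq !patchE; have [sD|sD] := boolP (s \in (`]0%R, D[%classic : set R)).
  rewrite mem_set //; apply/pt_square; move: sD tD.
  by move=> /set_mem /=; rewrite in_itv /= => ? /set_mem /=; rewrite in_itv.
rewrite memNset ?expr0n //= => /pt_square [h _].
by move/negP: sD; apply; apply/mem_set; rewrite /= in_itv.
Qed.

Lemma line_energy_measurable i : measurable_fun setT (line_energy D i phi \_ `]0, D[).
Proof.
apply/measurable_EFinP.
rewrite (_ : (EFin \o _) = fun t => (\int[mu]_s dsq i (pt i s t))%E).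
  exact: measurable_integral_pt.
by apply/funext => t; rewrite dsq_pt.
Qed.

Definition energy i : R := ip (leb2 R) (pderiv i phi \_ (square D)) (pderiv i phi \_ (square D)).

Lemma energyE i : ((energy i)%:E = \int[mu]_t ((line_energy D i phi \_ `]0%R, D[) t)%:E)%E.
Proof.
rewrite /energy ip_sqrE; last exact: sqint_continuous.
rewrite (tonelli_pt i (mdsq i)) //.
by apply: eq_integral => t _; rewrite dsq_pt.
Qed.

(** The term of [pointwise_bound] that varies with [z]: the energy of [phi] on the line through [z]
    in the direction other than [i]. It is cut off outside the square, so its integral is [D] times
    the energy in that direction. *)
Let slab i z : R := (line_energy D (~~ i) phi \_ `]0, D[) (coord i z) * \1_(square D) z.

Let mslab i : measurable_fun setT (slab i).
Proof.
apply: measurable_funM; last by apply: measurable_indic; exact: measurable_square.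
apply: measurableT_comp; first exact: line_energy_measurable.
by case: i; [exact: measurable_snd|exact: measurable_fst].
Qed.

Let slab_ge0 i z : 0 <= slab i z.
Proof.
rewrite /slab mulr_ge0 // patchE; case: ifP => // _; exact: line_energy_ge0.
Qed.

Let integral_slab i : (\int[leb2 R]_z (slab i z)%:E = (D * energy (~~ i))%:E)%E.
Proof.
rewrite (tonelli_pt (~~ i)); last 2 first.
- exact/measurable_EFinP.
- by move=> z; rewrite lee_fin.
rewrite EFinM energyE -ge0_integralZl //; last 3 first.
- by apply/measurable_EFinP; exact: line_energy_measurable.
- by move=> t _; rewrite lee_fin patchE; case: ifP => // _; exact: line_energy_ge0.
- by rewrite lee_fin ltW.
apply: eq_integral => t _; set c := (line_energy _ _ _ \_ _) t.
have -> : (fun s => (slab i (pt (~~ i) s t))%:E) =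
    (fun s => c%:E * (\1_(`]0%R, D[%classic : set R) s)%:E)%E.
  apply/funext => s; rewrite pt_negb /slab (_ : coord i (pt i t s) = t); last by case: (i).
  rewrite -/c -EFinM; congr EFin.
  have [tD|tD] := boolP (t \in (`]0, D[%classic : set R)); last first.
    by rewrite /c patchE (negbTE tD) !mul0r.
  congr (_ * _); rewrite !indicE; congr (_%:R); congr nat_of_bool.
  apply/idP/idP => /set_mem => [/pt_square [_ ?]|/= sD]; apply/mem_set.
    by rewrite /= in_itv.
  by apply/pt_square; move: sD tD; rewrite in_itv /= => ? /set_mem /=; rewrite in_itv.
rewrite ge0_integralZl //.
- by rewrite integral_indic_oo ?ltW // subr0 muleC.
- by apply/measurable_EFinP; exact: measurable_indic.
- by rewrite lee_fin /c patchE; case: ifP => // _; exact: line_energy_ge0.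
Qed.

Lemma energy_ge0 i : 0 <= energy i.
Proof.
by apply: (si_ge0 (sqint_semi_inner (leb2 R))); exact: sqint_continuous.
Qed.

(* Join [pt i c t] to [z] by a segment in direction [i] and one in the other
   direction, with the fundamental theorem of calculus and Cauchy-Schwarz. *)
Lemma pointwise_bound i (c t : R) z : 0 <= c <= D -> 0 <= t <= D -> square D z ->
  (phi z - phi (pt i c t)) ^+ 2 <=
  2 * D * line_energy D (~~ i) phi (coord i z) + 2 * D * line_energy D i phi t.
Proof.
move=> cD tD Sz.
have [x [y [-> xD yD cx]]] : exists x y, [/\ z = pt i x y, 0 <= x <= D, 0 <= y <= D & coord i z = x].
  exists (coord i z), (coord (~~ i) z).
  have [/andP[/ltW a1 /ltW a2] /andP[/ltW a3 /ltW a4]] := Sz.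
  by split; case: (i) => //=; rewrite ?a1 ?a2 ?a3 ?a4 //; case: (z).
have -> : coord i (pt i x y) = x by case: (i).
have := line_energy_bound (~~ i) x yD tD; rewrite !pt_negb.
have := line_energy_bound i t xD cD.
set p := phi (pt i x y); set q := phi (pt i x t); set r := phi (pt i c t).
set e := line_energy _ _ _ _; set e' := line_energy _ _ _ _ => h1 h2.
have := sqr_ge0 ((p - q) - (q - r)); rewrite !expr2 in h1 h2 *; nra.
Qed.

Let N2 : R := ip (leb2 R) (phi \_ (square D)) (phi \_ (square D)).

Let cphi : continuous phi. Proof. by have [] := Cphi. Qed.

Let sphi : sqint (leb2 R) (phi \_ (square D)).
Proof. exact: sqint_continuous. Qed.

Let mphi2 : measurable_fun setT (fun z => (phi \_ (square D)) z ^+ 2).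
Proof. by apply: measurable_funX; exact: sqint_measurable sphi. Qed.

Let mind : measurable_fun setT (\1_(square D) : plane R -> R).
Proof. by apply: measurable_indic; exact: measurable_square. Qed.

Let integral_ind : (\int[leb2 R]_z (\1_(square D) z : R)%:E = (D ^+ 2)%:E)%E.
Proof.
rewrite integral_indic ?setIT //; last exact: measurable_square.
exact: leb2_square.
Qed.

Let slabS i z : square D z -> slab i z = line_energy D (~~ i) phi (coord i z).
Proof.
move=> Sz; rewrite /slab indicE mem_set // mulr1 patchE mem_set //=.
by move: Sz; rewrite in_itv /= => -[]; case: (i).
Qed.

Let phiS z : square D z -> (phi \_ (square D)) z = phi z.
Proof. by move=> Sz; rewrite patchE mem_set. Qed.

Let indS z : square D z -> \1_(square D) z = 1 :> R.
Proof. by move=> Sz; rewrite indicE mem_set. Qed.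

Let D4 : 0 <= 4 * D. Proof. by rewrite mulr_ge0 // ltW. Qed.

(* The next two estimates integrate [pointwise_bound] over [z] in the square;
   integrating them over [t] then gives the Poincare and trace inequalities. *)
Lemma square_le_boundary i (c t : R) : 0 <= c <= D -> 0 <= t <= D ->
  N2 <= 2 * D ^+ 2 * phi (pt i c t) ^+ 2 + 4 * D ^+ 3 * line_energy D i phi t +
    4 * D ^+ 2 * energy (~~ i).
Proof.
move=> cD tD; set b := phi _; set e := line_energy _ _ _ _.
have e0 : 0 <= e by exact: line_energy_ge0.
have -> : 2 * D ^+ 2 * b ^+ 2 + 4 * D ^+ 3 * e + 4 * D ^+ 2 * energy (~~ i) =
    (2 * b ^+ 2 + 4 * D * e) * D ^+ 2 + (4 * D) * (D * energy (~~ i)) by ring.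
have A0 : 0 <= 2 * b ^+ 2 + 4 * D * e.
  by rewrite addr_ge0 // mulr_ge0 ?sqr_ge0.
rewrite -lee_fin EFinD (EFinM (_ + _)) (EFinM (4 * D)) -integral_ind -(integral_slab i) /N2.
rewrite ip_sqrE // -ge0_integral_lincomb //.
- apply: ge0_le_integral => //.
  + by move=> z _; rewrite lee_fin sqr_ge0.
  + exact/measurable_EFinP.
  + by apply/measurable_EFinP; apply: measurable_funD; apply: measurable_funM.
  + move=> z _; rewrite lee_fin; have [Sz|Sz] := pselect (square D z); last first.
      by rewrite patchE memNset // expr0n /= addr_ge0 // mulr_ge0 // ?D4 ?slab_ge0 ?A0.
    rewrite (phiS Sz) (slabS i Sz) (indS Sz) mulr1.
    have := pointwise_bound i cD tD Sz; rewrite -/b -/e.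
    set f := phi z; set g := line_energy _ _ _ _.
    (* This square is the gap in f^2 <= 2 b^2 + 2 (f - b)^2. *)
    have := sqr_ge0 (f - 2 * b); rewrite !expr2; nra.
Qed.

Lemma boundary_le_square i (c t : R) : 0 <= c <= D -> 0 <= t <= D ->
  D ^+ 2 * phi (pt i c t) ^+ 2 <= 2 * N2 + 4 * D ^+ 3 * line_energy D i phi t +
    4 * D ^+ 2 * energy (~~ i).
Proof.
move=> cD tD; set b := phi _; set e := line_energy _ _ _ _.
have e0 : 0 <= e by exact: line_energy_ge0.
have sE : (\int[leb2 R]_z (1 * slab i z + e * \1_(square D) z)%:E =
    (D * energy (~~ i) + e * D ^+ 2)%:E)%E.
  by rewrite ge0_integral_lincomb // integral_slab integral_ind mul1e.
have -> : 2 * N2 + 4 * D ^+ 3 * e + 4 * D ^+ 2 * energy (~~ i) =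
    2 * N2 + 4 * D * (D * energy (~~ i) + e * D ^+ 2) by ring.
have se0 z : 0 <= 1 * slab i z + e * \1_(square D) z.
  by rewrite addr_ge0 // mulr_ge0.
have ms : measurable_fun setT (fun z => 1 * slab i z + e * \1_(square D) z).
  by apply: measurable_funD; apply: measurable_funM.
rewrite mulrC -lee_fin EFinD !(EFinM 2) (EFinM (4 * D)) EFinM -sE /N2 ip_sqrE //.
rewrite -integral_ind -ge0_integral_lincomb //; last by move=> z _; rewrite sqr_ge0.
rewrite -ge0_integralZl //; last 2 first.
- exact/measurable_EFinP.
- by rewrite lee_fin sqr_ge0.
apply: ge0_le_integral => //.
- by move=> z _; rewrite -EFinM lee_fin mulr_ge0 ?sqr_ge0.
- by apply/measurable_EFinP; exact: measurable_funM.
- by apply/measurable_EFinP; apply: measurable_funD; apply: measurable_funM.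
- move=> z _; rewrite -EFinM lee_fin; have [Sz|Sz] := pselect (square D z); last first.
    rewrite indicE memNset // !mulr0 addr0 mul1r.
    by apply: addr_ge0; apply: mulr_ge0; rewrite ?sqr_ge0.
  rewrite (phiS Sz) (slabS i Sz) (indS Sz) !mulr1 mul1r.
  have := pointwise_bound i cD tD Sz; rewrite -/b -/e.
  set f := phi z; set g := line_energy _ _ _ _.
  have := sqr_ge0 (b - 2 * f); rewrite !expr2; nra.
Qed.

Let cb i (c : R) : continuous (fun t => phi (pt i c t)).
Proof.
move=> t; apply: (@cvg_comp _ _ _ (fun s => pt i c s) phi _ (nbhs (pt i c t))).
  by rewrite -pt_negb (_ : (fun s => _) = fun s => pt (~~ i) s c);
    [exact: continuous_pt|apply/funext => s; rewrite pt_negb].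
exact: cphi.
Qed.

Let mbt i (c : R) (Z : set R) : measurable_fun Z (fun t => phi (pt i c t) ^+ 2).
Proof.
apply: measurable_funX; apply: measurable_funTS.
by apply: continuous_measurable_fun; exact: cb.
Qed.

Let mle i (Z : set R) : measurable Z -> Z `<=` `]0, D[ ->
  measurable_fun Z (line_energy D i phi).
Proof.
move=> mZ ZD; apply: (@measurable_funS _ _ _ _ (`]0, D[)) => //.
apply/(measurable_restrictT _ (measurable_itv _)); exact: line_energy_measurable.
Qed.

Let ile i (Z : set R) : measurable Z -> Z `<=` `]0, D[ ->
  (\int[mu]_(t in Z) (line_energy D i phi t)%:E <= (energy i)%:E)%E.
Proof.
move=> mZ ZD; rewrite energyE [leRHS](_ : _ = \int[mu]_(t in `]0%R, D[) (line_energy D i phi t)%:E)%E.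
  apply: ge0_subset_integral => //.
  - by apply/measurable_EFinP; exact: mle.
  - by move=> t _; rewrite lee_fin line_energy_ge0.
rewrite [RHS]integral_mkcond; apply: eq_integral => t _; rewrite !patchE.
by case: ifP.
Qed.

Let muZ (Z : set R) : measurable Z -> Z `<=` `]0, D[ -> (mu Z <= D%:E)%E.
Proof.
move=> mZ ZD; apply: (@le_trans _ _ (mu (`]0, D[%classic : set R))).
  by apply: le_measure; rewrite ?inE.
have := lebesgue_measure_itv `]0, D[; rewrite /= lte_fin D0 -EFinB subr0.
by move=> H; rewrite le_eqVlt; apply/orP; left; apply/eqP; exact: H.
Qed.

(** [square_le_boundary] is integrated over a part [Z] of a side only. For the Poincare inequality,
    [Z] will be the part where a trace vanishes, so that the boundary term disappears and [mu Z]
    stays on the left. *)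
Lemma square_le_side i (c : R) (Z : set R) : 0 <= c <= D -> measurable Z ->
    Z `<=` `]0, D[ ->
  (N2%:E * mu Z <= (2 * D ^+ 2)%:E * \int[mu]_(t in Z) (phi (pt i c t) ^+ 2)%:E +
    (4 * D ^+ 3 * (energy false + energy true))%:E)%E.
Proof.
move=> cD mZ ZD; have D3 : 0 <= D ^+ 3 by rewrite exprn_ge0 // ltW.
have E0 := energy_ge0 (~~ i).
have le2 : 0 <= 4 * D ^+ 2 * energy (~~ i) by apply: mulr_ge0 => //; apply: mulr_ge0 => //; exact: sqr_ge0.
have m1 : measurable_fun Z (fun t => phi (pt i c t) ^+ 2) by exact: mbt.
have m2 := mle i mZ ZD.
have m3 : measurable_fun Z (fun t => 4 * D ^+ 3 * line_energy D i phi t +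
    4 * D ^+ 2 * energy (~~ i) * 1).
  by apply: measurable_funD => //; apply: measurable_funM.
rewrite -integral_cst //.
apply: (@le_trans _ _ (\int[mu]_(t in Z) (2 * D ^+ 2 * phi (pt i c t) ^+ 2 +
    1 * (4 * D ^+ 3 * line_energy D i phi t + 4 * D ^+ 2 * energy (~~ i) * 1))%:E)%E).
  apply: ge0_le_integral => //.
  - by move=> t _; rewrite lee_fin; apply: (si_ge0 (sqint_semi_inner (leb2 R))).
  - by apply/measurable_EFinP; apply: measurable_funD; apply: measurable_funM.
  - move=> t Zt; rewrite lee_fin mul1r mulr1 addrA; apply: square_le_boundary => //.
    by have := ZD _ Zt; rewrite /= in_itv /= => /andP[/ltW -> /ltW ->].
rewrite ge0_integral_lincomb //; last 3 first.
- by rewrite mulr_ge0 // sqr_ge0.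
- by move=> t _; rewrite sqr_ge0.
- by move=> t _; rewrite mulr1 addr_ge0 // mulr_ge0 ?line_energy_ge0 // mulr_ge0.
rewrite leeD2l // mul1e ge0_integral_lincomb //; last 2 first.
- by rewrite mulr_ge0.
- by move=> t _; exact: line_energy_ge0.
rewrite integral_cst // mul1e.
apply: (@le_trans _ _ ((4 * D ^+ 3)%:E * (energy i)%:E + (4 * D ^+ 2 * energy (~~ i))%:E * D%:E)%E).
  apply: leeD; apply: lee_wpmul2l;
    [by rewrite lee_fin mulr_ge0|exact: ile|by rewrite lee_fin|exact: muZ].
rewrite -!EFinM -EFinD lee_fin le_eqVlt; apply/orP; left; apply/eqP.
by case: (i) => /=; move: (N2) (energy false) (energy true) => w x y; ring.
Qed.

Lemma side_le_square i (c : R) : 0 <= c <= D ->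
  ((D ^+ 2)%:E * \int[mu]_(t in `]0%R, D[) (phi (pt i c t) ^+ 2)%:E <=
    (2 * D * N2 + 4 * D ^+ 3 * (energy false + energy true))%:E)%E.
Proof.
move=> cD; have D3 : 0 <= D ^+ 3 by rewrite exprn_ge0 // ltW.
have E0 := energy_ge0 (~~ i).
have N0 : 0 <= N2 by apply: (si_ge0 (sqint_semi_inner (leb2 R))).
have le2 : 0 <= 4 * D ^+ 2 * energy (~~ i) by apply: mulr_ge0 => //; apply: mulr_ge0 => //; exact: sqr_ge0.
have m1 : measurable_fun `]0, D[ (fun t => phi (pt i c t) ^+ 2) by exact: mbt.
have m2 := mle i (measurable_itv `]0, D[) (@subset_refl _ _).
rewrite -ge0_integralZl //; last 3 first.
- exact/measurable_EFinP.
- by move=> t _; rewrite lee_fin sqr_ge0.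
- by rewrite lee_fin sqr_ge0.
apply: (@le_trans _ _ (\int[mu]_(t in `]0%R, D[) (4 * D ^+ 3 * line_energy D i phi t +
    (2 * N2 + 4 * D ^+ 2 * energy (~~ i)) * 1)%:E)%E).
  apply: ge0_le_integral => //.
  - by move=> t _; rewrite -EFinM lee_fin mulr_ge0 ?sqr_ge0.
  - by apply/measurable_EFinP; exact: measurable_funM.
  - by apply/measurable_EFinP; apply: measurable_funD => //; apply: measurable_funM.
  - move=> t /=; rewrite in_itv /= => /andP[/ltW t0 /ltW tD].
    have tD' : 0 <= t <= D by rewrite t0.
    have := boundary_le_square i cD tD'; rewrite -EFinM lee_fin; lra.
rewrite ge0_integral_lincomb //; last 3 first.
- by rewrite mulr_ge0.
- by rewrite addr_ge0 // mulr_ge0.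
- by move=> t _; exact: line_energy_ge0.
rewrite integral_cst // mul1e.
apply: (@le_trans _ _ ((4 * D ^+ 3)%:E * (energy i)%:E + (2 * N2 + 4 * D ^+ 2 * energy (~~ i))%:E * D%:E)%E).
  apply: leeD; apply: lee_wpmul2l;
    [by rewrite lee_fin mulr_ge0|exact: ile|by rewrite lee_fin addr_ge0 // mulr_ge0|exact: muZ].
rewrite -!EFinM -EFinD lee_fin le_eqVlt; apply/orP; left; apply/eqP.
by case: (i) => /=; move: (N2) (energy false) (energy true) => w x y; ring.
Qed.

End C1.
End BoundaryInequalities.

(** * Square integrable functions on a subset of the plane *)

HB.lock Definition L2ip {R : realType} (mu : {measure set (plane R) -> \bar R})
    (A : set (plane R)) (f g : plane R -> R) : R :=
  ip mu (f \_ A) (g \_ A).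

Section RestrictedL2.
Context {R : realType}.
Variables (mu : {measure set (plane R) -> \bar R}) (A : set (plane R)).
Implicit Types (f g h v w : plane R -> R).

Local Notation L2ip := (L2ip mu A).

Lemma L2ipE f g : L2ip f g = ip mu (f \_ A) (g \_ A).
Proof. by rewrite L2ip.unlock. Qed.

Lemma patchD f g : (f + g) \_ A = f \_ A + g \_ A.
Proof. by apply/funext => z; rewrite !fctE !patchE; case: ifP; rewrite ?addr0. Qed.

Lemma patchZ c f : (c *: f) \_ A = c *: (f \_ A).
Proof.
by apply/funext => z; rewrite !fctE !patchE; case: ifP => //; rewrite scaler0.
Qed.

Lemma patchN f : (- f) \_ A = - (f \_ A).
Proof. by apply/funext => z; rewrite !fctE !patchE; case: ifP => //; rewrite oppr0. Qed.

Lemma patchB f g : (f - g) \_ A = f \_ A - g \_ A.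
Proof. by rewrite patchD patchN. Qed.

Lemma integral_L2ip f g : \int[mu]_(z in A) (f z * g z) = L2ip f g.
Proof.
rewrite L2ipE Rintegral_mkcond; apply: eq_Rintegral => z _; rewrite !patchE.
by case: ifP; rewrite ?mulr0.
Qed.

Lemma L2_semi_inner : semi_inner (L2 mu A) L2ip.
Proof.
have H := sqint_semi_inner mu; split.
- have -> : L2 mu A 0 = sqint mu ((0 : plane R -> R) \_ A) by [].
  have -> : (0 : plane R -> R) \_ A = 0.
    by apply/funext => z; rewrite patchE; case: ifP.
  exact: si_0 H.
- move=> c f g f2 g2; rewrite /L2 /= patchD patchZ; exact: (si_lin H).
- by move=> f g f2 g2; rewrite !L2ipE; exact: (si_sym H).
- by move=> c f g h f2 g2 h2; rewrite !L2ipE patchD patchZ; exact: (si_linl H).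
- by move=> f f2; rewrite L2ipE; exact: (si_ge0 H).
Qed.

Lemma L2ip_ge0 f : 0 <= L2ip f f.
Proof. by rewrite L2ipE; apply: Rintegral_ge0 => z _; rewrite -expr2 sqr_ge0. Qed.

Lemma L2normE v : L2 mu A v -> L2norm mu A v = (Num.sqrt (L2ip v v))%:E.
Proof. by move=> v2; rewrite /L2norm L2ipE Lnorm2_sqrt. Qed.

Lemma L2_cvgP (u : nat -> plane R -> R) f : (forall n, L2 mu A (u n - f)) ->
  (L2ip (u n - f) (u n - f) @[n --> \oo] --> 0) <->
  (L2norm mu A (u n - f) @[n --> \oo] --> 0%E).
Proof.
move=> u2; have := @sqint_cvgP _ _ _ mu (fun n => (u n - f) \_ A) 0.
have -> : (fun n => 'N[mu]_2%:E[EFin \o ((u n - f) \_ A - 0)%R]%E) =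
    (fun n => L2norm mu A (u n - f)).
  by apply/funext => n; rewrite subr0.
have -> : (fun n => ip mu ((u n - f) \_ A - 0) ((u n - f) \_ A - 0)) =
    (fun n => L2ip (u n - f) (u n - f)).
  by apply/funext => n; rewrite L2ipE subr0.
by apply => n; rewrite subr0; exact: u2.
Qed.

Lemma eq_ae_L2ip f f' g g' : L2 mu A f -> L2 mu A f' -> L2 mu A g -> L2 mu A g' ->
  {ae mu, forall z, A z -> f z = f' z} -> {ae mu, forall z, A z -> g z = g' z} ->
  L2ip f g = L2ip f' g'.
Proof.
move=> f2 f2' g2 g2' ff gg; rewrite !L2ipE; apply: eq_ae_ip => //.
- by move: ff; apply: filterS => z fz; rewrite !patchE; case: ifPn => // /set_mem /fz.
- by move: gg; apply: filterS => z fz; rewrite !patchE; case: ifPn => // /set_mem /fz.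
Qed.

Lemma L2ip_eq0 f : L2 mu A f -> L2ip f f = 0 -> {ae mu, forall z, A z -> f z = 0}.
Proof.
move=> f2; rewrite L2ipE => /(ip_eq0 f2); apply: filterS => z + Az.
by rewrite patchE mem_set.
Qed.

Lemma L2_le (B : set (plane R)) f : measurable B -> B `<=` A -> L2 mu A f ->
  sqint mu (f \_ B) /\ ip mu (f \_ B) (f \_ B) <= L2ip f f.
Proof.
move=> mB BA f2.
have fB : f \_ B = fun z => \1_B z * (f \_ A) z.
  apply/funext => z; rewrite !patchE indicE; have [Bz|Bz] := pselect (B z).
    by rewrite !mem_set ?mul1r //; exact: BA.
  by rewrite memNset // mul0r.
have sB : sqint mu (f \_ B).
  rewrite fB; apply: (@sqint_bounded _ _ _ _ 1) => // z.
  by rewrite indicE; case: (_ \in _); rewrite ?normr1 ?normr0.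
split => //; rewrite -lee_fin L2ipE (ip_sqrE sB) ip_sqrE //; apply: ge0_le_integral => //.
- by move=> z _; rewrite lee_fin sqr_ge0.
- by apply/measurable_EFinP/measurable_funX; exact: sqint_measurable sB.
- by apply/measurable_EFinP/measurable_funX; exact: sqint_measurable f2.
- by move=> z _; rewrite lee_fin fB exprMn ler_piMl ?sqr_ge0.
Qed.

(** The limit of the extensions by zero may be nonzero off [A]; cutting it off there only decreases
    the distances. *)
Lemma L2_complete : measurable A -> semi_complete (L2 mu A) L2ip.
Proof.
move=> mA u K u2 uK.
have [||v v2 uv] := @sqint_complete _ _ _ mu (fun n => u n \_ A) K.
- exact: u2.
- by move=> m n mn; rewrite -patchB -L2ipE; exact: uK.
have vA : v \_ A = fun z => \1_A z * v z.
  by apply/funext => z; rewrite patchE indicE; case: ifP; rewrite ?mul1r ?mul0r.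
have vA2 : sqint mu (v \_ A).
  rewrite vA; apply: (@sqint_bounded _ _ _ _ 1) => // z.
  by rewrite indicE; case: (_ \in _); rewrite ?normr1 ?normr0.
exists v => //.
have H := sqint_semi_inner mu.
apply: (@squeeze_cvgr _ _ _ _ (fun=> 0) (fun n => ip mu (u n \_ A - v) (u n \_ A - v)));
  [|exact: cvg_cst|exact: uv].
near=> n; rewrite L2ip_ge0 /= L2ipE patchB.
have s1 : sqint mu (u n \_ A - v \_ A) by apply: (siB H) => //; exact: u2.
have s2 : sqint mu (u n \_ A - v) by apply: (siB H) => //; exact: u2.
rewrite -lee_fin (ip_sqrE s1) (ip_sqrE s2); apply: ge0_le_integral => //.
- by move=> z _; rewrite lee_fin sqr_ge0.
- by apply/measurable_EFinP/measurable_funX; exact: sqint_measurable s1.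
- by apply/measurable_EFinP/measurable_funX; exact: sqint_measurable s2.
- move=> z _; rewrite lee_fin !fctE !patchE; case: ifP => // _.
  by rewrite subr0 expr0n sqr_ge0.
Unshelve. all: by end_near.
Qed.

End RestrictedL2.

(** [nu] is the sum of its restrictions to [A] and to the complement. The extension of [f] by zero
    equals [f] almost everywhere for the first and 0 almost everywhere for the second. *)
Lemma ge0_integral_mrestr d (T : measurableType d) (R : realType)
    (nu : {measure set T -> \bar R}) (A : set T) (mA : measurable A) (f : T -> \bar R) :
    measurable_fun setT f -> (forall x, (0 <= f x)%E) ->
  (\int[mrestr nu mA]_x f x = \int[nu]_(x in A) f x)%E.
Proof.
move=> mf f0; have mC := measurableC mA.
have mfA : measurable_fun setT (f \_ A).
  by apply/(measurable_restrictT _ mA); exact: measurable_funTS.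
have fA0 x : (0 <= (f \_ A) x)%E by rewrite patchE; case: ifP.
rewrite [RHS]integral_mkcond.
rewrite [RHS](@eq_measure_integral _ _ _ _ (measure_add (mrestr nu mA) (mrestr nu mC))); last first.
  move=> B mB _; apply: etrans (esym (measure_addE (mrestr nu mA) (mrestr nu mC) B)).
  rewrite /= /mrestr -measureU //.
  - by rewrite -setIUr setUv setIT.
  - exact: measurableI.
  - exact: measurableI.
  - by rewrite setIACA setICr setI0.
rewrite ge0_integral_measure_add //.
rewrite [X in (_ + X)%E](_ : _ = 0%E) ?adde0; last first.
  rewrite -[RHS](integral0 (mrestr nu mC) setT).
  apply: ge0_ae_eq_integral => //.
  exists A; split => //; first by change (nu (A `&` ~` A) = 0%E); rewrite setICr measure0.
  move=> x /= h; apply: contrapT => nA; apply: h => _.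
  by rewrite patchE memNset.
apply: ge0_ae_eq_integral => //.
exists (~` A); split => //; first by change (nu (~` A `&` A) = 0%E); rewrite setICl measure0.
move=> x /= h Ax; apply: h => _.
by rewrite patchE mem_set.
Qed.

(** * Arc length, and the C1 inequalities summed over the four sides *)

Section Arclength.
Context {R : realType}.
Variables (D : R) (D0 : 0 < D).
Local Notation mu := (@lebesgue_measure R).
Local Notation al := (arclength D).

Lemma side_pt k : exists i c, 0 <= c <= D /\ forall t, side D k t = pt i c t.
Proof.
have D1 : 0 <= D <= D by apply/andP; split => //; exact: ltW.
have D2 : 0 <= (0 : R) <= D by apply/andP; split => //; exact: ltW.
by case: k => [|[|[|k]]]; [exists true, 0|exists false, D|exists true, D|exists false, 0].
Qed.

(** Endpoints of the sides are null for the line measure, so the closed sides may be replaced by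
    []0, D[], where the estimates along lines are available. *)
Lemma integral_arclength (f : plane R -> \bar R) : measurable_fun setT f ->
  (forall z, (0 <= f z)%E) ->
  (\int[al]_z f z = \sum_(k < 4) \int[mu]_(t in `]0%R, D[) f (side D k t))%E.
Proof.
move=> mf f0; rewrite /arclength ge0_integral_measure_sum //.
apply: eq_bigr => k _.
have ms := measurable_side D k.
have mfs : measurable_fun setT (f \o side D k) by apply: measurableT_comp.
transitivity (\int[mrestr mu (measurable_itv `[0%R, D])]_t (f \o side D k) t)%E.
  by rewrite (@ge0_integral_pushforward _ _ (measurableTypeR R) _ _ (side D k) ms
    (mrestr mu (measurable_itv `[0%R, D])) setT f measurableT).
rewrite ge0_integral_mrestr //; last by move=> t; exact: f0.
by rewrite -(@integral_itv_bndoo R 0 D _ true false) //; exact: measurable_funTS.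
Qed.

Lemma arclengthE (Z : set (plane R)) : measurable Z ->
  (al Z = \sum_(k < 4) mu (`]0%R, D[ `&` side D k @^-1` Z))%E.
Proof.
move=> mZ; have -> : al Z = (\int[al]_z (\1_Z z)%:E)%E by rewrite integral_indic // setIT.
rewrite integral_arclength; last 2 first.
- by apply/measurable_EFinP; apply: measurable_indic.
- by move=> z; rewrite lee_fin.
apply: eq_bigr => k _; rewrite -[X in mu X]setIC.
have mp : measurable (side D k @^-1` Z).
  by rewrite -[_ @^-1` _]setTI; apply: measurable_side.
rewrite -(integral_indic mu) //.
Qed.

Lemma integral_arclength_set (Z : set (plane R)) (f : plane R -> R) : measurable Z ->
    measurable_fun setT f -> (forall z, 0 <= f z) ->
  (\int[al]_(z in Z) (f z)%:E = \sum_(k < 4)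
    \int[mu]_(t in `]0%R, D[ `&` side D k @^-1` Z) (f (side D k t))%:E)%E.
Proof.
move=> mZ mf f0; rewrite integral_mkcond integral_arclength; last 2 first.
- apply/(measurable_restrictT _ mZ); apply: measurable_funTS; exact/measurable_EFinP.
- by move=> z; rewrite patchE; case: ifP => //; rewrite lee_fin.
apply: eq_bigr => k _; rewrite integral_mkcondr; apply: eq_integral => t _.
by rewrite !patchE.
Qed.

Section C1Boundary.
Variables (phi : plane R -> R) (Cphi : Ck 1 phi).

Let cphi : continuous phi. Proof. by have [] := Cphi. Qed.
Let mphi : measurable_fun setT (fun z => phi z ^+ 2).
Proof. by apply: measurable_funX; exact: continuous_plane_measurable. Qed.

Let mpre (Z : set (plane R)) k : measurable Z ->
  measurable (`]0%R, D[ `&` side D k @^-1` Z).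
Proof.
move=> mZ; apply: measurableI => //.
by rewrite -[_ @^-1` _]setTI; apply: measurable_side.
Qed.

Local Notation E := (energy D phi false + energy D phi true).
Local Notation N := (L2ip (leb2 R) (square D) phi phi).

(** Sum of [square_le_side] over the four sides, each with its own part of [Z]; the gradient term is
    counted four times, hence 16. *)
Lemma poincare_C1 (Z : set (plane R)) : measurable Z ->
  (N%:E * al Z <= (2 * D ^+ 2)%:E * \int[al]_(z in Z) (phi z ^+ 2)%:E +
     (16 * D ^+ 3 * E)%:E)%E.
Proof.
move=> mZ; rewrite arclengthE // integral_arclength_set // => [|z]; last exact: sqr_ge0.
rewrite ge0_sume_distrr => [|k _]; last exact: measure_ge0.
rewrite ge0_sume_distrr => [|k _]; last first.
  by apply: integral_ge0 => t _; rewrite lee_fin sqr_ge0.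
have -> : 16 * D ^+ 3 * E = \sum_(k < 4) (4 * D ^+ 3 * E).
  by rewrite sumr_const card_ord; move: E => e; rewrite -mulr_natl; ring.
rewrite -sumEFin -big_split /=; apply: lee_sum => k _.
have [i [c [cD sE]]] := side_pt k.
have := square_le_side D0 Cphi i cD (mpre k mZ) (@subIsetl _ _ _); rewrite -L2ipE.
move/le_trans; apply; rewrite leeD2r // lee_wpmul2l //.
  by rewrite lee_fin mulr_ge0 // sqr_ge0.
by rewrite le_eqVlt; apply/orP; left; apply/eqP; apply: eq_integral => t _; rewrite sE.
Qed.

Lemma trace_C1 :
  ((D ^+ 2)%:E * \int[al]_z (phi z ^+ 2)%:E <= (8 * D * N + 16 * D ^+ 3 * E)%:E)%E.
Proof.
rewrite integral_arclength; last 2 first.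
- exact/measurable_EFinP.
- by move=> z; rewrite lee_fin sqr_ge0.
rewrite ge0_sume_distrr => [|k _]; last first.
  by apply: integral_ge0 => t _; rewrite lee_fin sqr_ge0.
have -> : 8 * D * N + 16 * D ^+ 3 * E = \sum_(k < 4) (2 * D * N + 4 * D ^+ 3 * E).
  by rewrite sumr_const card_ord; move: N E => n e; rewrite -mulr_natl; ring.
rewrite -sumEFin; apply: lee_sum => k _.
have [i [c [cD sE]]] := side_pt k.
have := side_le_square D0 Cphi i cD; rewrite -L2ipE; apply: le_trans.
rewrite lee_wpmul2l ?lee_fin ?sqr_ge0 //.
by rewrite le_eqVlt; apply/orP; left; apply/eqP; apply: eq_integral => t _; rewrite sE.
Qed.

Lemma L2_arclength_C1 : L2 al (bsquare D) phi.
Proof.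
have mb := measurable_bsquare D.
apply: sqintP.
  apply/(measurable_restrictT _ mb); apply: measurable_funTS.
  exact: continuous_plane_measurable.
apply: (@le_lt_trans _ _ (\int[al]_z (phi z ^+ 2)%:E)%E).
  apply: ge0_le_integral => //.
  - by move=> z _; rewrite lee_fin sqr_ge0.
  - apply/measurable_EFinP; apply: measurable_funX.
    apply/(measurable_restrictT _ mb); apply: measurable_funTS.
    exact: continuous_plane_measurable.
  - exact/measurable_EFinP.
  - by move=> z _; rewrite lee_fin patchE; case: ifP => // _; rewrite expr0n sqr_ge0.
have := trace_C1; set I := (\int[al]_z _)%E => H.
have D2 : 0 < D ^+ 2 by rewrite exprn_gt0.
rewrite ltey; apply/eqP => Ioo; move: H; rewrite Ioo gt0_muley ?lte_fin //.
Qed.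

End C1Boundary.
End Arclength.

(** * The spaces H1 and V *)

HB.lock Definition wderiv {R : realType} (D : R) (i : bool) (v : plane R -> R) :
  plane R -> R := weak_pderiv D i v.

Section SobolevSpace.
Context {R : realType}.
Variables (D : R) (D0 : 0 < D).
Implicit Types (u v w h t phi : plane R -> R) (i : bool).
Local Notation S := (square D).
Local Notation L2S := (L2 (leb2 R) S).
Local Notation l2 := (L2ip (leb2 R) S).
Local Notation wp := (wderiv D).
Local Notation HS := (L2_semi_inner (leb2 R) S).

Lemma wderivE i v : wp i v = weak_pderiv D i v.
Proof. by rewrite wderiv.unlock. Qed.

Lemma test_L2 phi i : test_function S phi -> L2S phi /\ L2S (pderiv i phi).
Proof.
move=> [/(_ 1%N) [c /(_ i) [_ cd]] _].
by split; exact: sqint_continuous.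
Qed.

Lemma is_weak_pderivP i v w : is_weak_pderiv D i v w <->
  L2S w /\ forall phi, test_function S phi -> l2 v (pderiv i phi) = - l2 w phi.
Proof.
by split=> -[w2 H]; split=> // phi tp; have := H _ tp; rewrite !integral_L2ip.
Qed.

Lemma is_weak_pderiv_lin i c u v w w' : L2S u -> L2S v ->
  is_weak_pderiv D i u w -> is_weak_pderiv D i v w' ->
  is_weak_pderiv D i (c *: u + v) (c *: w + w').
Proof.
move=> u2 v2 /is_weak_pderivP [w2 Hw] /is_weak_pderivP [w2' Hw'].
apply/is_weak_pderivP; split; first exact: (si_lin HS).
move=> phi tp; have [p2 dp2] := test_L2 i tp.
by rewrite !(si_linl HS) // Hw // Hw' // mulrN opprD.
Qed.

(** The difference of two weak derivatives is orthogonal to every test function. *)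
Lemma is_weak_pderiv_uniq i v w w' : is_weak_pderiv D i v w ->
  is_weak_pderiv D i v w' -> {ae leb2 R, forall z, S z -> w z = w' z}.
Proof.
move=> /is_weak_pderivP [w2 Hw] /is_weak_pderivP [w2' Hw'].
have := @ortho_test_ae0 _ D (w - w') D0 (siB HS w2 w2').
move=> /(_ _)/wrap[phi tp|].
  have [p2 dp2] := test_L2 i tp; rewrite integral_L2ip (sibBl HS) //.
  by rewrite -[l2 w _]opprK -Hw // Hw' // opprK subrr.
by apply: filterS => z Hz Sz; apply/eqP; rewrite -subr_eq0; apply/eqP; exact: Hz.
Qed.

Lemma wderivP i v : H1 D v -> is_weak_pderiv D i v (wp i v).
Proof.
move=> [_ /(_ i) [w Hw]]; rewrite wderiv.unlock /weak_pderiv.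
by apply: (@xgetPex _ _ [set w | is_weak_pderiv D i v w]); exists w.
Qed.

Lemma wderiv_L2 i v : H1 D v -> L2S (wp i v).
Proof. by move=> /(wderivP i) []. Qed.

Lemma wderiv_ae i v w : H1 D v -> is_weak_pderiv D i v w ->
  {ae leb2 R, forall z, S z -> wp i v z = w z}.
Proof. by move=> Hv; apply: is_weak_pderiv_uniq; exact: wderivP. Qed.

Lemma H1_lin c u v : H1 D u -> H1 D v -> H1 D (c *: u + v).
Proof.
move=> Hu Hv; have [u2 _] := Hu; have [v2 _] := Hv; split; first exact: (si_lin HS).
move=> i; exists (c *: wp i u + wp i v).
by apply: is_weak_pderiv_lin => //; exact: wderivP.
Qed.

Lemma H1_0 : H1 D 0.
Proof.
split; first exact: si_0 HS.
move=> i; exists 0; apply/is_weak_pderivP; split; first exact: si_0 HS.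
by move=> phi tp; have [p2 dp2] := test_L2 i tp; rewrite !(sib0l HS) // oppr0.
Qed.

Lemma wderiv_lin_ae i c u v : H1 D u -> H1 D v ->
  {ae leb2 R, forall z, S z -> wp i (c *: u + v) z = (c *: wp i u + wp i v) z}.
Proof.
move=> Hu Hv; apply: wderiv_ae; first exact: H1_lin.
by apply: is_weak_pderiv_lin; [case: Hu|case: Hv|exact: wderivP|exact: wderivP].
Qed.

(** The representatives selected by choice are linear only almost everywhere; under the integral
    this makes no difference, and the bilinear forms below are genuinely bilinear. *)
Lemma wderiv_linl i c u v h : H1 D u -> H1 D v -> L2S h ->
  l2 (wp i (c *: u + v)) h = c * l2 (wp i u) h + l2 (wp i v) h.
Proof.
move=> Hu Hv h2; rewrite -(si_linl HS c (wderiv_L2 i Hu) (wderiv_L2 i Hv) h2).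
apply: eq_ae_L2ip => //.
- by apply: wderiv_L2; exact: H1_lin.
- by apply: (si_lin HS); exact: wderiv_L2.
- exact: wderiv_lin_ae.
- exact: aeW.
Qed.

Definition grad_ip u v : R := l2 (wp false u) (wp false v) + l2 (wp true u) (wp true v).

Definition h1_ip u v : R := l2 u v + grad_ip u v.

Lemma grad_semi_inner : semi_inner (H1 D) grad_ip.
Proof.
split.
- exact: H1_0.
- exact: H1_lin.
- move=> u v Hu Hv; rewrite /grad_ip.
  rewrite (si_sym HS (wderiv_L2 false Hu) (wderiv_L2 false Hv)).
  by rewrite (si_sym HS (wderiv_L2 true Hu) (wderiv_L2 true Hv)).
- move=> c u v h Hu Hv Hh; rewrite /grad_ip.
  rewrite (wderiv_linl false c Hu Hv (wderiv_L2 false Hh)).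
  rewrite (wderiv_linl true c Hu Hv (wderiv_L2 true Hh)).
  by rewrite mulrDr addrACA.
- by move=> u Hu; rewrite addr_ge0 // L2ip_ge0.
Qed.

Lemma h1_semi_inner : semi_inner (H1 D) h1_ip.
Proof.
have HG := grad_semi_inner; split.
- exact: H1_0.
- exact: H1_lin.
- move=> u v Hu Hv; have [[u2 _] [v2 _]] := (Hu, Hv).
  by rewrite /h1_ip (si_sym HG Hu Hv) (si_sym HS u2 v2).
- move=> c u v h Hu Hv Hh; have [u2 _] := Hu.
  have [[v2 _] [h2 _]] := (Hv, Hh).
  rewrite /h1_ip (si_linl HG c Hu Hv Hh) (si_linl HS c u2 v2 h2).
  by move: (grad_ip u h) (grad_ip v h) => a b; rewrite mulrDr addrACA.
- by move=> u Hu; rewrite addr_ge0 ?L2ip_ge0 // (si_ge0 HG).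
Qed.

Lemma grad_ip_ge0 u : 0 <= grad_ip u u.
Proof. by rewrite addr_ge0 // L2ip_ge0. Qed.

Lemma h1_ip_ge0 u : 0 <= h1_ip u u.
Proof. by rewrite addr_ge0 ?L2ip_ge0 ?grad_ip_ge0. Qed.

Lemma H1normE v : H1 D v -> H1norm D v = (Num.sqrt (h1_ip v v))%:E.
Proof.
move=> Hv; have [v2 _] := Hv.
rewrite /H1norm -poweR_sqrt ?h1_ip_ge0 // -!wderivE; congr (_ `^ _)%E.
have w2 i : L2S (wp i v) by exact: wderiv_L2.
have E h : L2S h -> (\int[leb2 R]_(z in S) (h z ^+ 2)%:E = (l2 h h)%:E)%E.
  move=> h2; rewrite L2ipE (ip_sqrE h2) [LHS]integral_mkcond; apply: eq_integral => z _.
  by rewrite !patchE; case: ifP; rewrite ?expr0n.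
have ms h : L2S h -> measurable_fun S (fun z => (h z ^+ 2)%:E).
  move=> h2; apply/measurable_EFinP; apply: measurable_funX.
  by apply/(measurable_restrictT _ (measurable_square D)); exact: sqint_measurable h2.
have mS := measurable_square D.
under eq_integral do rewrite 2!EFinD.
rewrite !ge0_integralD //; try by move=> z _; rewrite -?EFinD lee_fin ?addr_ge0 ?sqr_ge0.
- by rewrite !E.
- exact: ms.
- exact: ms.
- exact: ms.
- by apply: emeasurable_funD; exact: ms.
Qed.

Lemma H1_cvgP (u : nat -> plane R -> R) v : (forall n, H1 D (u n - v)) ->
  (h1_ip (u n - v) (u n - v) @[n --> \oo] --> 0) <->
  (H1norm D (u n - v) @[n --> \oo] --> 0%E).
Proof.
move=> uv; have -> : (fun n => H1norm D (u n - v)) =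
    (fun n => (Num.sqrt (h1_ip (u n - v) (u n - v)))%:E).
  by apply/funext => n; exact: H1normE.
by apply: sqrt_cvg0P => n; exact: h1_ip_ge0.
Qed.

Lemma C1_H1 phi : Ck 1 phi -> H1 D phi.
Proof.
move=> Cphi; split; first by apply: sqint_continuous => //; case: Cphi.
by move=> i; exists (pderiv i phi); exact: C1_weak_pderiv.
Qed.

Lemma C1_weak_energy phi i : Ck 1 phi -> l2 (wp i phi) (wp i phi) = energy D phi i.
Proof.
move=> Cphi; have Hp := C1_H1 Cphi; have wpd := C1_weak_pderiv i D0 Cphi.
have ae := wderiv_ae Hp wpd.
rewrite /energy -L2ipE.
by apply: eq_ae_L2ip => //; try exact: wderiv_L2; case: wpd.
Qed.

(** The zero function is a weak derivative of a null function, and weak derivatives are unique.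
    Hence a vector of [H1] is null as soon as its values are, whatever representatives are chosen
    for its derivatives. *)
Lemma ae_eq0_h1 u : H1 D u -> {ae leb2 R, forall z, S z -> u z = 0} -> h1_ip u u = 0.
Proof.
move=> Hu u0; have [u2 _] := Hu; have Z2 := si_0 HS.
have l0 h : L2S h -> l2 u h = 0.
  move=> h2; rewrite -(sib0l HS h2); apply: eq_ae_L2ip => //; exact: aeW.
rewrite /h1_ip l0 // add0r /grad_ip.
suff w0 i : l2 (wp i u) (wp i u) = 0 by rewrite !w0 addr0.
have w2 := wderiv_L2 i Hu.
have W0 : is_weak_pderiv D i u 0.
  apply/is_weak_pderivP; split => // phi tp; have [p2 dp2] := test_L2 i tp.
  by rewrite l0 // (sib0l HS) // oppr0.
rewrite -(sib0l HS w2); apply: eq_ae_L2ip => //; last exact: aeW.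
exact: wderiv_ae.
Qed.

Lemma h1_eq0_ae u : H1 D u -> h1_ip u u = 0 -> {ae leb2 R, forall z, S z -> u z = 0}.
Proof.
move=> Hu u0; apply: L2ip_eq0; first by case: Hu.
apply/eqP; rewrite eq_le L2ip_ge0 andbT -u0 lerDl.
exact: grad_ip_ge0.
Qed.

End SobolevSpace.

(** * Traces of functions in H1 *)

Lemma cvg0_le (R : realType) (x y : R) (e : nat -> R) :
  e n @[n --> \oo] --> 0 -> (forall n, x <= e n + y) -> x <= y.
Proof.
move=> e0 H; have cv : (e n + y) @[n --> \oo] --> y.
  by rewrite -[X in _ --> X]add0r; apply: cvgD => //; exact: cvg_cst.
rewrite -(cvg_lim (@Rhausdorff R) cv); apply: limr_ge; first by apply/cvg_ex; exists y.
exact: nearW.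
Qed.

HB.lock Definition trace {R : realType} (D : R) (v : plane R -> R) : plane R -> R :=
  xget (fun=> 0) [set t | is_trace D v t].

Section Traces.
Context {R : realType}.
Variables (D : R) (D0 : 0 < D).
Implicit Types (u v w s t phi psi : plane R -> R) (i : bool).
Local Notation S := (square D).
Local Notation B := (bsquare D).
Local Notation al := (arclength D).
Local Notation l2 := (L2ip (leb2 R) S).
Local Notation L2B := (L2 al B).
Local Notation lb := (L2ip al B).
Local Notation HB := (L2_semi_inner al B).
Local Notation H1S := (h1_semi_inner D0).
Local Notation h1 := (h1_ip D).

Lemma is_traceP v t : is_trace D v t <-> [/\ H1 D v, L2B t &
  exists p : nat -> plane R -> R, [/\ forall n, Ck 1 (p n),
    h1 (p n - v) (p n - v) @[n --> \oo] --> 0 &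
    lb (p n - t) (p n - t) @[n --> \oo] --> 0]].
Proof.
split=> -[Hv t2 [p [Cp pv pt]]]; split => //; exists p; split => //.
- apply/(H1_cvgP (D := D)) => // n; apply: (siB H1S) => //; exact: C1_H1.
- apply/L2_cvgP => // n; apply: (siB HB) => //; exact: L2_arclength_C1.
- apply/(H1_cvgP (D := D)) => // n; apply: (siB H1S) => //; exact: C1_H1.
- apply/L2_cvgP => // n; apply: (siB HB) => //; exact: L2_arclength_C1.
Qed.

Lemma h1_C1 phi : Ck 1 phi ->
  h1 phi phi = l2 phi phi + (energy D phi false + energy D phi true).
Proof. by move=> Cphi; rewrite /h1_ip /grad_ip !C1_weak_energy. Qed.

(** The coefficients 8 D and 16 D^3 of [trace_C1], added so as to dominate both and divided by the
    factor D^2 on its left. *)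
Definition trace_const : R := (8 * D + 16 * D ^+ 3) / D ^+ 2.

Lemma trace_const_gt0 : 0 < trace_const.
Proof. by rewrite divr_gt0 ?addr_gt0 ?mulr_gt0 ?exprn_gt0. Qed.

Lemma trace_bound_C1 phi : Ck 1 phi -> lb phi phi <= trace_const * h1 phi phi.
Proof.
move=> Cphi; have D2 : 0 < D ^+ 2 by rewrite exprn_gt0.
have mphi : measurable_fun setT phi by apply: continuous_plane_measurable; case: Cphi.
rewrite /trace_const mulrAC ler_pdivlMr // mulrC -lee_fin.
have b2 := L2_arclength_C1 D0 Cphi.
apply: (@le_trans _ _ ((D ^+ 2)%:E * \int[al]_z (phi z ^+ 2)%:E)%E).
  rewrite EFinM lee_wpmul2l ?lee_fin ?sqr_ge0 // L2ipE (ip_sqrE b2).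
  apply: ge0_le_integral => //.
  - by move=> z _; rewrite lee_fin sqr_ge0.
  - by apply/measurable_EFinP/measurable_funX; exact: sqint_measurable b2.
  - by apply/measurable_EFinP; exact: measurable_funX.
  - by move=> z _; rewrite lee_fin patchE; case: ifP => // _; rewrite expr0n sqr_ge0.
apply: (le_trans (trace_C1 D0 Cphi)); rewrite lee_fin h1_C1 //.
have := L2ip_ge0 (leb2 R) S phi; have := energy_ge0 D0 Cphi false.
have := energy_ge0 D0 Cphi true.
move: (l2 phi phi) (energy D phi false) (energy D phi true) => n e0 e1 h0 h1 h2.
have D3 : 0 <= D ^+ 3 by rewrite exprn_ge0 // ltW.
have := mulr_ge0 D3 h2; have := mulr_ge0 (ltW D0) (addr_ge0 h0 h1); lra.
Qed.

(** Limit of the C1 bound along the sequence that defines the trace. The factor 4 comes from (x +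
    y)^2 <= 2 x^2 + 2 y^2, used once on the boundary and once in the square. *)
Lemma trace_bound v t : is_trace D v t -> lb t t <= 4 * trace_const * h1 v v.
Proof.
move=> /is_traceP [Hv t2 [p [Cp pv pt]]].
have K0 := trace_const_gt0.
pose e n := 2 * lb (p n - t) (p n - t) + 4 * trace_const * h1 (p n - v) (p n - v).
apply: (@cvg0_le _ _ _ e).
  by rewrite -[X in _ --> X]addr0 -{1}(mulr0 2) -[X in _ + X](mulr0 (4 * trace_const));
    apply: cvgD; apply: cvgMr.
move=> n; have Hp := C1_H1 D0 (Cp n); have p2 := L2_arclength_C1 D0 (Cp n).
have ptB := siB HB p2 t2; have pvB := siB H1S Hp Hv.
have h : lb t t <= 2 * lb (p n - t) (p n - t) + 2 * lb (p n) (p n).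
  have := sib_sqrD_le HB (siB HB t2 p2) p2.
  by rewrite subrK -(opprB (p n) t) (sib_sqrN HB ptB).
have h' : h1 (p n) (p n) <= 2 * h1 (p n - v) (p n - v) + 2 * h1 v v.
  by have := sib_sqrD_le H1S pvB Hv; rewrite subrK.
have := trace_bound_C1 (Cp n).
have := ler_wpM2l (ltW K0) h'; rewrite /e; lra.
Qed.

Lemma trace_lin c u v s t : is_trace D u s -> is_trace D v t ->
  is_trace D (c *: u + v) (c *: s + t).
Proof.
move=> /is_traceP [Hu s2 [p [Cp pu ps]]] /is_traceP [Hv t2 [q [Cq qv qt]]].
apply/is_traceP; split; [exact: (si_lin H1S)|exact: (si_lin HB)|].
exists (fun n => c *: p n + q n); split.
- move=> n; apply: CkD => //.
  have -> : c *: p n = cst c * p n by [].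
  by apply: CkM => //; exact: Ck_cst.
- apply: (@squeeze_cvgr _ _ _ _ (fun=> 0) (fun n =>
    2 * c ^+ 2 * h1 (p n - u) (p n - u) + 2 * h1 (q n - v) (q n - v))).
  + near=> n; rewrite h1_ip_ge0 /= opprD addrACA -scalerBr.
    have Hp := siB H1S (C1_H1 D0 (Cp n)) Hu; have Hq := siB H1S (C1_H1 D0 (Cq n)) Hv.
    apply: (le_trans (sib_sqrD_le H1S (siZ H1S c Hp) Hq)).
    have cp := siZ H1S c Hp.
    by rewrite (sibZl H1S c Hp cp) (si_sym H1S Hp cp) (sibZl H1S c Hp Hp) expr2 !mulrA.
  + exact: cvg_cst.
  + by rewrite -[X in _ --> X]addr0 -{1}(mulr0 (2 * c ^+ 2)) -[X in _ + X](mulr0 2);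
      apply: cvgD; apply: cvgMr.
- apply: (@squeeze_cvgr _ _ _ _ (fun=> 0) (fun n =>
    2 * c ^+ 2 * lb (p n - s) (p n - s) + 2 * lb (q n - t) (q n - t))).
  + near=> n; rewrite L2ip_ge0 /= opprD addrACA -scalerBr.
    have Hp := siB HB (L2_arclength_C1 D0 (Cp n)) s2.
    have Hq := siB HB (L2_arclength_C1 D0 (Cq n)) t2.
    apply: (le_trans (sib_sqrD_le HB (siZ HB c Hp) Hq)).
    have cp := siZ HB c Hp.
    by rewrite (sibZl HB c Hp cp) (si_sym HB Hp cp) (sibZl HB c Hp Hp) expr2 !mulrA.
  + exact: cvg_cst.
  + by rewrite -[X in _ --> X]addr0 -{1}(mulr0 (2 * c ^+ 2)) -[X in _ + X](mulr0 2);
      apply: cvgD; apply: cvgMr.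
Unshelve. all: by end_near.
Qed.

(** By linearity the difference is a trace of 0, and the trace inequality forces it to be null. *)
Lemma trace_uniq v s t : is_trace D v s -> is_trace D v t ->
  {ae al, forall z, B z -> s z = t z}.
Proof.
move=> Ts Tt; have := trace_lin (-1) Tt Ts.
rewrite scaleN1r addNr scaleN1r => T0.
have d2 : L2B (- t + s) by case: T0.
have := trace_bound T0.
rewrite (sib0l H1S) ?mulr0; last exact: H1_0.
move=> h; have := L2ip_eq0 d2; move=> /(_ _)/wrap[|].
  by apply/eqP; rewrite eq_le h L2ip_ge0.
apply: filterS => z Hz Bz; apply/eqP; rewrite -subr_eq0 addrC; apply/eqP; exact: Hz.
Qed.

(** Diagonal argument: each [u n] is replaced by a C1 function within 1/(n+1) of it, both in [H1]
    and, for its boundary values, in [L2]. *)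
Lemma trace_closed (u : nat -> plane R -> R) (t : nat -> plane R -> R) v s :
  (forall n, is_trace D (u n) (t n)) -> H1 D v -> L2B s ->
  h1 (u n - v) (u n - v) @[n --> \oo] --> 0 ->
  lb (t n - s) (t n - s) @[n --> \oo] --> 0 -> is_trace D v s.
Proof.
move=> Tu Hv s2 uv ts; apply/is_traceP; split => //.
have /choice[p pP] : forall n : nat, exists q, [/\ Ck 1 q,
    h1 (q - u n) (q - u n) <= n.+1%:R^-1 & lb (q - t n) (q - t n) <= n.+1%:R^-1].
  move=> n; have /is_traceP [Hu t2 [p [Cp pu pt]]] := Tu n.
  have e0 : 0 < n.+1%:R^-1 :> R by rewrite invr_gt0 ltr0n.
  have /cvgrPdist_lt/(_ _ e0) := pu; have /cvgrPdist_lt/(_ _ e0) := pt.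
  move=> h1' h2'; near \oo => m; exists (p m); split => //.
  - have : `|0 - h1 (p m - u n) (p m - u n)| < n.+1%:R^-1 by near: m.
    by rewrite sub0r normrN => /ltW; apply: le_trans; exact: ler_norm.
  - have : `|0 - lb (p m - t n) (p m - t n)| < n.+1%:R^-1 by near: m.
    by rewrite sub0r normrN => /ltW; apply: le_trans; exact: ler_norm.
have h0 : n.+1%:R^-1 @[n --> \oo] --> (0 : R) by exact: cvg_harmonic.
exists p; split; first by move=> n; case: (pP n).
- apply: (@squeeze_cvgr _ _ _ _ (fun=> 0) (fun n =>
    2 * n.+1%:R^-1 + 2 * h1 (u n - v) (u n - v))).
  + near=> n; rewrite h1_ip_ge0 /=; have [Cp pu _] := pP n.
    have [Hu _ _] := Tu n.
    apply: (le_trans (sib_sqrB_le H1S (C1_H1 D0 Cp) Hu Hv)).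
    by rewrite lerD2r ler_pM2l.
  + exact: cvg_cst.
  + by rewrite -[X in _ --> X]addr0 -{1}(mulr0 2) -[X in _ + X](mulr0 2);
      apply: cvgD; apply: cvgMr.
- apply: (@squeeze_cvgr _ _ _ _ (fun=> 0) (fun n =>
    2 * n.+1%:R^-1 + 2 * lb (t n - s) (t n - s))).
  + near=> n; rewrite L2ip_ge0 /=; have [Cp _ pt] := pP n.
    have [_ t2 _] := Tu n.
    apply: (le_trans (sib_sqrB_le HB (L2_arclength_C1 D0 Cp) t2 s2)).
    by rewrite lerD2r ler_pM2l.
  + exact: cvg_cst.
  + by rewrite -[X in _ --> X]addr0 -{1}(mulr0 2) -[X in _ + X](mulr0 2);
      apply: cvgD; apply: cvgMr.
Unshelve. all: by end_near.
Qed.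

End Traces.

(** * The Poincare inequality on V; completeness of H1 and V *)

Section EssentialBoundary.
Context {R : realType}.
Variables (D : R) (D0 : 0 < D) (G1 : set (plane R)).
Hypotheses (G1B : G1 `<=` bsquare D) (G1_gt0 : (0 < arclength D G1)%E).
Implicit Types (u v w s t phi psi : plane R -> R) (i : bool).
Local Notation S := (square D).
Local Notation B := (bsquare D).
Local Notation al := (arclength D).
Local Notation L2S := (L2 (leb2 R) S).
Local Notation l2 := (L2ip (leb2 R) S).
Local Notation L2B := (L2 al B).
Local Notation lb := (L2ip al B).
Local Notation HS := (L2_semi_inner (leb2 R) S).
Local Notation HB := (L2_semi_inner al B).
Local Notation H1S := (h1_semi_inner D0).
Local Notation HG := (grad_semi_inner D0).
Local Notation h1 := (h1_ip D).
Local Notation wp := (wderiv D).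
Local Notation VD := (V D G1).

(** Arc length takes outer measure values outside the measurable sets, and [G1] is an arbitrary set
    here, so monotonicity is wanted in this generality. *)
Lemma arclength_mono (X Y : set (plane R)) : X `<=` Y -> (al X <= al Y)%E.
Proof.
move=> XY; apply: lee_sum => k _; apply: le_mu_ext => t [Xt tD]; split => //.
exact: XY.
Qed.

Lemma V_lin c u v : VD u -> VD v -> VD (c *: u + v).
Proof.
move=> [Hu [s Ts s0]] [Hv [t Tt t0]]; split; first exact: (si_lin H1S).
exists (c *: s + t); first exact: trace_lin.
by move: s0 t0; apply: filterS2 => z sz tz Gz; rewrite !fctE sz // tz // scaler0 addr0.
Qed.

Lemma V_0 : VD 0.
Proof.
have Z2 := si_0 HB; split; first exact: H1_0.
exists 0; last by apply: aeW.
apply/(is_traceP D0); split => //; first exact: H1_0.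
exists (fun=> 0); split.
- by move=> n; exact: (Ck_cst 1 0).
- by rewrite subrr (sib0l H1S); [exact: cvg_cst|exact: H1_0].
- by rewrite subrr (sib0l HB); [exact: cvg_cst|].
Qed.

Lemma V_semi_inner : semi_inner VD h1.
Proof.
split; [exact: V_0|exact: V_lin| | |].
- by move=> u v [Hu _] [Hv _]; exact: (si_sym H1S).
- by move=> c u v w [Hu _] [Hv _] [Hw _]; exact: (si_linl H1S).
- by move=> u _; exact: h1_ip_ge0.
Qed.

Lemma measurable_L2 (A : set (plane R)) (mu : {measure set (plane R) -> \bar R}) v :
  measurable A -> L2 mu A v -> measurable_fun A v.
Proof. by move=> mA v2; apply/(measurable_restrictT _ mA); exact: sqint_measurable v2. Qed.

Lemma V_poincare : exists K, 0 < K /\ forall v, VD v -> h1 v v <= K * grad_ip D v v.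
Proof.
have [gam [gam0 gamE]] : exists gam : R, 0 < gam /\ (gam%:E <= al G1)%E.
  move: G1_gt0; case: (al G1) => [r||] // r0; first by exists r.
  by exists 1; rewrite ltr01 leey.
exists (1 + 64 * D ^+ 3 / gam).
have D3 : 0 < D ^+ 3 by rewrite exprn_gt0.
split; first by rewrite addr_gt0 // divr_gt0 // mulr_gt0.
move=> v [Hv [t Tt t0]]; have [v2 _] := Hv.
suff H : gam * l2 v v <= 64 * D ^+ 3 * grad_ip D v v.
  by rewrite {1}/h1_ip mulrDl mul1r [leLHS]addrC lerD2l mulrAC ler_pdivlMr // mulrC.
have /(is_traceP D0) [_ t2 [p [Cp pv pt]]] := Tt.
(* A measurable set that contains [G1] up to a null set, so [al Z] is at least [gam]. The
   approximations [p n] do not vanish on [Z], but [t] does, so their boundary integral over [Z] is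
   at most the squared distance from [p n] to [t]. *)
pose Z := B `&` t @^-1` [set 0].
have mt := measurable_L2 (measurable_bsquare D) t2.
have mZ : measurable Z by apply: mt => //; exact: measurable_bsquare.
have gZ : (gam%:E <= al Z)%E.
  apply: (le_trans gamE); have [N [mN N0 NG]] := t0.
  apply: (@le_trans _ _ (al (Z `|` N))).
    apply: arclength_mono => z Gz; have [tz|tz] := eqVneq (t z) 0.
      by left; split => //; exact: G1B.
    by right; apply: NG => /= /(_ Gz) /eqP; rewrite (negbTE tz).
  by have := measureU2 al mZ mN; rewrite [X in (_ <= _ + X)%E]N0 adde0.
have pZ n : (\int[al]_(z in Z) (p n z ^+ 2)%:E <= (lb (p n - t) (p n - t))%:E)%E.
  have pt2 := siB HB (L2_arclength_C1 D0 (Cp n)) t2.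
  have [z2 /=] := L2_le mZ (@subIsetl _ _ _) pt2.
  rewrite -lee_fin (ip_sqrE z2); apply: le_trans.
  rewrite [leLHS]integral_mkcond le_eqVlt; apply/orP; left; apply/eqP.
  apply: eq_integral => z _; rewrite !patchE; case: ifPn => [/set_mem[_ /= tz]|_].
    by rewrite !fctE tz subr0.
  by rewrite expr0n.
(* Comparing [v] with [p n] by (x + y)^2 <= 2 x^2 + 2 y^2, for values and for gradients, turns the
   16 of [poincare_C1] into 64; [e n] collects the approximation errors. *)
pose e n := (2 * gam + 64 * D ^+ 3) * h1 (p n - v) (p n - v) + 4 * D ^+ 2 * lb (p n - t) (p n - t).
apply: (@cvg0_le _ _ _ e).
  rewrite -[X in _ --> X]addr0 -{1}(mulr0 (2 * gam + 64 * D ^+ 3)).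
  rewrite -[X in _ + X](mulr0 (4 * D ^+ 2)).
  by apply: cvgD; apply: cvgMr.
move=> n; have Hp := C1_H1 D0 (Cp n); have [p2 _] := Hp.
have pvH := siB H1S Hp Hv; have [pv2 _] := pvH.
have k1 : l2 v v <= 2 * l2 (p n - v) (p n - v) + 2 * l2 (p n) (p n).
  have := sib_sqrD_le HS (siB HS v2 p2) p2.
  by rewrite subrK -(opprB (p n) v) (sib_sqrN HS pv2).
have k2 : grad_ip D (p n) (p n) <= 2 * grad_ip D (p n - v) (p n - v) + 2 * grad_ip D v v.
  by have := sib_sqrD_le HG pvH Hv; rewrite subrK.
have k3 : gam * l2 (p n) (p n) <= 2 * D ^+ 2 * lb (p n - t) (p n - t) + 16 * D ^+ 3 * grad_ip D (p n) (p n).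
  rewrite -lee_fin EFinD mulrC EFinM.
  apply: (@le_trans _ _ ((l2 (p n) (p n))%:E * al Z)%E).
    by rewrite lee_wpmul2l // lee_fin L2ip_ge0.
  apply: (le_trans (poincare_C1 D0 (Cp n) mZ)).
  rewrite /grad_ip !C1_weak_energy // leeD2r // [leRHS]EFinM lee_wpmul2l //.
  by rewrite lee_fin mulr_ge0 // sqr_ge0.
have k4 := ler_wpM2l (ltW gam0) k1.
have k5 := ler_wpM2l (ltW D3) k2.
have g0 := grad_ip_ge0 D (p n - v); have l0 := L2ip_ge0 (leb2 R) S (p n - v).
have k6 := mulr_ge0 (ltW D3) l0; have k7 := mulr_ge0 (ltW gam0) g0.
rewrite /e /h1_ip; move: k3 k4 k5 k6 k7.
move: (grad_ip D (p n - v) (p n - v)) (grad_ip D v v) (grad_ip D (p n) (p n)) => a1 a2 a3.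
move: (l2 v v) (l2 (p n) (p n)) (l2 (p n - v) (p n - v)) (lb (p n - t) (p n - t)) => b1 b2 b3 b4.
lra.
Qed.

Lemma wderivB_energy i u v : H1 D u -> H1 D v ->
  l2 (wp i u - wp i v) (wp i u - wp i v) = l2 (wp i (u - v)) (wp i (u - v)).
Proof.
move=> Hu Hv; have uv : H1 D (u - v) by exact: (siB H1S).
have E : {ae leb2 R, forall z, S z -> (wp i u - wp i v) z = wp i (u - v) z}.
  have := wderiv_lin_ae D0 i (-1) Hv Hu; rewrite scaleN1r addrC.
  by apply: filterS => z + Sz => -> //; rewrite scaleN1r addrC.
have w2 : L2S (wp i u - wp i v) by apply: (siB HS); exact: wderiv_L2.
by apply: eq_ae_L2ip => //; exact: wderiv_L2.
Qed.

(** The function and both weak derivatives converge in [L2], and the identity that defines a weak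
    derivative is continuous in [L2] for each test function. *)
Lemma H1_complete : semi_complete (H1 D) h1.
Proof.
move=> u K Hu uK; have mS := measurable_square D.
have u2 n : L2S (u n) by case: (Hu n).
have w2 n i : L2S (wp i (u n)) by exact: wderiv_L2.
have [||v v2 uv] := @L2_complete _ (leb2 R) _ mS u K.
- by [].
- by move=> m n mn; apply: le_trans (uK _ _ mn); rewrite lerDl grad_ip_ge0.
have wlim i : exists2 w, L2S w & l2 (wp i (u n) - w) (wp i (u n) - w) @[n --> \oo] --> 0.
  apply: (@L2_complete _ (leb2 R) _ mS (fun n => wp i (u n)) K) => // m n mn.
  rewrite wderivB_energy //; apply: le_trans (uK _ _ mn).
  rewrite /h1_ip /grad_ip; case: i; first by rewrite addrA lerDr addr_ge0 // L2ip_ge0.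
  by rewrite addrCA lerDl addr_ge0 // L2ip_ge0.
have /choice [w wP] : forall i, exists w, L2S w /\
    l2 (wp i (u n) - w) (wp i (u n) - w) @[n --> \oo] --> 0.
  by move=> i; have [w] := wlim i; exists w.
have wd i : is_weak_pderiv D i v (w i).
  have [wi2 wi] := wP i; apply/is_weak_pderivP; split => // phi tp.
  have [p2 dp2] := test_L2 D0 i tp.
  apply/eqP; rewrite -addr_eq0 -sqrf_eq0 eq_le sqr_ge0 andbT.
  (* The defect of the identity at the limit is, up to sign, the sum of the two pairings of
     [u n - v] and of [wp i (u n) - w i] with fixed functions. By Cauchy-Schwarz its square is at
     most [e n]. *)
  pose e n := 2 * l2 (pderiv i phi) (pderiv i phi) * l2 (u n - v) (u n - v) +
    2 * l2 phi phi * l2 (wp i (u n) - w i) (wp i (u n) - w i).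
  apply: (@cvg0_le _ _ _ e).
    rewrite -[X in _ --> X]addr0 -{1}(mulr0 (2 * l2 (pderiv i phi) (pderiv i phi))).
    rewrite -[X in _ + X](mulr0 (2 * l2 phi phi)).
    by apply: cvgD; apply: cvgMr.
  move=> n; rewrite addr0.
  have /is_weak_pderivP [_ /(_ _ tp) Hn] := wderivP i (Hu n).
  have d1 := siB HS (u2 n) v2; have d2 := siB HS (w2 n i) wi2.
  have c1 := si_CS HS d1 dp2; have c2 := si_CS HS d2 p2.
  rewrite (sibBl HS) // in c1; rewrite (sibBl HS) // in c2.
  rewrite Hn in c1; rewrite /e; move: c1 c2.
  move: (l2 (u n - v) (u n - v)) (l2 (wp i (u n) - w i) (wp i (u n) - w i)) => x1 x2.
  move: (l2 (pderiv i phi) (pderiv i phi)) (l2 phi phi) (l2 v (pderiv i phi)) => x3 x4 x5.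
  move: (l2 (wp i (u n)) phi) (l2 (w i) phi) => x6 x7 c1 c2.
  have := sqr_ge0 ((- x6 - x5) - (x6 - x7)); rewrite !expr2 in c1 c2 *; nra.
have Hv : H1 D v by split => // i; exists (w i).
exists v => //.
have wE i n : l2 (wp i (u n - v)) (wp i (u n - v)) = l2 (wp i (u n) - w i) (wp i (u n) - w i).
  rewrite -wderivB_energy //.
  have ae := wderiv_ae D0 Hv (wd i); have [wi2 _] := wP i.
  have d1 : L2S (wp i (u n) - wp i v) by apply: (siB HS) => //; exact: wderiv_L2.
  have d2 : L2S (wp i (u n) - w i) by exact: (siB HS).
  by apply: eq_ae_L2ip => //; move: ae; apply: filterS => z Hz Sz; rewrite !fctE Hz.
have -> : (fun n => h1 (u n - v) (u n - v)) = fun n => l2 (u n - v) (u n - v) +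
    (l2 (wp false (u n) - w false) (wp false (u n) - w false) +
     l2 (wp true (u n) - w true) (wp true (u n) - w true)).
  by apply/funext => n; rewrite /h1_ip /grad_ip !wE.
rewrite -[X in _ --> X]addr0 -[X in _ + X]addr0.
by apply: cvgD => //; apply: cvgD; [case: (wP false)|case: (wP true)].
Qed.

(** By the trace inequality the traces of a Cauchy sequence form a Cauchy sequence, with rate
    multiplied by [4 * trace_const D], and their limit is the trace of the limit. *)
Lemma V_complete : semi_complete VD h1.
Proof.
move=> u K Vu uK; have mB := measurable_bsquare D.
have Hu n : H1 D (u n) by case: (Vu n).
have [||v Hv uv] := @H1_complete u K => //.
have /choice [t tP] : forall n, exists t, is_trace D (u n) t /\
    {ae al, forall z, G1 z -> t z = 0}.
  by move=> n; have [_ [t Tt t0]] := Vu n; exists t.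
have t2 n : L2B (t n) by case: (tP n).1.
have KT := trace_const_gt0 D0.
have [||s s2 ts] := @L2_complete _ al _ mB t (4 * trace_const D * K).
- by [].
- move=> m n mn; have := trace_lin D0 (-1) (tP n).1 (tP m).1.
  rewrite !scaleN1r ![- _ + _]addrC => /(trace_bound D0); move/le_trans; apply.
  by rewrite -[leRHS]mulrA ler_wpM2l ?uK // mulr_ge0 // ltW.
exists v => //; split => //; exists s.
  by apply: (trace_closed D0 (u := u) (t := t)) => // n; case: (tP n).
(* On the measurable set where all traces [t n] vanish, their limit [s] is null; almost every point
   of [G1] lies in it, countably many exceptional sets being discarded. *)
pose Y := B `&` \bigcap_n (t n @^-1` [set 0]).
have mY : measurable Y.
  have -> : Y = \bigcap_n (B `&` t n @^-1` [set 0]).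
    apply/seteqP; split => z; first by move=> [Bz H] n _; split => //; exact: H.
    by move=> H; split => [|n _]; [case: (H 0%N I)|case: (H n I)].
  by apply: bigcapT_measurable => n; apply: (measurable_L2 mB (t2 n)).
have [Y2 Yle] := L2_le mY (@subIsetl _ _ _) s2.
have Ys : {ae al, forall z, (s \_ Y) z = 0}.
  apply: ip_eq0 => //; apply/eqP; rewrite eq_le; apply/andP; split; last first.
    exact: (si_ge0 (sqint_semi_inner al)).
  apply: (@cvg0_le _ _ _ (fun n => lb (t n - s) (t n - s))) => // n; rewrite addr0.
  have [d2 dle] := L2_le mY (@subIsetl _ _ _) (siB HB (t2 n) s2).
  apply: le_trans dle; rewrite -lee_fin (ip_sqrE Y2) (ip_sqrE d2).
  rewrite le_eqVlt; apply/orP; left; apply/eqP; apply: eq_integral => z _.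
  rewrite !patchE; case: ifPn => // /set_mem [_ /(_ n I) /= tz].
  by rewrite !fctE tz sub0r sqrrN.
have tN : {ae al, forall z n, G1 z -> t n z = 0}.
  by apply/ae_foralln => n; case: (tP n).
move: Ys tN; apply: filterS2 => z + tz Gz; rewrite patchE mem_set //.
by split; [exact: G1B|move=> n _ /=; exact: tz].
Qed.

End EssentialBoundary.

(** * The deterministic problem *)

Section Deterministic.
Context {R : realType}.
Variables (D : R) (D0 : 0 < D) (G1 G2 : set (plane R)).
Hypotheses (G1B : G1 `<=` bsquare D) (G1_gt0 : (0 < arclength D G1)%E).
Hypothesis (G2B : G2 `<=` bsquare D).
Implicit Types (u v w s t a f g : plane R -> R) (i : bool).
Local Notation S := (square D).
Local Notation B := (bsquare D).
Local Notation al := (arclength D).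
Local Notation L2S := (L2 (leb2 R) S).
Local Notation l2 := (L2ip (leb2 R) S).
Local Notation L2B := (L2 al B).
Local Notation HS := (L2_semi_inner (leb2 R) S).
Local Notation HB := (L2_semi_inner al B).
Local Notation HA := (sqint_semi_inner al).
Local Notation H1S := (h1_semi_inner D0).
Local Notation h1 := (h1_ip D).
Local Notation wp := (wderiv D).
Local Notation VD := (V D G1).
Local Notation HV := (V_semi_inner D0 G1).

Lemma V_H1 v : VD v -> H1 D v. Proof. by case. Qed.

Lemma V_traceP v : VD v -> is_trace D v (trace D v).
Proof.
move=> [_ [t Tt _]]; rewrite trace.unlock.
by apply: (@xgetPex _ _ [set t | is_trace D v t]); exists t.
Qed.

Lemma V_trace_L2 v : VD v -> L2B (trace D v).
Proof. by move=> /V_traceP []. Qed.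

(* [G2] need not be measurable: functions on it are extended by [0], here and
   in [data_norm]. *)
Definition load f g v : R := l2 f v + ip al (g \_ G2) (trace D v \_ B).

Section Load.
Variables (f g : plane R -> R) (f2 : L2S f) (g2 : L2 al G2 g).

Lemma loadE v t : is_trace D v t -> VD v ->
  \int[leb2 R]_(z in S) (f z * v z) + \int[al]_(z in G2) (g z * t z) = load f g v.
Proof.
move=> Tt Vv; rewrite integral_L2ip /load; congr (_ + _).
rewrite Rintegral_mkcond.
have -> : (fun z => g z * t z) \_ G2 = fun z => (g \_ G2) z * (t \_ B) z.
  apply/funext => z; rewrite !patchE; case: ifPn => [zG|_]; last by rewrite mul0r.
  by rewrite mem_set //; apply: G2B; exact: set_mem.
have Tv := V_traceP Vv.
apply: eq_ae_ip => //; [by case: Tt|by case: Tv|exact: aeW|].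
have := trace_uniq D0 Tt Tv; apply: filterS => z Hz; rewrite !patchE.
by case: ifPn => // /set_mem /Hz.
Qed.

Lemma load_lin c u v : VD u -> VD v -> load f g (c *: u + v) = c * load f g u + load f g v.
Proof.
move=> Vu Vv; have Vw := V_lin D0 c Vu Vv.
have [Hu [Hv Hw]] := (V_H1 Vu, (V_H1 Vv, V_H1 Vw)).
have [[u2 _] [[v2 _] _]] := (Hu, (Hv, Hw)).
have [Tu [Tv Tw]] := (V_traceP Vu, (V_traceP Vv, V_traceP Vw)).
have [tu [tv tw]] := (V_trace_L2 Vu, (V_trace_L2 Vv, V_trace_L2 Vw)).
rewrite /load (si_sym HS) //; last exact: (si_lin HS).
rewrite (si_linl HS) // (si_sym HS u2 f2) (si_sym HS v2 f2).
have -> : ip al (g \_ G2) (trace D (c *: u + v) \_ B) =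
    ip al (g \_ G2) ((c *: trace D u + trace D v) \_ B).
  apply: eq_ae_ip => //; [exact: (si_lin HB)|exact: aeW|].
  have := trace_uniq D0 Tw (trace_lin D0 c Tu Tv).
  by apply: filterS => z Hz; rewrite !patchE; case: ifPn => // /set_mem /Hz.
rewrite patchD patchZ (si_sym HA) //; last exact: (si_lin HA).
rewrite (si_linl HA) // (si_sym HA tu g2) (si_sym HA tv g2).
by move: (l2 f u) (l2 f v) => x y; ring.
Qed.

(** The 1 serves the volume term, the square root of the constant of [trace_bound] the boundary
    term. *)
Definition load_const : R := 1 + Num.sqrt (4 * trace_const D).

Lemma load_const_gt0 : 0 < load_const.
Proof. by rewrite ltr_wpDr // sqrtr_ge0. Qed.

Definition data_norm f g : R :=
  Num.sqrt (l2 f f) + Num.sqrt (ip al (g \_ G2) (g \_ G2)).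

Lemma load_bound v : VD v ->
  `|load f g v| <= load_const * data_norm f g * Num.sqrt (h1 v v).
Proof.
move=> Vv; have Hv := V_H1 Vv; have [v2 _] := Hv.
have tv := V_trace_L2 Vv; have KT := trace_const_gt0 D0.
have K4 : 0 <= 4 * trace_const D by rewrite mulr_ge0 // ltW.
have b1 : `|l2 f v| <= Num.sqrt (l2 f f) * Num.sqrt (h1 v v).
  rewrite -sqrtrM ?L2ip_ge0 // -sqrtr_sqr ler_wsqrtr //.
  apply: le_trans (si_CS HS f2 v2) _; rewrite ler_wpM2l ?L2ip_ge0 //.
  by rewrite lerDl grad_ip_ge0.
have b2 : `|ip al (g \_ G2) (trace D v \_ B)| <= Num.sqrt (ip al (g \_ G2) (g \_ G2)) *
    (Num.sqrt (4 * trace_const D) * Num.sqrt (h1 v v)).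
  have g0 : 0 <= ip al (g \_ G2) (g \_ G2) by exact: (si_ge0 HA).
  rewrite -sqrtrM // -sqrtrM // -sqrtr_sqr ler_wsqrtr //.
  apply: le_trans (si_CS HA g2 tv) _; rewrite ler_wpM2l //.
  by rewrite -L2ipE; exact: trace_bound (V_traceP Vv).
apply: (le_trans (ler_normD _ _)); apply: (le_trans (lerD b1 b2)).
rewrite /load_const /data_norm.
move: (sqrtr_ge0 (l2 f f)) (sqrtr_ge0 (h1 v v)) (sqrtr_ge0 (4 * trace_const D)).
move: (sqrtr_ge0 (ip al (g \_ G2) (g \_ G2))).
move: (Num.sqrt (l2 f f)) (Num.sqrt (ip al (g \_ G2) (g \_ G2))) (Num.sqrt (h1 v v)).
move: (Num.sqrt (4 * trace_const D)) => k F G N G0 F0 N0 k0.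
rewrite mulrA -mulrDl ler_wpM2r //.
have := mulr_ge0 k0 F0; lra.
Qed.

End Load.

Definition energy_form a u v : R :=
  l2 (a * wp false u) (wp false v) + l2 (a * wp true u) (wp true v).

Section Coefficient.
Variables (a : plane R -> R) (am M : R).
Hypotheses (ma : measurable_fun S a) (am0 : 0 < am).
Hypothesis (aM : forall z, S z -> am <= a z <= M).

Lemma coef_bound_gt0 : 0 < M.
Proof.
have /aM /andP[h h'] := square_center D0.
by rewrite (lt_le_trans am0) // (le_trans h h').
Qed.

Lemma coef_L2 v : L2S v -> L2S (a * v).
Proof.
move=> v2; rewrite /L2 /=.
have -> : (a * v) \_ S = fun z => (a \_ S) z * (v \_ S) z.
  by apply/funext => z; rewrite !patchE; case: ifP => //; rewrite mulr0.
apply: (@sqint_bounded _ _ _ _ M) => // [|z].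
  by apply/(measurable_restrictT _ (measurable_square D)).
rewrite patchE; case: ifPn => [/set_mem /aM /andP[h1 h2]|_].
  by rewrite ger0_norm // (le_trans _ h1) // ltW.
by rewrite normr0 ltW // coef_bound_gt0.
Qed.

Lemma coef_ip_sym v w : l2 (a * v) w = l2 (a * w) v.
Proof.
rewrite -!integral_L2ip; apply: eq_Rintegral => z _.
by rewrite !fctE mulrAC.
Qed.

Lemma coef_ip_bound v : L2S v -> am * l2 v v <= l2 (a * v) v <= M * l2 v v.
Proof.
move=> v2; have mS := measurable_square D; have av2 := coef_L2 v2.
have int w : L2S w -> (leb2 R).-integrable S (EFin \o (fun z => w z * v z)).
  move=> w2; apply/(integrable_mkcond _ mS).
  have := sqint_integrable w2 v2.
  rewrite (_ : (EFin \o _) \_ S = EFin \o (fun z => (w \_ S) z * (v \_ S) z)) //.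
  by apply/funext => z /=; rewrite !patchE; case: ifP => //=; rewrite mulr0.
have intv := int _ v2; have intav := int _ av2.
have iz (k : R) : (leb2 R).-integrable S (EFin \o (fun z => k * (v z * v z))).
  exact: (integrableZl mS k intv).
rewrite -!integral_L2ip -!RintegralZl //; apply/andP; split; apply: le_Rintegral => //.
- move=> z Sz; rewrite !fctE -mulrA ler_wpM2r ?sqr_ge0 -?expr2 ?sqr_ge0 //.
  by have /andP[] := aM Sz.
- move=> z Sz; rewrite !fctE -mulrA ler_wpM2r ?sqr_ge0 -?expr2 ?sqr_ge0 //.
  by have /andP[] := aM Sz.
Qed.

Lemma energy_formE u v : H1 D u -> H1 D v ->
  \int[leb2 R]_(z in S) (a z * (weak_pderiv D false u z * weak_pderiv D false v z
              + weak_pderiv D true u z * weak_pderiv D true v z)) = energy_form a u v.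
Proof.
move=> Hu Hv; rewrite -!wderivE /energy_form -!integral_L2ip.
have mS := measurable_square D.
have int i : (leb2 R).-integrable S (EFin \o (fun z => (a * wp i u) z * wp i v z)).
  apply/(integrable_mkcond _ mS).
  have := sqint_integrable (coef_L2 (wderiv_L2 i Hu)) (wderiv_L2 i Hv).
  rewrite (_ : (EFin \o _) \_ S = EFin \o (fun z => ((a * wp i u) \_ S) z * (wp i v \_ S) z)) //.
  by apply/funext => z /=; rewrite !patchE; case: ifP => //=; rewrite mulr0.
rewrite -RintegralD //; apply: eq_Rintegral => z _.
by rewrite !fctE mulrDr !mulrA.
Qed.

Lemma energy_form_semi_inner : semi_inner (H1 D) (energy_form a).
Proof.
split.
- exact: H1_0.
- exact: (si_lin H1S).
- by move=> u v Hu Hv; rewrite /energy_form coef_ip_sym [in X in _ + X]coef_ip_sym.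
- move=> c u v w Hu Hv Hw; rewrite /energy_form.
  have E i : l2 (a * wp i (c *: u + v)) (wp i w) =
      c * l2 (a * wp i u) (wp i w) + l2 (a * wp i v) (wp i w).
    have aw := coef_L2 (wderiv_L2 i Hw).
    have sym x : H1 D x -> l2 (a * wp i x) (wp i w) = l2 (wp i x) (a * wp i w).
      by move=> Hx; rewrite coef_ip_sym (si_sym HS aw (wderiv_L2 i Hx)).
    by rewrite !sym ?(wderiv_linl D0) //; exact: (si_lin H1S).
  by rewrite !E mulrDr addrACA.
- move=> u Hu; apply: addr_ge0.
    have /andP[h _] := coef_ip_bound (wderiv_L2 false Hu).
    by apply: le_trans h; rewrite mulr_ge0 ?L2ip_ge0 // ltW.
  have /andP[h _] := coef_ip_bound (wderiv_L2 true Hu).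
  by apply: le_trans h; rewrite mulr_ge0 ?L2ip_ge0 // ltW.
Qed.

Lemma energy_form_bound u : H1 D u ->
  am * grad_ip D u u <= energy_form a u u <= M * grad_ip D u u.
Proof.
move=> Hu; have /andP[h1' h2] := coef_ip_bound (wderiv_L2 false Hu).
have /andP[h3 h4] := coef_ip_bound (wderiv_L2 true Hu).
by rewrite /energy_form /grad_ip !mulrDr !lerD.
Qed.

Lemma energy_form_le_h1 u : H1 D u -> energy_form a u u <= M * h1 u u.
Proof.
move=> Hu; have /andP[_ h] := energy_form_bound Hu; apply: (le_trans h).
by rewrite ler_wpM2l ?(ltW coef_bound_gt0) // lerDr L2ip_ge0.
Qed.

Lemma V_energy_semi_inner : semi_inner VD (energy_form a).
Proof.
have HE := energy_form_semi_inner; split.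
- exact: V_0.
- exact: V_lin.
- by move=> u v /V_H1 Hu /V_H1 Hv; exact: (si_sym HE).
- by move=> c u v w /V_H1 Hu /V_H1 Hv /V_H1 Hw; exact: (si_linl HE).
- by move=> u /V_H1 Hu; exact: (si_ge0 HE).
Qed.

(** The problem as an equation between the energy form and the load functional. The quantification
    over all traces of a test function reduces to the chosen one, since traces agree almost
    everywhere on the boundary. *)
Lemma weak_solutionP f g u : L2S f -> L2 al G2 g ->
  weak_solution D G1 G2 a f g u <->
  VD u /\ forall v, VD v -> energy_form a u v = load f g v.
Proof.
move=> f2 g2; split=> -[Vu H]; (split; first exact: Vu).
  move=> v Vv; have Tv := V_traceP Vv.
  by rewrite -(loadE f g2 Tv Vv) -(H _ _ Vv Tv) (energy_formE (V_H1 Vu) (V_H1 Vv)).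
by move=> v t Vv Tt; rewrite (loadE f g2 Tt Vv) (energy_formE (V_H1 Vu) (V_H1 Vv)) H.
Qed.

Variable K : R.
Hypotheses (K0 : 0 < K) (PK : forall v, VD v -> h1 v v <= K * grad_ip D v v).

Lemma h1_le_energy v : VD v -> h1 v v <= K / am * energy_form a v v.
Proof.
move=> Vv; apply: (le_trans (PK Vv)); rewrite -mulrA ler_wpM2l ?(ltW K0) //.
by rewrite ler_pdivlMl //; have /andP[] := energy_form_bound (V_H1 Vv).
Qed.

(** On [V] the energy form is equivalent to [h1]. The upper bound [M] is used for the convergence of
    the limit in energy and leaves no mark on the constants of the estimates. *)
Lemma V_energy_complete : semi_complete VD (energy_form a).
Proof.
move=> u K' Vu uK.
have [||v Vv uv] := @V_complete _ _ D0 _ G1B u (K / am * K').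
- by [].
- move=> m n mn; apply: (le_trans (h1_le_energy (siB HV (Vu m) (Vu n)))).
  by rewrite -[leRHS]mulrA ler_wpM2l ?uK // divr_ge0 // ltW.
exists v => //.
apply: (@squeeze_cvgr _ _ _ _ (fun=> 0) (fun n => M * h1 (u n - v) (u n - v))).
- near=> n; have Vuv := siB HV (Vu n) Vv.
  rewrite (si_ge0 V_energy_semi_inner Vuv) /=; apply: energy_form_le_h1.
  exact: V_H1.
- exact: cvg_cst.
- by rewrite -[X in _ --> X](mulr0 M); exact: cvgMr.
Unshelve. all: by end_near.
Qed.

Lemma weak_solution_exists f g : L2S f -> L2 al G2 g ->
  exists u, weak_solution D G1 G2 a f g u.
Proof.
move=> f2 g2.
(* Square of the constant in [load_bound], with [h1] replaced by the energy at the cost of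
   [K / am]. *)
pose C := (load_const * data_norm f g) ^+ 2 * (K / am).
have [||u Vu Hu] := @semi_riesz _ _ VD (energy_form a) (load f g) C
  V_energy_semi_inner V_energy_complete.
- by move=> c u v Vu Vv; exact: load_lin.
- move=> v Vv; have := load_bound f2 g2 Vv => h.
  have h0 := h1_ip_ge0 D v.
  rewrite -real_normK ?num_real //.
  apply: (@le_trans _ _ ((load_const * data_norm f g * Num.sqrt (h1 v v)) ^+ 2)).
    by rewrite lerXn2r ?nnegrE // (le_trans _ h).
  rewrite exprMn sqr_sqrtr // /C -mulrA ler_wpM2l ?sqr_ge0 //.
  exact: h1_le_energy.
by exists u; apply/weak_solutionP.
Qed.

Lemma weak_solution_uniq f g u u' : L2S f -> L2 al G2 g ->
  weak_solution D G1 G2 a f g u -> weak_solution D G1 G2 a f g u' ->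
  {ae leb2 R, forall z, S z -> u z = u' z}.
Proof.
move=> f2 g2 /(weak_solutionP _ f2 g2) [Vu Hu] /(weak_solutionP _ f2 g2) [Vu' Hu'].
have Vw := siB HV Vu Vu'; have HE := V_energy_semi_inner.
have e0 : energy_form a (u - u') (u - u') = 0.
  by rewrite (sibBl HE) // Hu // Hu' // subrr.
have h0 : h1 (u - u') (u - u') = 0.
  apply/eqP; rewrite eq_le h1_ip_ge0 andbT.
  by have := h1_le_energy Vw; rewrite e0 mulr0.
have := h1_eq0_ae (V_H1 Vw) h0; apply: filterS => z Hz Sz.
by apply/eqP; rewrite -subr_eq0; apply/eqP; exact: Hz.
Qed.

(** Test the equation with [u] itself: the squared norm is at most [K / am] times the load at [u],
    which is linear in the norm, and one factor cancels. *)
Lemma weak_solution_bound f g u : L2S f -> L2 al G2 g ->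
  weak_solution D G1 G2 a f g u ->
  Num.sqrt (h1 u u) <= K / am * load_const * data_norm f g.
Proof.
move=> f2 g2 /(weak_solutionP _ f2 g2) [Vu Hu].
have h0 := h1_ip_ge0 D u.
have [s0|s0] := eqVneq (Num.sqrt (h1 u u)) 0.
  rewrite s0; apply: mulr_ge0; last by rewrite addr_ge0 // sqrtr_ge0.
  apply: mulr_ge0; first by apply: divr_ge0; exact: ltW.
  exact: ltW load_const_gt0.
have sp : 0 < Num.sqrt (h1 u u) by rewrite lt_def s0 sqrtr_ge0.
rewrite -(ler_pM2r sp) -expr2 sqr_sqrtr //.
apply: (le_trans (h1_le_energy Vu)); rewrite Hu // -!mulrA (ler_wpM2l (ltW K0)) //.
rewrite ler_wpM2l ?invr_ge0 ?(ltW am0) // !mulrA.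
by apply: le_trans (ler_norm _) _; exact: load_bound.
Qed.

End Coefficient.
End Deterministic.

(** * Separability and strong measurability *)

Section Separability.
Context {R : realType}.
Variables (D : R) (D0 : 0 < D) (G1 : set (plane R)).
Hypotheses (G1B : G1 `<=` bsquare D).
Local Notation S := (square D).
Local Notation L2S := (L2 (leb2 R) S).
Local Notation l2 := (L2ip (leb2 R) S).
Local Notation HS := (L2_semi_inner (leb2 R) S).
Local Notation h1 := (h1_ip D).
Local Notation VD := (V D G1).
Local Notation HV := (V_semi_inner D0 G1).

Let corner (q : rat * rat) : set (plane R) := `]ratr q.1, +oo[ `*` `]ratr q.2, +oo[.

Let mcorner q : measurable (corner q).
Proof. by apply: measurableX. Qed.

Let corner_L2 q : L2S (\1_(corner q)).
Proof.
rewrite /L2 /=; have -> : (\1_(corner q) : plane R -> R) \_ S = fun z => \1_(corner q) z * \1_S z.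
  by apply/funext => z; rewrite patchE [\1_S z]indicE; case: ifP; rewrite ?mulr1 ?mulr0.
apply: (@sqint_bounded _ _ _ _ 1) => [||z].
- exact: measurable_indic.
- exact: sqint_indic_square.
- by rewrite indicE; case: (_ \in _); rewrite ?normr1 ?normr0.
Qed.

Lemma corner_total (x : plane R -> R) : L2S x ->
  (forall q, l2 x (\1_(corner q)) = 0) -> {ae leb2 R, forall z, S z -> x z = 0}.
Proof.
move=> x2 H; set W := x \_ S.
have intW : (leb2 R).-integrable setT (EFin \o W).
  have -> : W = fun z => W z * \1_S z.
    by apply/funext => z; rewrite /W patchE indicE; case: ifP; rewrite ?mulr1 ?mulr0.
  exact: sqint_integrable x2 (sqint_indic_square D0).
have key E q : measurable E -> S `&` E = S `&` corner q ->
    (\int[leb2 R]_(z in E) (W z)%:E = 0)%E.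
  move=> mE SE; rewrite -[RHS]/(0%:E) -(H q) L2ipE /ip /Rintegral fineK; last first.
    by apply: integrable_fin_num => //; apply: sqint_integrable => //; exact: corner_L2.
  rewrite [LHS]integral_mkcond; apply: eq_integral => z _; rewrite /W !patchE.
  have [Sz|Sz] := pselect (S z); last first.
    by rewrite [z \in S]memNset //= mul0r; case: ifP.
  rewrite [z \in S]mem_set // indicE.
  have <- : (z \in E) = (z \in corner q).
    by rewrite -[z \in E]andTb -[z \in corner q]andTb -(mem_set Sz) -!in_setI SE.
  by case: ifP; rewrite ?mulr1 ?mulr0.
(* A corner at coordinate -1 puts no constraint on points of the square, so half-planes and the
   whole plane are covered by corners too. *)
have m1 (t : R) : 0 < t -> ratr (-1) < t.
  by move=> t0; rewrite rmorphN1 (lt_trans _ t0) // oppr_lt0.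
have := plane_integral0_ae intW; case.
- apply: (key setT (-1, -1)) => //; apply/seteqP; split => z /= [Sz _]; split => //.
  by have [/andP[h1 _] /andP[h2 _]] := Sz; split; rewrite /= in_itv /= andbT m1.
- by move=> a c; apply: (key _ (a, c)) => //; exact: measurableX.
- move=> a; apply: (key _ (a, -1)) => //; first exact: measurableX.
  apply/seteqP; split => z /= [Sz [h _]]; split => //; split => //=.
  by have [_ /andP[h2 _]] := Sz; rewrite in_itv /= andbT m1.
- move=> c; apply: (key _ (-1, c)) => //; first exact: measurableX.
  apply/seteqP; split => z /= [Sz [h h']]; split => //; split => //=.
  by have [/andP[h2 _] _] := Sz; rewrite in_itv /= andbT m1.
move=> N [mN N0 NW]; exists N; split => // z /= nz; apply: NW => /= h; apply: nz => Sz.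
by have := h I; rewrite /W patchE mem_set // => -[].
Qed.

(** The total sequence consists of the Riesz representatives in [V] of the integrals over rational
    corners. A vector of [V] orthogonal to all of them has vanishing integral on every corner, hence
    is null; no density of smooth functions in [V] enters. *)
Lemma V_dense : exists e : nat -> plane R -> R, (forall k, VD (e k)) /\
  forall x (eps : R), VD x -> 0 < eps -> exists k, h1 (x - e k) (x - e k) < eps.
Proof.
have cplt := V_complete D0 G1B.
have /choice [r rP] : forall q, exists r, VD r /\ forall v, VD v -> h1 r v = l2 v (\1_(corner q)).
  move=> q; have c2 := corner_L2 q.
  have [||r Vr Hr] := @semi_riesz _ _ VD h1 (fun v => l2 v (\1_(corner q)))
    (l2 (\1_(corner q)) (\1_(corner q))) HV cplt; last by exists r.
  - by move=> c x y [[x2 _] _] [[y2 _] _]; exact: (si_linl HS).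
  - move=> x [[x2 _] _]; apply: le_trans (si_CS HS x2 c2) _.
    by rewrite mulrC ler_wpM2l ?L2ip_ge0 // lerDl grad_ip_ge0.
pose Sq k := if unpickle k is Some q then r q else r (0, 0).
have VS k : VD (Sq k).
  by rewrite /Sq; case: unpickle => [q|]; [case: (rP q)|case: (rP (0, 0))].
apply: (semi_dense HV cplt VS) => x Vx xS.
have [Hx _] := Vx; have [x2 _] := Hx; apply: (ae_eq0_h1 D0 Hx).
apply: (corner_total x2) => q; have [Vr Hr] := rP q; rewrite -Hr // (si_sym HV) //.
by have := xS (pickle q); rewrite /Sq pickleK.
Qed.

End Separability.

(** * Strong measurability: from maps to scalars, and by measurable selection *)

Section BochnerMeasurability.
Context d (Omega : measurableType d) (R : realType) (P : probability Omega R).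

(** Completeness of [P] makes any set of outcomes inside the exceptional null set measurable,
    whatever [f] does there. *)
Lemma ae_cvg_measurable (F : nat -> Omega -> R) (f : Omega -> R) :
  measure_is_complete P -> (forall n, measurable_fun setT (F n)) ->
  {ae P, forall w, F n w @[n --> \oo] --> f w} -> measurable_fun setT f.
Proof.
move=> cP mF [N [mN N0 NF]].
pose g w := f w * \1_(~` N) w.
have mg : measurable_fun setT g.
  apply: (@measurable_fun_cvg _ _ _ _ (fun n w => F n w * \1_(~` N) w)) => [n|w _].
    by apply: measurable_funM => //; apply: measurable_indic; exact: measurableC.
  rewrite /g indicE; have [Nw|Nw] := pselect (N w).
    by rewrite memNset // mulr0; under eq_fun do rewrite mulr0; exact: cvg_cst.
  rewrite mem_set // mulr1; under eq_fun do rewrite mulr1.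
  by apply: contrapT => nF; apply: Nw; exact: NF.
move=> _ Y mY; rewrite setTI.
have -> : f @^-1` Y = (g @^-1` Y `&` ~` N) `|` (f @^-1` Y `&` N).
  apply/seteqP; split => w /=.
    move=> Yf; have [Nw|Nw] := pselect (N w); first by right.
    by left; split => //; rewrite /g indicE mem_set // mulr1.
  by move=> [[]|[]//]; rewrite /g indicE => + Nw; rewrite mem_set // mulr1.
apply: measurableU; last by apply: cP; exists N; split => // w [].
apply: measurableI; last exact: measurableC.
by rewrite -[_ @^-1` _]setTI; exact: mg.
Qed.

Variables (E : zmodType) (B : set E) (Nm : E -> \bar R).

(** Extracts scalar measurability from strong measurability: [L] of a simple map takes finitely many
    values on measurable sets, and the Lipschitz bound carries the almost sure convergence over to
    the scalars. *)
Lemma strongly_measurable_lipschitz (L : E -> R) (C : R) (Z : Omega -> E) :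
    measure_is_complete P -> (forall w, B (Z w)) ->
    (forall x y, B x -> B y -> (`|L x - L y|%:E <= C%:E * Nm (x - y))%E) ->
    strongly_measurable P B Nm Z ->
  measurable_fun setT (fun w => L (Z w)).
Proof.
move=> cP BZ Lip [s [ss sZ]].
apply: (@ae_cvg_measurable (fun n w => L (s n w))) => //.
  move=> n _ Y mY; rewrite setTI; have [fs ms _] := ss n.
  have -> : (fun w => L (s n w)) @^-1` Y =
      \bigcup_(y in range (s n) `&` [set y | Y (L y)]) (s n @^-1` [set y]).
    apply/seteqP; split => w /=; first by move=> Yw; exists (s n w).
    by move=> [y [_ Yy] /= ->].
  apply: fin_bigcup_measurable => //.
  by apply: sub_finite_set fs => y [].
move: sZ; apply: filterS => w sw.
have C0 : (C%:E * Nm (s n w - Z w) @[n --> \oo] --> 0)%E.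
  by rewrite -[X in _ --> X](mule0 C%:E); apply: cvgeZl.
apply/cvgrPdist_le => eps eps0.
have /fine_cvgP [fin0 /cvgrPdist_le/(_ _ eps0) le0] := C0.
near=> n; have [_ _ Bs] := ss n.
have f0 : (C%:E * Nm (s n w - Z w))%E \is a fin_num by near: n.
have : `|0 - fine (C%:E * Nm (s n w - Z w))%E| <= eps by near: n.
rewrite sub0r normrN distrC => h; apply: le_trans h; rewrite -lee_fin.
apply: (le_trans (Lip _ _ (Bs w) (BZ w))).
by rewrite -[leLHS]fineK // lee_fin ler_norm.
Unshelve. all: by end_near.
Qed.

(* A measurable choice of an approximation among finitely many candidates: the
   maps [e (argmin_upto m n w)] are the simple maps that converge to the limit. *)
Fixpoint argmin_upto (m : nat -> Omega -> R) n w : nat :=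
  if n is n'.+1 then
    if m n w < m (argmin_upto m n' w) w then n else argmin_upto m n' w
  else 0%N.

Lemma argmin_upto_le m n w : (argmin_upto m n w <= n)%N.
Proof. by elim: n => //= n IH; case: ifP => // _; exact: leqW. Qed.

Lemma argmin_upto_min m n k w : (k <= n)%N -> m (argmin_upto m n w) w <= m k w.
Proof.
elim: n => [|n IH]; first by rewrite leqn0 => /eqP ->.
rewrite leq_eqVlt => /predU1P[->|/IH le_k] /=; case: ifP => // h.
- by rewrite leNgt h.
- by rewrite (le_trans (ltW h)).
Qed.

(** [m k w] stands for a distance from [e k] to [Z w], not necessarily [Nm]: it has to be
    measurable, to have infimum 0 and to control [Nm] along any selection. The minimum over indices
    up to n then tends to 0, and its argument depends measurably on the outcome. *)
Lemma strongly_measurable_argmin (e : nat -> E) (m : nat -> Omega -> R) (Z : Omega -> E) :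
    (forall k, B (e k)) -> (forall k, measurable_fun setT (m k)) ->
    {ae P, forall w, (forall k, 0 <= m k w) /\
      (forall eps, 0 < eps -> exists k, m k w < eps) /\
      (forall kap : nat -> nat, m (kap n) w @[n --> \oo] --> 0 ->
        Nm (e (kap n) - Z w) @[n --> \oo] --> 0%E)} ->
  strongly_measurable P B Nm Z.
Proof.
move=> Be mm ae; exists (fun n w => e (argmin_upto m n w)).
have mval n : measurable_fun setT (fun w => m (argmin_upto m n w) w) /\
    forall j, measurable [set w | argmin_upto m n w = j].
  elim: n => [|n [IHm IHj]].
    split=> [|j]; first exact: mm.
    have [->|j0] := eqVneq j 0%N.
      by rewrite (_ : [set _ | _] = setT) //; apply/seteqP; split.
    rewrite (_ : [set _ | _] = set0) //; apply/seteqP; split => // w /= h.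
    by move: j0; rewrite -h eqxx.
  have mlt : measurable [set w | m n.+1 w < m (argmin_upto m n w) w].
    have := measurable_fun_ltr (mm n.+1) IHm measurableT (Y := [set true]).
    by rewrite setTI; apply.
  split=> [|j] /=.
    rewrite (_ : (fun w => _) = fun w => Order.min (m (argmin_upto m n w) w) (m n.+1 w)).
      exact: measurable_minr.
    by apply/funext => w; rewrite /Order.min; case: (ltgtP (m n.+1 w) (m (argmin_upto m n w) w)).
  rewrite (_ : [set w | _] =
      ([set w | m n.+1 w < m (argmin_upto m n w) w] `&` [set w | n.+1 = j]) `|`
      (~` [set w | m n.+1 w < m (argmin_upto m n w) w] `&` [set w | argmin_upto m n w = j])).
    apply: measurableU; apply: measurableI => //; last exact: measurableC.
    have [h|h] := pselect (n.+1 = j).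
      by rewrite (_ : [set _ | _] = setT) //; apply/seteqP; split.
    by rewrite (_ : [set _ | _] = set0) //; apply/seteqP; split.
  apply/seteqP; split => w /=.
    by case: ifP => h hj; [left|right; split => //; rewrite h].
  by case: ifP => h [[h1 h2]|[h1 h2]] //; exfalso; move: h1; rewrite h.
split=> [n|].
  split=> [|y|w]; last exact: Be.
    apply: (@sub_finite_set _ _ (e @` `I_n.+1)); last exact/finite_image/finite_II.
    by move=> _ [w _ <-]; exists (argmin_upto m n w) => //=; exact: argmin_upto_le.
  have -> : (fun w => e (argmin_upto m n w)) @^-1` [set y] =
      \bigcup_(j in [set j | e j = y]) [set w | argmin_upto m n w = j].
    apply/seteqP; split => w /=; first by move=> ey; exists (argmin_upto m n w).
    by move=> [j /= ey aj]; rewrite aj.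
  by apply: bigcup_measurable => j _; exact: (mval n).2.
move: ae; apply: filterS => w [m0 [minf mcv]]; apply: mcv.
apply/cvgrPdist_le => eps /minf [k mk].
exists k => // n /= kn; rewrite sub0r normrN ger0_norm ?m0 //.
by apply: le_trans (ltW mk); exact: argmin_upto_min.
Qed.

End BochnerMeasurability.

(** * Joint measurability of the random coefficient *)

Section JointMeasurability.
Context d (Omega : measurableType d) (R : realType).
Local Notation mu := (@lebesgue_measure R).

(** Right-continuity is used in one coordinate at a time: first with parameter space [Omega], then
    with [Omega * R]. *)
Lemma measurable_fun_caratheodory (h : Omega -> plane R -> R) :
    (forall z, measurable_fun setT (h ^~ z)) -> (forall w, continuous (h w)) ->
  measurable_fun setT (fun p : Omega * plane R => h p.1 p.2).
Proof.
move=> mh ch.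
have cx w y : continuous (fun x => h w (x, y)).
  move=> x; apply: (@cvg_comp _ _ _ (fun x => pt false x y) (h w) _ (nbhs (x, y))).
    exact: (@continuous_pt _ false y x).
  exact: ch.
have cy w x : continuous (fun y => h w (x, y)).
  move=> y; apply: (@cvg_comp _ _ _ (fun y => pt true y x) (h w) _ (nbhs (x, y))).
    exact: (@continuous_pt _ true x y).
  exact: ch.
have m1 y : measurable_fun setT (fun p : Omega * R => h p.1 (p.2, y)).
  rewrite -setXTT; apply: (measurable_fun_right_continuous (h := fun p => h p.1 (p.2, y))) => //=.
  by move=> w x _; apply: cvg_at_right_filter; exact: cx.
have m2 : measurable_fun setT (fun p : (Omega * R) * R => h p.1.1 (p.1.2, p.2)).
  rewrite -setXTT; apply: (measurable_fun_right_continuous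
    (h := fun p : (Omega * R) * R => h p.1.1 (p.1.2, p.2))) => //=.
  by move=> [w x] y _; apply: cvg_at_right_filter; exact: cy.
have -> : (fun p : Omega * plane R => h p.1 p.2) =
    (fun p : (Omega * R) * R => h p.1.1 (p.1.2, p.2)) \o
    (fun p : Omega * plane R => ((p.1, p.2.1), p.2.2)).
  by apply/funext => -[w [x y]].
apply: measurableT_comp m2 _; apply: measurable_fun_pair.
  apply: measurable_fun_pair; first exact: measurable_fst.
  by apply: (measurableT_comp measurable_fst); exact: measurable_snd.
by apply: (measurableT_comp measurable_snd); exact: measurable_snd.
Qed.

Lemma ge0_measurable_integral_leb2 (f : Omega * plane R -> \bar R) :
    measurable_fun setT f -> (forall p, (0 <= f p)%E) ->
  measurable_fun setT (fun w => \int[leb2 R]_z f (w, z))%E.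
Proof.
move=> mf f0.
have m0 : measurable_fun setT (fun p : (Omega * R) * R => f (p.1.1, (p.1.2, p.2))).
  apply: measurableT_comp mf _; apply: measurable_fun_pair.
    by apply: (measurableT_comp measurable_fst); exact: measurable_fst.
  apply: measurable_fun_pair; last exact: measurable_snd.
  by apply: (measurableT_comp measurable_snd); exact: measurable_fst.
have m1 := @measurable_fun_fubini_tonelli_F _ _ (Omega * R)%type (measurableTypeR R) _ mu _ m0
  (fun p => f0 _).
have f1 p : (0 <= fubini_F mu (fun p : (Omega * R) * R => f (p.1.1, (p.1.2, p.2))) p)%E.
  exact: integral_ge0.
have m2 := @measurable_fun_fubini_tonelli_F _ _ Omega (measurableTypeR R) _ mu _ m1 f1.
have -> : (fun w => \int[leb2 R]_z f (w, z))%E =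
    fubini_F mu (fubini_F mu (fun p : (Omega * R) * R => f (p.1.1, (p.1.2, p.2)))).
  apply/funext => w.
  have mfw : measurable_fun setT (fun z => f (w, z)).
    by apply: measurableT_comp mf _; apply: measurable_fun_pair.
  by have [-> _] := ge0_integral_leb2 mfw (fun z => f0 _).
exact: m2.
Qed.

Lemma measurable_integral_leb2 (f : Omega * plane R -> \bar R) :
  measurable_fun setT f -> measurable_fun setT (fun w => \int[leb2 R]_z f (w, z))%E.
Proof.
move=> mf.
have -> : (fun w => \int[leb2 R]_z f (w, z))%E =
    (fun w => (\int[leb2 R]_z (f^\+ (w, z))) - (\int[leb2 R]_z (f^\- (w, z))))%E.
  apply/funext => w; rewrite (integralE _ _ (fun z => f (w, z))); congr (_ - _)%E.
  - by apply: eq_integral => z _; rewrite !funeposE.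
  - by apply: eq_integral => z _; rewrite !funenegE.
apply: emeasurable_funB; [apply: (@ge0_measurable_integral_leb2 f^\+%E)|
  apply: (@ge0_measurable_integral_leb2 f^\-%E)] => //.
- exact: measurable_funepos.
- exact: measurable_funeneg.
Qed.

End JointMeasurability.

Lemma within_continuous_comp (R : realType) (U V : topologicalType) (A : set V)
    (f : V -> R) (g : U -> V) :
  {within A, continuous f} -> continuous g -> (forall x, A (g x)) ->
  continuous (fun x => f (g x)).
Proof.
move=> /subspace_continuousP cf cg Ag x.
apply: (@cvg_comp _ _ _ g f _ (within A (nbhs (g x)))); last exact: cf.
move=> Y /= /cg HY.
have H0 : nbhs x [set y | A (g y) -> Y (g y)] := HY.
by apply: filterS H0 => y; apply.
Qed.

Section Clip.
Context {R : realType}.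
Implicit Types (D x : R) (z : plane R).

Definition clip D x : R := Order.min (Order.max x 0) D.

Lemma clip_itv D x : 0 <= D -> 0 <= clip D x <= D.
Proof.
by move=> D0; rewrite /clip ge_min lexx orbT andbT le_min D0 andbT le_max lexx orbT.
Qed.

Lemma clip_id D x : 0 <= x <= D -> clip D x = x.
Proof. by move=> /andP[x0 xD]; rewrite /clip max_l // min_l. Qed.

Lemma continuous_clip D : continuous (clip D).
Proof.
apply: min_fun_continuous; last by move=> x; exact: cvg_cst.
by apply: max_fun_continuous => x; [exact: cvg_id|exact: cvg_cst].
Qed.

Lemma continuous_pair_fun (f g : R -> R) : continuous f -> continuous g ->
  continuous (fun z : plane R => (f z.1, g z.2)).
Proof.
move=> cf cg z.
have H1 : f z'.1 @[z' --> z] --> f z.1.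
  by apply: (@cvg_comp _ _ _ (fun z : plane R => z.1) f _ (nbhs z.1)); [exact: cvg_fst|exact: cf].
have H2 : g z'.2 @[z' --> z] --> g z.2.
  by apply: (@cvg_comp _ _ _ (fun z : plane R => z.2) g _ (nbhs z.2)); [exact: cvg_snd|exact: cg].
exact: (@cvg_pair _ _ _ (nbhs z) (nbhs (f z.1)) (nbhs (g z.2)) _ _ _ _ _ H1 H2).
Qed.

(** A cadlag path is right-continuous on [0, D[ only; continued by constants it is right-continuous
    on the whole line, including at [D]. *)
Lemma clip_right_continuous D (l : R -> R) : 0 < D ->
  (forall t, 0 <= t < D -> l x @[x --> t^'+] --> l t) ->
  forall t, l (clip D s) @[s --> t^'+] --> l (clip D t).
Proof.
move=> D0 lr t; have [t0|t0] := ltP t 0.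
  apply: cvg_near_cst; near=> s; congr l.
  have s0 : s < 0 by near: s; exact: nbhs_right_lt.
  by rewrite /clip !max_r // ltW.
have [tD|tD] := ltP t D.
  rewrite clip_id ?t0 ?(ltW tD) //.
  apply: cvg_trans (lr t _); last by rewrite t0.
  apply: near_eq_cvg; near=> s.
  have sD : s < D by near: s; exact: nbhs_right_lt.
  have st : t < s by near: s; exact: nbhs_right_gt.
  by rewrite clip_id // (le_trans t0 (ltW st)) ltW.
apply: cvg_near_cst; near=> s; congr l.
have st : t < s by near: s; exact: nbhs_right_gt.
rewrite /clip [LHS]min_r; last by rewrite le_max (le_trans tD (ltW st)).
by rewrite min_r // le_max tD.
Unshelve. all: by end_near.
Qed.

End Clip.

(** The extension by zero may jump at the boundary, so right-continuity in the second coordinate is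
    used over []0, D[] only; outside this strip the function is 0. *)
Lemma measurable_square_continuous (R : realType) (D : R) (f : plane R -> R) :
  {within square D, continuous f} -> measurable_fun setT (f \_ (square D)).
Proof.
move=> /subspace_continuousP cf; set S := square D; set h := f \_ S.
have hS z : S z -> h z = f z by move=> Sz; rewrite /h patchE mem_set.
have hN z : ~ S z -> h z = 0 by move=> Sz; rewrite /h patchE memNset.
have nS z : S z -> nbhs z S.
  rewrite /S squareE => -[z1 z2]; exists (`]0, D[%classic, `]0, D[%classic) => //=.
  by split; apply: open_nbhs_nbhs; split => //; exact: itv_open.
have ch z : S z -> h z' @[z' --> z] --> h z.
  move=> Sz; rewrite hS // => Y /(cf z Sz) HY.
  have H0 : nbhs z [set z' | S z' -> Y (f z')] := HY.
  by apply: filterS2 (nS _ Sz) H0 => z' Sz' /(_ Sz'); rewrite /= hS.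
have cpt i s t : S (pt i s t) -> h (pt i s' t) @[s' --> s] --> h (pt i s t).
  move=> Sz; apply: (@cvg_comp _ _ _ (fun s' => pt i s' t) h _ (nbhs (pt i s t))).
    exact: continuous_pt.
  exact: ch.
have m1 y : measurable_fun setT (fun x => h (x, y)).
  have [yD|yD] := boolP (0 < y < D); last first.
    rewrite (_ : (fun x => _) = cst 0) //; apply/funext => x /=.
    by rewrite hN // => -[_ h']; move/negP: yD; apply.
  rewrite (_ : (fun x => _) = (fun x => h (x, y)) \_ `]0, D[); last first.
    apply/funext => x; rewrite patchE; case: ifPn => // /negP nx.
    by rewrite hN // => -[h' _]; apply: nx; apply/mem_set; rewrite /= in_itv.
  apply/(measurable_restrictT _ (measurable_itv _)).
  apply: open_continuous_measurable_fun; first exact: itv_open.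
  move=> x /set_mem /=; rewrite in_itv /= => xD; apply: (cpt false x y).
  by split.
have m2 : measurable_fun (setT `*` `]0, D[) h.
  apply: measurable_fun_right_continuous => // x y; rewrite /= in_itv /= => yD.
  have [xD|xD] := boolP (0 < x < D); last first.
    rewrite hN; last by move=> [h' _]; move/negP: xD; apply.
    rewrite (_ : (fun s => h (x, s)) = cst 0); first exact: cvg_cst.
    by apply/funext => s; rewrite hN // => -[h' _]; move/negP: xD; apply.
  by apply: cvg_at_right_filter; apply: (cpt true y x); split.
have mST : measurable (setT `*` `]0, D[ : set (plane R)) by exact: measurableX.
rewrite (_ : h = h \_ (setT `*` `]0, D[)); first exact/(measurable_restrictT _ mST).
apply/funext => z; rewrite patchE; case: ifPn => // /negP nz.
by rewrite hN // => -[_ h']; apply: nz; apply/mem_set; split => //=; rewrite in_itv.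
Qed.

Lemma measurable_energy_form d (Omega : measurableType d) (R : realType) (D : R)
    (a : Omega -> plane R -> R) u v :
    measurable_fun setT (fun p : Omega * plane R => a p.1 p.2) -> H1 D u -> H1 D v ->
  measurable_fun setT (fun w => energy_form D (a w) u v).
Proof.
move=> ma Hu Hv; suff H i : measurable_fun setT (fun w =>
    L2ip (leb2 R) (square D) (a w * wderiv D i u) (wderiv D i v)).
  by apply: measurable_funD; exact: H.
have mk x : H1 D x -> measurable_fun setT (wderiv D i x \_ (square D)).
  by move=> Hx; exact: sqint_measurable (wderiv_L2 i Hx).
pose k z := (wderiv D i u \_ (square D)) z * (wderiv D i v \_ (square D)) z.
have -> : (fun w => L2ip (leb2 R) (square D) (a w * wderiv D i u) (wderiv D i v)) =
    fun w => fine (\int[leb2 R]_z (a w z * k z)%:E)%E.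
  apply/funext => w; rewrite L2ipE; apply: eq_Rintegral => z _; rewrite /k !patchE.
  by case: ifP => _; [rewrite mulrA|rewrite !mul0r mulr0].
apply: (measurableT_comp (f := fine)); first exact: fine_measurable.
apply: (measurable_integral_leb2 (f := fun p => (a p.1 p.2 * k p.2)%:E)).
apply/measurable_EFinP; apply: measurable_funM => //.
apply: (measurableT_comp (f := k)); last exact: measurable_snd.
by apply: measurable_funM; exact: mk.
Qed.

Section RandomCoefficient.
Context d (Omega : measurableType d) (R : realType) (P : probability Omega R).
Variables (D : R) (D0 : 0 < D).
Local Notation S := (square D).

Lemma gaussian_field_measurable A (W : Omega -> plane R -> R) z :
  centered_gaussian_field P A W -> A z -> measurable_fun setT (W ^~ z).
Proof.
move=> gW Az; have [mW _] := gW 1%N (fun=> z) (fun=> 1) (fun=> Az).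
rewrite (_ : W ^~ z = fun w => \sum_(i < 1) 1 * W w z) //.
by apply/funext => w; rewrite big_ord1 mul1r.
Qed.

Lemma measurable_kill (N : set Omega) (f : Omega -> R) : measurable N ->
  measurable_fun setT f -> measurable_fun setT (fun w => if w \in N then 0 else f w).
Proof.
move=> mN mf; rewrite (_ : (fun w => _) = fun w => f w * \1_(~` N) w).
  by apply: measurable_funM => //; apply: measurable_indic; exact: measurableC.
by apply/funext => w; rewrite indicE in_setC; case: ifP => /= _; rewrite ?mulr0 ?mulr1.
Qed.

Lemma continuous_kill (U : topologicalType) (N : set Omega) w (f : U -> R) :
  (~ N w -> continuous f) -> continuous (fun x => if w \in N then 0 else f x).
Proof.
move=> cf x; have [wN|/negP nN] := boolP (w \in N); first exact: cvg_cst.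
by apply: cf => Nw; apply: nN; exact: mem_set.
Qed.

Variables (am ap : R) (abar : plane R -> R) (Phi1 Phi2 : R -> R)
  (W1 W2 : Omega -> plane R -> R) (l1 l2 : Omega -> R -> R).
Hypotheses (am0 : 0 < am) (cabar : {within S, continuous abar})
  (abarM : forall z, S z -> am <= abar z <= ap)
  (cPhi1 : continuous Phi1) (cPhi2 : continuous Phi2)
  (Phi1_ge0 : forall x, 0 <= Phi1 x) (Phi2_ge0 : forall x, 0 <= Phi2 x)
  (gW1 : centered_gaussian_field P (csquare D) W1)
  (gW2 : centered_gaussian_field P quadrant W2)
  (cW1 : continuous_paths P (csquare D) W1) (cW2 : continuous_paths P quadrant W2)
  (L1 : levy_subordinator P D l1) (L2 : levy_subordinator P D l2).
Local Notation a := (jump_diffusion abar Phi1 Phi2 W1 W2 l1 l2).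

Let regular_path (l : R -> R) := [/\ l 0 = 0,
  forall t, 0 <= t < D -> l x @[x --> t^'+] --> l t &
  forall s t, 0 <= s -> s <= t -> t <= D -> l s <= l t].

Let subordinator_regular (l : Omega -> R -> R) : levy_subordinator P D l ->
  {ae P, forall w, regular_path (l w)}.
Proof.
move=> [[_ h0 _ _ _] hc hm]; move: h0 hc hm.
apply: filterS3 => w h1 [h2 _] h3.
by split.
Qed.

(* A version of the coefficient that is jointly measurable on the whole space:
   fields and subordinators are set to [0] on an exceptional null set [N], and
   their arguments are projected to the sets where they are regular. *)
Let w1' (N : set Omega) w z := if w \in N then 0 else W1 w (clip D z.1, clip D z.2).
Let w2' (N : set Omega) w z := if w \in N then 0 else W2 w (Order.max (z : plane R).1 0, Order.max z.2 0).
Let l' (l : Omega -> R -> R) (N : set Omega) w x := if w \in N then 0 else l w (clip D x).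
Let version (N : set Omega) w z := (abar \_ S) z + Phi1 (w1' N w z) +
  Phi2 (w2' N w (l' l1 N w z.1, l' l2 N w z.2)).

Let regular w := [/\ {within csquare D, continuous (W1 w)},
    {within quadrant, continuous (W2 w)}, regular_path (l1 w) & regular_path (l2 w)].

Let regular_ae : {ae P, forall w, regular w}.
Proof.
have h12 : {ae P, forall w, {within csquare D, continuous (W1 w)} /\
    {within quadrant, continuous (W2 w)}} by move: cW1 cW2; apply: filterS2.
move: h12 (subordinator_regular L1) (subordinator_regular L2).
by apply: filterS3 => w [].
Qed.

Section Version.
Variables (N : set Omega) (mN : measurable N) (NP : forall w, ~ N w -> regular w).

Let continuous_w1' w : continuous (w1' N w).
Proof.
apply: continuous_kill => Nw; have [h1 _ _ _] := NP Nw.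
apply: (within_continuous_comp (g := fun z => (clip D z.1, clip D z.2)) h1).
  by apply: continuous_pair_fun; exact: continuous_clip.
by move=> z; split; apply: clip_itv; exact: ltW.
Qed.

Let continuous_w2' w : continuous (w2' N w).
Proof.
apply: continuous_kill => Nw; have [_ h2 _ _] := NP Nw.
apply: (within_continuous_comp (g := fun z : plane R => (Order.max z.1 0, Order.max z.2 0)) h2).
  apply: (@continuous_pair_fun _ (fun x => Order.max x 0) (fun x => Order.max x 0));
  by apply: max_fun_continuous => x; [exact: cvg_id|exact: cvg_cst].
by move=> z; split; rewrite /= le_max lexx orbT.
Qed.

Let measurable_l' l : levy_subordinator P D l -> (forall w, ~ N w -> regular_path (l w)) ->
  measurable_fun setT (fun p : Omega * R => l' l N p.1 p.2).
Proof.
move=> [[ml _ _ _ _] _ _] rl.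
rewrite -setXTT; apply: (measurable_fun_right_continuous (h := fun p => l' l N p.1 p.2)) => //=.
  move=> x; apply: measurable_kill => //; apply: ml; apply: clip_itv; exact: ltW.
move=> w x _; rewrite /l'; case: ifPn => [_|/negP Nw]; first exact: cvg_cst.
have [|_ rc _] := rl w; first by move=> Nw'; apply: Nw; exact: mem_set.
exact: clip_right_continuous.
Qed.

Let path_itv (l : Omega -> R -> R) w x : regular_path (l w) -> 0 <= x <= D -> 0 <= l w x <= l w D.
Proof.
move=> [l0 _ lm] /andP[x0 xD]; by rewrite -{1}l0 !lm.
Qed.

Lemma version_measurable : measurable_fun setT (fun p : Omega * plane R => version N p.1 p.2).
Proof.
have m1 : measurable_fun setT (fun p : Omega * plane R => w1' N p.1 p.2).
  apply: measurable_fun_caratheodory => // z.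
  apply: measurable_kill => //; apply: (gaussian_field_measurable gW1).
  by split; apply: clip_itv; exact: ltW.
have m2 : measurable_fun setT (fun p : Omega * plane R => w2' N p.1 p.2).
  apply: measurable_fun_caratheodory => // z.
  apply: measurable_kill => //; apply: (gaussian_field_measurable gW2).
  by split; rewrite /= le_max lexx orbT.
have ml1 := measurable_l' L1 (fun w Nw => let: And4 _ _ h _ := NP Nw in h).
have ml2 := measurable_l' L2 (fun w Nw => let: And4 _ _ _ h := NP Nw in h).
apply: measurable_funD; first apply: measurable_funD.
- apply: (@measurableT_comp _ _ _ _ _ _ (abar \_ S) _ (fun p : Omega * plane R => p.2)).
    exact: measurable_square_continuous.
  exact: measurable_snd.
- apply: (measurableT_comp (f := Phi1)) m1.
  exact: continuous_measurable_fun.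
- apply: (measurableT_comp (f := Phi2)); first exact: continuous_measurable_fun.
  apply: (measurableT_comp (g := fun p : Omega * plane R =>
    (p.1, (l' l1 N p.1 p.2.1, l' l2 N p.1 p.2.2))) m2).
  apply: measurable_fun_pair; first exact: measurable_fst.
  apply: measurable_fun_pair.
    apply: (measurableT_comp (g := fun p : Omega * plane R => (p.1, p.2.1)) ml1).
    apply: measurable_fun_pair; first exact: measurable_fst.
    by apply: (measurableT_comp measurable_fst); exact: measurable_snd.
  apply: (measurableT_comp (g := fun p : Omega * plane R => (p.1, p.2.2)) ml2).
  apply: measurable_fun_pair; first exact: measurable_fst.
  by apply: (measurableT_comp measurable_snd); exact: measurable_snd.
Qed.

(** Off [N] the subordinators start at 0 and do not decrease, so their values are nonnegative and
    the projections act as the identity. *)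
Lemma version_eq w z : ~ N w -> S z -> version N w z = a w z.
Proof.
move=> Nw Sz; have [_ _ r1 r2] := NP Nw.
have wN : (w \in N) = false by apply/negP => /set_mem.
have [[z10 z1D] [z20 z2D]] := (andP Sz.1, andP Sz.2).
have D1 : 0 <= z.1 <= D by rewrite !ltW.
have D2 : 0 <= z.2 <= D by rewrite !ltW.
have [/andP[p1 _] /andP[p2 _]] := (path_itv r1 D1, path_itv r2 D2).
rewrite /version /a patchE mem_set // /w1' /w2' /l' !wN /= !clip_id // !max_l //.
by case: z {Sz z10 z1D z20 z2D D1 D2 p1 p2}.
Qed.

(** By monotonicity the arguments of [W2] stay in the compact square whose side is the larger of
    [l1 w D] and [l2 w D], where the continuous path is bounded. The bound depends on the outcome;
    the lower bound comes from [abar] alone, the other two terms being nonnegative. *)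
Lemma version_bounded w : ~ N w -> exists M, forall z, S z -> am <= a w z <= M.
Proof.
move=> Nw; have [_ _ r1 r2] := NP Nw.
have wN : (w \in N) = false by apply/negP => /set_mem.
have [M1 HM1] : exists M, forall z, csquare D z -> `|Phi1 (w1' N w z)| <= M.
  apply: (@continuous_bounded_square _ D (fun z => Phi1 (w1' N w z))).
  by move=> z; apply: continuous_comp; [exact: continuous_w1'|exact: cPhi1].
pose D' := Order.max (l1 w D) (l2 w D).
have [M2 HM2] : exists M, forall z, csquare D' z -> `|Phi2 (w2' N w z)| <= M.
  apply: (@continuous_bounded_square _ D' (fun z => Phi2 (w2' N w z))).
  by move=> z; apply: continuous_comp; [exact: continuous_w2'|exact: cPhi2].
exists (ap + M1 + M2) => z Sz; rewrite -(version_eq Nw Sz).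
have [[z10 z1D] [z20 z2D]] := (andP Sz.1, andP Sz.2).
have D1 : 0 <= z.1 <= D by rewrite !ltW.
have D2 : 0 <= z.2 <= D by rewrite !ltW.
have [/andP[p1 q1] /andP[p2 q2]] := (path_itv r1 D1, path_itv r2 D2).
have /andP[ba bb] := abarM Sz.
have C1 := HM1 z (square_csquare Sz).
have C2 : `|Phi2 (w2' N w (l1 w z.1, l2 w z.2))| <= M2.
  by apply: HM2; split; rewrite /= ?p1 ?p2 /= le_max ?q1 ?q2 ?orbT.
rewrite /version patchE mem_set // /l' !wN !clip_id //.
rewrite (ger0_norm (Phi1_ge0 _)) in C1; rewrite (ger0_norm (Phi2_ge0 _)) in C2.
rewrite !lerD // andbT.
by rewrite -addrA -[am]addr0 lerD // addr_ge0.
Qed.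

Lemma version_ge0 w z : 0 <= version N w z.
Proof.
rewrite /version !addr_ge0 // patchE; case: ifPn => // /set_mem Sz.
by have /andP[h _] := abarM Sz; exact: le_trans (ltW am0) h.
Qed.

End Version.

Lemma coefficient_regular : exists a' : Omega -> plane R -> R,
  [/\ {ae P, forall w z, S z -> a' w z = a w z},
      {ae P, forall w, exists M, forall z, S z -> am <= a w z <= M},
      (forall w z, 0 <= a' w z) &
      measurable_fun setT (fun p : Omega * plane R => a' p.1 p.2)].
Proof.
have [N [mN N0 NP]] := regular_ae.
have rN w : ~ N w -> regular w by move=> Nw; apply: contrapT => nr; apply: Nw; exact: NP.
exists (version N); split.
- exists N; split => // w /= H; apply: contrapT => Nw; apply: H => z Sz.
  exact: version_eq.
- exists N; split => // w /= H; apply: contrapT => Nw; apply: H.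
  exact: version_bounded rN _ Nw.
- by move=> w z; exact: version_ge0.
- exact: version_measurable.
Qed.

End RandomCoefficient.

(** * Seminorms of semi-inner products, and measurability of scalars built from them *)

Section SemiNormBounds.
Context {R : realType} {E : lmodType R}.
Variables (B : set E) (b : E -> E -> R) (H : semi_inner B b).
Implicit Types x y : E.

Lemma si_CS_sqrt x y : B x -> B y -> `|b x y| <= Num.sqrt (b x x) * Num.sqrt (b y y).
Proof.
move=> Bx By; rewrite -sqrtrM ?(si_ge0 H) // -sqrtr_sqr ler_wsqrtr //.
exact: si_CS H _ _ Bx By.
Qed.

Lemma si_triangle x y : B x -> B y ->
  Num.sqrt (b (x + y) (x + y)) <= Num.sqrt (b x x) + Num.sqrt (b y y).
Proof.
move=> Bx By; have h := sib_sqrD H 1 Bx By; rewrite !scale1r in h.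
have s : 0 <= Num.sqrt (b x x) + Num.sqrt (b y y) by rewrite addr_ge0 ?sqrtr_ge0.
rewrite -(ger0_norm s) -sqrtr_sqr ler_wsqrtr // h sqrrD !sqr_sqrtr ?(si_ge0 H) //.
have := le_trans (ler_norm _) (si_CS_sqrt Bx By).
move: (Num.sqrt _ * _) => q; move: (b x y) (b x x) (b y y) => p r t pq; lra.
Qed.

Lemma si_sqrt_lipschitz x y : B x -> B y ->
  `|Num.sqrt (b x x) - Num.sqrt (b y y)| <= Num.sqrt (b (x - y) (x - y)).
Proof.
move=> Bx By.
have h1 := si_triangle (siB H Bx By) By; rewrite subrK in h1.
have h2 := si_triangle (siB H By Bx) Bx; rewrite subrK in h2.
have h3 : b (y - x) (y - x) = b (x - y) (x - y) by rewrite -opprB (sib_sqrN H) //; exact: siB H _ _ Bx By.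
rewrite h3 in h2; rewrite ler_norml; lra.
Qed.

(* [2 b(x, e) - b(e, e) = b(x, x) - b(x - e, x - e)]: the squared norm of [x] is
   recovered from the values [b(x, e)] alone, which the weak formulation gives
   as explicit functions of the data. *)
Lemma si_energy_sup (e : nat -> E) x : (forall k, B (e k)) -> B x ->
    (forall eps, 0 < eps -> exists k, b (x - e k) (x - e k) < eps) ->
  ereal_sup (range (fun j => (2 * b x (e j) - b (e j) (e j))%:E)) = (b x x)%:E.
Proof.
move=> Be Bx dense.
have E1 j : 2 * b x (e j) - b (e j) (e j) = b x x - b (x - e j) (x - e j).
  have := sib_sqrD H (-1) Bx (Be j); rewrite scaleN1r => ->.
  by rewrite sqrrN expr1n; ring.
apply/eqP; rewrite eq_le; apply/andP; split.
  apply: ge_ereal_sup => _ [j _ <-]; rewrite lee_fin E1 gerBl.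
  exact: (si_ge0 H) (siB H Bx (Be j)).
apply/lee_addgt0Pr => eps eps0; have [j hj] := dense _ eps0.
rewrite -leeBlDr //; apply: le_trans (ereal_sup_ubound _); last by exists j.
by rewrite E1 -EFinB lee_fin lerD2l lerN2 ltW.
Qed.

End SemiNormBounds.

Section StronglyMeasurable.
Context d (Omega : measurableType d) (R : realType) (P : probability Omega R).
Context {E : lmodType R}.
Variables (B : set E) (b : E -> E -> R) (Nm : E -> \bar R).
Hypotheses (cP : measure_is_complete P) (H : semi_inner B b).
Hypothesis NmE : forall x, B x -> Nm x = (Num.sqrt (b x x))%:E.
Variables (Z : Omega -> E) (BZ : forall w, B (Z w)).
Hypothesis sZ : strongly_measurable P B Nm Z.

Lemma strongly_measurable_norm : measurable_fun setT (fun w => Num.sqrt (b (Z w) (Z w))).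
Proof.
apply: (@strongly_measurable_lipschitz _ _ _ P _ B Nm (fun x => Num.sqrt (b x x)) 1) sZ => //.
move=> x y Bx By; rewrite mul1e NmE ?lee_fin; last exact: siB H _ _ Bx By.
exact: (si_sqrt_lipschitz H Bx By).
Qed.

Lemma strongly_measurable_functional (F : E -> R) (C : R) :
    (forall x y, B x -> B y -> F x - F y = F (x - y)) ->
    (forall x, B x -> `|F x| <= C * Num.sqrt (b x x)) ->
  measurable_fun setT (fun w => F (Z w)).
Proof.
move=> Flin Fbd.
apply: (@strongly_measurable_lipschitz _ _ _ P _ B Nm F C) sZ => //.
move=> x y Bx By; have Bxy := siB H Bx By.
by rewrite NmE // -EFinM lee_fin Flin // Fbd.
Qed.

End StronglyMeasurable.

(** * The random problem *)

Section LnormProbability.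
Context d (Omega : measurableType d) (R : realType) (P : probability Omega R).
Implicit Types (X Y : Omega -> R).

Let measurable_pow X p : measurable_fun setT X ->
  measurable_fun setT (fun w => `|X w| `^ p).
Proof.
move=> mX; apply: (@measurableT_comp _ _ _ _ _ _ (@powR R ^~ p)) => //.
exact: measurableT_comp.
Qed.

(** Hoelder's inequality for |X|^r and the constant 1, with exponent [q / r > 1] and its conjugate;
    the norm of 1 is 1 because [P] has mass 1. *)
Lemma Lnorm_probability_le X (r q : R) : measurable_fun setT X -> 0 < r -> r < q ->
  ('N[P]_r%:E[EFin \o X] <= 'N[P]_q%:E[EFin \o X])%E.
Proof.
move=> mX r0 rq; have q0 : 0 < q by exact: lt_trans rq.
pose s := q / r; pose s' := (1 - s^-1)^-1.
have s0 : 0 < s by rewrite divr_gt0.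
have s'0 : 0 < s' by rewrite /s' invr_gt0 subr_gt0 /s invf_div ltr_pdivrMr // mul1r.
have ss' : s^-1 + s'^-1 = 1 by rewrite /s' invrK subrKC.
have m1 : measurable_fun [set: Omega] (@cst _ R 1) by exact: measurable_cst.
have := hoelder P (measurable_pow r mX) m1 s0 s'0 ss'.
rewrite (@Lnorm_cst1 _ _ _ P s') [X in (X `^ _)%E](probability_setT P) poweR1r mule1 Lnorm1.
have -> : (\int[P]_x `|(EFin \o ((fun w => `|X w| `^ r)%R \* cst 1)%R) x| =
    \int[P]_x (`|X x| `^ r)%:E)%E.
  by apply: eq_integral => w _; rewrite /= mulr1 ger0_norm ?powR_ge0.
have -> : ('N[P]_s%:E[EFin \o (fun w => `|X w| `^ r)%R] =
    (\int[P]_x (`|X x| `^ q)%:E) `^ s^-1)%E.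
  rewrite unlock /Lnorm; congr (_ `^ _)%E; apply: eq_integral => w _.
  by rewrite /= norm_powR // normr_id -powRrM /s mulrCA divff ?mulr1 // gt_eqF.
move=> h; rewrite unlock /Lnorm /=.
have i0 (p : R) : (0 <= \int[P]_x (`|X x| `^ p)%:E)%E.
  by apply: integral_ge0 => w _; rewrite lee_fin powR_ge0.
have -> : q^-1 = s^-1 * r^-1 by rewrite /s invf_div mulrAC divff ?gt_eqF // mul1r.
rewrite poweRrM; apply: gt0_ler_poweR => //.
- by rewrite invr_ge0 ltW.
- by rewrite in_itv /= i0 leey.
- by rewrite in_itv /= poweR_ge0 leey.
Qed.

Lemma ae_le_Lnorm X Y (c q : R) : measurable_fun setT X -> measurable_fun setT Y ->
    0 < q -> 0 <= c -> {ae P, forall w, `|X w| <= c * `|Y w|} ->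
  ('N[P]_q%:E[EFin \o X] <= c%:E * 'N[P]_q%:E[EFin \o Y])%E.
Proof.
move=> mX mY q0 c0 XY; rewrite unlock /Lnorm /=.
have i0 (Z : Omega -> R) : (0 <= \int[P]_x (`|Z x| `^ q)%:E)%E.
  by apply: integral_ge0 => w _; rewrite lee_fin powR_ge0.
have cE : c%:E = ((c `^ q)%:E `^ q^-1)%E.
  by rewrite poweR_EFin -powRrM divff ?gt_eqF // powRr1.
rewrite [in leRHS]cE -poweRM ?lee_fin ?powR_ge0 //.
apply: gt0_ler_poweR.
- by rewrite invr_ge0 ltW.
- by rewrite in_itv /= i0 leey.
- by rewrite in_itv /= mule_ge0 ?leey ?lee_fin ?powR_ge0.
have mpow (Z : Omega -> R) : measurable_fun setT Z -> measurable_fun setT (fun w => (`|Z w| `^ q)%:E).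
  by move=> mZ; apply/measurable_EFinP; exact: measurable_pow.
have pow0 (Z : Omega -> R) w : (0 <= (`|Z w| `^ q)%:E)%E by rewrite lee_fin powR_ge0.
rewrite -(@ge0_integralZl_EFin _ _ _ P setT measurableT _ (fun w _ => pow0 Y w) (mpow _ mY))
  ?powR_ge0 //.
apply: ae_ge0_le_integral => //.
- exact: mpow.
- by move=> w _; rewrite -EFinM lee_fin mulr_ge0 // powR_ge0.
- by apply/measurable_EFinP; apply: measurable_funM => //; exact: measurable_pow.
move: XY; apply: filterS => w h _; rewrite -EFinM lee_fin -powRM //.
by apply: ge0_ler_powR; rewrite ?nnegrE ?mulr_ge0 // ltW.
Qed.

End LnormProbability.

Section RandomSolution.
Context d (Omega : measurableType d) (R : realType) (P : probability Omega R).
Hypothesis cP : measure_is_complete P.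
Variables (D : R) (D0 : 0 < D) (G1 G2 : set (plane R)).
Hypotheses (G1B : G1 `<=` bsquare D) (G1_gt0 : (0 < arclength D G1)%E).
Hypothesis (G2B : G2 `<=` bsquare D).
Local Notation S := (square D).
Local Notation al := (arclength D).
Local Notation VD := (V D G1).
Local Notation h1 := (h1_ip D).
Local Notation L2S := (L2 (leb2 R) S).
Local Notation N2S := (L2norm (leb2 R) S).
Local Notation L2G := (L2 al G2).
Local Notation N2G := (L2norm al G2).

Variables (f g : Omega -> plane R -> R).
Hypotheses (f2 : forall w, L2S (f w)) (g2 : forall w, L2G (g w)).
Hypotheses (sf : strongly_measurable P L2S N2S f) (sg : strongly_measurable P L2G N2G g).

(** For a fixed [v], each term of the load is linear in the data and bounded by Cauchy-Schwarz,
    hence Lipschitz. *)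
Lemma measurable_load v : VD v -> measurable_fun setT (fun w => load D G2 (f w) (g w) v).
Proof.
move=> Vv; have [v2 _] := V_H1 Vv; have tv := V_trace_L2 Vv.
have HS := L2_semi_inner (leb2 R) S; have HG := L2_semi_inner al G2.
have HA := sqint_semi_inner al.
apply: measurable_funD.
  apply: (strongly_measurable_functional cP HS (@L2normE _ _ _) f2 sf
    (F := fun x => L2ip (leb2 R) S x v) (C := Num.sqrt (L2ip (leb2 R) S v v))).
    by move=> x y x2 y2; rewrite (sibBl HS).
  by move=> x x2; rewrite mulrC; exact: (si_CS_sqrt HS).
apply: (strongly_measurable_functional cP HG (@L2normE _ _ _) g2 sg
  (F := fun x => ip al (x \_ G2) (trace D v \_ (bsquare D)))
  (C := Num.sqrt (ip al (trace D v \_ (bsquare D)) (trace D v \_ (bsquare D))))).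
  by move=> x y x2 y2; rewrite patchB (sibBl HA).
by move=> x x2; rewrite mulrC L2ipE; exact: (si_CS_sqrt HA).
Qed.

Variables (K am : R) (a a' : Omega -> plane R -> R).
Hypotheses (K0 : 0 < K) (PK : forall v, VD v -> h1 v v <= K * grad_ip D v v).
Hypothesis (am0 : 0 < am).
Hypothesis aa' : {ae P, forall w z, S z -> a' w z = a w z}.
Hypothesis aM : {ae P, forall w, exists M, forall z, S z -> am <= a w z <= M}.
Hypothesis ma' : measurable_fun setT (fun p : Omega * plane R => a' p.1 p.2).

Lemma coef_ae : {ae P, forall w, [/\ measurable_fun S (a w),
  (exists M, forall z, S z -> am <= a w z <= M) &
  forall u v, energy_form D (a' w) u v = energy_form D (a w) u v]}.
Proof.
move: aa' aM; apply: filterS2 => w E bd.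
have mS := measurable_square D; split => //.
  apply: (eq_measurable_fun (a' w)); first by move=> z /set_mem Sz; exact: E.
  apply: measurable_funTS; apply: (measurableT_comp (g := fun z => (w, z)) ma').
  by apply: measurable_fun_pair.
have Ep p q : L2ip (leb2 R) S (a' w * p) q = L2ip (leb2 R) S (a w * p) q.
  rewrite !L2ipE; congr (ip _ _ _); apply/funext => z; rewrite !patchE.
  by case: ifPn => // /set_mem /E Ez; rewrite !fctE Ez.
by move=> u v; rewrite /energy_form !Ep.
Qed.

Variable u : Omega -> plane R -> R.
Hypotheses (Vu : forall w, VD (u w)).
Hypothesis wu : {ae P, forall w, weak_solution D G1 G2 (a w) (f w) (g w) (u w)}.

Lemma strongly_measurable_solution : strongly_measurable P VD (H1norm D) u.
Proof.
have [e [Ve dense]] := V_dense D0 G1B.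
(* Explicit in the data and in [a'], without reference to the solution: the weak formulation has
   been used to replace the energy of [u w] against [e j] by the load at [e j]. *)
pose x k j w : \bar R := (2 * (load D G2 (f w) (g w) (e j) - energy_form D (a' w) (e k) (e j))
  - energy_form D (a' w) (e j) (e j))%:E.
have mx k j : measurable_fun setT (x k j).
  have me i j' : measurable_fun setT (fun w => energy_form D (a' w) (e i) (e j')).
    by apply: measurable_energy_form => //; exact: V_H1.
  apply/measurable_EFinP; apply: measurable_funB => //.
  by apply: measurable_funM => //; apply: measurable_funB => //; exact: measurable_load.
(* For almost every outcome the supremum is finite; the value that [fine] gives to an infinite one
   matters only on a null set. *)
pose m k w := fine (ereal_sup (range (fun j => x k j w))).
apply: (strongly_measurable_argmin (e := e) (m := m)) => //.
  move=> k; apply: (measurableT_comp (f := fine)); first exact: fine_measurable.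
  have -> : (fun w => ereal_sup (range (fun j => x k j w))) =
      (fun w => esups (fun j => x k j w) 0%N).
    apply/funext => w; congr ereal_sup; apply/seteqP; split => _ [j _ <-]; by exists j.
  exact: measurable_fun_esups.
move: coef_ae wu; apply: filterS2 => w [ma [M bd] Ea] wuw.
have [_ Hu] := (weak_solutionP D0 _ G2B ma am0 bd _ (f2 w) (g2 w)).1 wuw.
have HE := V_energy_semi_inner D0 G1 ma am0 bd.
have h1E v : VD v -> h1 v v <= K / am * energy_form D (a w) v v.
  exact: (h1_le_energy D0 ma am0 bd K0 PK).
have M0 := coef_bound_gt0 D0 am0 bd.
(* The bound [M] of this outcome may be used here, since density is asked for each outcome
   separately. *)
have denseE v eps : VD v -> 0 < eps -> exists k, energy_form D (a w) (v - e k) (v - e k) < eps.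
  move=> Vv eps0; have [|k hk] := dense v (eps / M) Vv; first by rewrite divr_gt0.
  exists k; have Vd := siB HE Vv (Ve k).
  apply: le_lt_trans (energy_form_le_h1 D0 ma am0 bd (V_H1 Vd)) _.
  by rewrite mulrC -ltr_pdivlMr.
have mE k : m k w = energy_form D (a w) (u w - e k) (u w - e k).
  have Vd := siB HE (Vu w) (Ve k).
  have E2 : (fun j => x k j w) = fun j => (2 * energy_form D (a w) (u w - e k) (e j) -
      energy_form D (a w) (e j) (e j))%:E.
    by apply/funext => j; rewrite /x !Ea (sibBl HE (Vu w) (Ve k) (Ve j)) (Hu _ (Ve j)).
  by rewrite /m E2 (si_energy_sup HE Ve Vd (fun eps => denseE _ eps Vd)).
split; first by move=> k; rewrite mE; apply: (si_ge0 HE); exact: siB HE _ _ (Vu w) (Ve k).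
split; first by move=> eps eps0; have [k hk] := denseE _ _ (Vu w) eps0; exists k; rewrite mE.
move=> kap mk; have Vd n : VD (e (kap n) - u w) by exact: siB HE _ _ (Ve _) (Vu w).
apply/(H1_cvgP (D := D) (fun n => V_H1 (Vd n))).
apply: (@squeeze_cvgr _ _ _ _ (fun=> 0) (fun n => K / am * m (kap n) w)).
- apply: nearW => n /=; rewrite h1_ip_ge0 /= mE; apply: (le_trans (h1E _ (Vd n))).
  by rewrite -opprB (sib_sqrN HE) //; exact: siB HE _ _ (Vu w) (Ve _).
- exact: cvg_cst.
- by rewrite -[X in _ --> X](mulr0 (K / am)); apply: cvgMr.
Qed.

End RandomSolution.

Theorem theorem3p6 (R : realType) (D : R) (G1 G2 : set (plane R)) (am : R)
    (D_gt0 : 0 < D) (decG : boundary_decomposition D G1 G2) (am_gt0 : 0 < am) :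
  exists C : R, 0 < C /\
    forall (d : measure_display) (Omega : measurableType d)
      (P : probability Omega R) (ap : R) (abar : plane R -> R)
      (Phi1 Phi2 : R -> R) (W1 W2 : Omega -> plane R -> R)
      (l1 l2 : Omega -> R -> R) (q : R) (f g : Omega -> plane R -> R),
    measure_is_complete P ->
    {within square D, continuous abar} ->
    (forall z, square D z -> am <= abar z <= ap) ->
    continuous Phi1 -> continuous Phi2 ->
    (forall x, 0 <= Phi1 x) -> (forall x, 0 <= Phi2 x) ->
    centered_gaussian_field P (csquare D) W1 ->
    centered_gaussian_field P quadrant W2 ->
    continuous_paths P (csquare D) W1 ->
    continuous_paths P quadrant W2 ->
    levy_subordinator P D l1 -> levy_subordinator P D l2 ->
    independent_of_fields P D l1 l2 W1 W2 ->
    1 <= q ->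
    Bochner P (L2 (leb2 R) (square D)) (L2norm (leb2 R) (square D)) q f ->
    Bochner P (L2 (arclength D) G2) (L2norm (arclength D) G2) q g ->
    let a := jump_diffusion abar Phi1 Phi2 W1 W2 l1 l2 in
    {ae P, forall w,
      (exists u, weak_solution D G1 G2 (a w) (f w) (g w) u) /\
      (forall u u', weak_solution D G1 G2 (a w) (f w) (g w) u ->
                    weak_solution D G1 G2 (a w) (f w) (g w) u' ->
                    {ae leb2 R, forall z, square D z -> u z = u' z})} /\
    (forall u : Omega -> plane R -> R,
      (forall w, V D G1 (u w)) ->
      {ae P, forall w, weak_solution D G1 G2 (a w) (f w) (g w) (u w)} ->
      forall r : R, 1 <= r -> r < q ->
        Bochner P (V D G1) (H1norm D) r u /\
        (Bochner_norm P (H1norm D) r u <=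
         C%:E * (Bochner_norm P (L2norm (leb2 R) (square D)) q f
                 + Bochner_norm P (L2norm (arclength D) G2) q g))%E).
Proof.
have [[decU _ _ _] [G1_gt0 _]] := decG.
have G1B : G1 `<=` bsquare D by move=> z Gz; rewrite -decU; left.
have G2B : G2 `<=` bsquare D by move=> z Gz; rewrite -decU; right.
have [K [K0 PK]] := V_poincare D_gt0 G1B G1_gt0.
(* [K] depends on [D] and [G1], and [load_const] on [D]: the constant is fixed before the
   probability space and the data. *)
pose C := K / am * load_const D.
have C0 : 0 < C by rewrite mulr_gt0 ?load_const_gt0 // divr_gt0.
exists C; split => // d Omega P ap abar Phi1 Phi2 W1 W2 l1 l2 q f g cP cabar abarM
  cPhi1 cPhi2 Phi1_ge0 Phi2_ge0 gW1 gW2 cW1 cW2 L1 L2 _ q1 [f2 sf fq] [g2 sg gq] a.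
have [a' [aa' aM _ ma']] := coefficient_regular D_gt0 am_gt0 cabar abarM cPhi1 cPhi2
  Phi1_ge0 Phi2_ge0 gW1 gW2 cW1 cW2 L1 L2.
have good := coef_ae aa' aM ma'; split.
  move: good; apply: filterS => w [ma [M bd] _]; split.
    exact: (weak_solution_exists D_gt0 G1B G2B ma am_gt0 bd K0 PK (f2 w) (g2 w)).
  by move=> u u'; exact: (weak_solution_uniq D_gt0 G2B ma am_gt0 bd K0 PK (f2 w) (g2 w)).
move=> u Vu wu r r1 rq.
have su : strongly_measurable P (V D G1) (H1norm D) u.
  exact: (strongly_measurable_solution cP D_gt0 G1B G2B f2 g2 sf sg K0 PK am_gt0 aa' aM ma' Vu wu).
have HS := L2_semi_inner (leb2 R) (square D); have HG := L2_semi_inner (arclength D) G2.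
pose nu w := Num.sqrt (h1_ip D (u w) (u w)).
pose nf w := Num.sqrt (L2ip (leb2 R) (square D) (f w) (f w)).
pose ng w := Num.sqrt (L2ip (arclength D) G2 (g w) (g w)).
have mnf : measurable_fun setT nf.
  exact: (strongly_measurable_norm cP HS (@L2normE _ _ _) f2 sf).
have mng : measurable_fun setT ng.
  exact: (strongly_measurable_norm cP HG (@L2normE _ _ _) g2 sg).
have mnu : measurable_fun setT nu.
  apply: (strongly_measurable_norm cP (V_semi_inner D_gt0 G1) _ Vu su) => x Vx.
  by apply: H1normE => //; exact: V_H1 Vx.
have nuE p : Bochner_norm P (H1norm D) p u = ('N[P]_p%:E[EFin \o nu])%E.
  by apply: eq_Lnorm => w /=; apply: H1normE => //; exact: V_H1 (Vu w).
have nfE p : Bochner_norm P (L2norm (leb2 R) (square D)) p f = ('N[P]_p%:E[EFin \o nf])%E.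
  by apply: eq_Lnorm => w /=; exact: L2normE.
have ngE p : Bochner_norm P (L2norm (arclength D) G2) p g = ('N[P]_p%:E[EFin \o ng])%E.
  by apply: eq_Lnorm => w /=; exact: L2normE.
have est : (Bochner_norm P (H1norm D) r u <=
    C%:E * (Bochner_norm P (L2norm (leb2 R) (square D)) q f
      + Bochner_norm P (L2norm (arclength D) G2) q g))%E.
  have r0 : 0 < r by exact: lt_le_trans r1.
  (* The exponent is raised from r to q on the solution; the pathwise bound is then integrated at
     exponent q, even though the q-norm of the solution is not yet known to be finite. *)
  rewrite nuE nfE ngE; apply: (le_trans (Lnorm_probability_le P mnu r0 rq)).
  apply: (le_trans (y := (C%:E * 'N[P]_q%:E[EFin \o (nf \+ ng)%R])%E)).
    apply: (ae_le_Lnorm mnu (measurable_funD mnf mng)) => //; [exact: lt_trans rq|exact: ltW|].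
    move: good wu; apply: filterS2 => w [ma [M bd] _] wuw.
    rewrite ger0_norm ?sqrtr_ge0 // ger0_norm ?addr_ge0 ?sqrtr_ge0 //.
    have := weak_solution_bound D_gt0 G2B ma am_gt0 bd K0 PK (f2 w) (g2 w) wuw.
    by rewrite /data_norm -L2ipE.
  by rewrite lee_pmul2l ?lte_fin //; exact: minkowski_EFin.
split => //; split => //; apply: (le_lt_trans est).
by rewrite lte_mul_pinfty ?lee_fin ?(ltW C0) // lte_add_pinfty.
Qed.
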